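(* Let $\mathbb{K}$ be a local field and let $\psi\in L^2(\mathbb{K})$ be an admissible (mother) wavelet, with admissibility constant $c_\psi=\int_{\mathbb{K}}\frac{|\hat\psi(\xi)|^2}{|\xi|}\,d\xi<\infty$. Then for all $f,g\in L^2(\mathbb{K})$, $$\int_{\mathbb{K}}\int_{\mathbb{K}} K_\psi f(a,b)\,\overline{K_\psi g(a,b)}\,\frac{da\,db}{|a|^2}=c_\psi\,(f,g)_{L^2(\mathbb{K})},$$ that is, $(K_\psi f,K_\psi g)_{L^2(\mathbb{K}\times\mathbb{K})}=c_\psi (f,g)_{L^2(\mathbb{K})}$, where $L^2(\mathbb{K}\times\mathbb{K})$ is taken with respect to the measure $|a|^{-2}\,da\,db$ (on $a\neq 0$).
   Context: A local field $\mathbb{K}$ is a locally compact, non-discrete, complete, totally disconnected topological field. $dx$ is a Haar measure on the additive group $\mathbb{K}^+$; the absolute value is defined by $d(\alpha x)=|\alpha|\,dx$ for $\alpha\ne0$, and $|0|=0$. Put $\mathfrak{D}=\{x\in\mathbb{K}:|x|\le 1\}$ and $\mathfrak{P}=\{x\in\mathbb{K}:|x|<1\}$. Fix a continuous unitary character $\chi$ of $\mathbb{K}^+$ that is trivial on $\mathfrak{D}$ but nontrivial on $\mathfrak{P}^{-1}$, and write $\chi_y(x)=\chi(xy)$. The Haar measure is normalized so that Fourier inversion and Parseval's formula hold with constant 1 (i.e. $\mathfrak{D}$ has measure 1). The Fourier transform is $\hat f(\xi)=\int_{\mathbb{K}} f(x)\overline{\chi_\xi(x)}\,dx$ for $f\in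 L^1(\mathbb{K})$, extended to a unitary operator on $L^2(\mathbb{K})$. Functions are complex valued and $(f,g)_{L^2(\mathbb{K})}=\int_{\mathbb{K}} f\overline{g}\,dx$. A function $\psi\in L^2(\mathbb{K})$ is an admissible wavelet (mother wavelet) if $c_\psi=\int_{\mathbb{K}}\frac{|\hat\psi(\xi)|^2}{|\xi|}\,d\xi<\infty$. For $a,b\in\mathbb{K}$, $a\neq0$, put $\psi_{a,b}(x)=|a|^{-1/2}\psi\left(\frac{x-b}{a}\right)$. The continuous wavelet transform of $f\in L^2(\mathbb{K})$ is $K_\psi f(a,b)=(f,\psi_{a,b})_{L^2(\mathbb{K})}=\int_{\mathbb{K}} f(x)\,|a|^{-1/2}\,\overline{\psi\left(\frac{x-b}{a}\right)}\,dx$. *)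

(* Defs.v *)
From HB Require Import structures.
From mathcomp Require Import all_boot all_order all_algebra.
From mathcomp Require Import all_classical all_reals all_analysis.
From mathcomp Require Import complex.

Set Implicit Arguments.
Unset Strict Implicit.
Unset Printing Implicit Defensive.

Import Order.TTheory GRing.Theory Num.Theory.
Import numFieldNormedType.Exports.
Import ComplexField.Normc.

Local Open Scope classical_set_scope.
Local Open Scope ring_scope.
Local Open Scope complex_scope.

(* Uniform continuity of + and - forces the uniformity of K to be the one of
   its additive topological group, so completeness of K as a uniform space is
   completeness of that group. *)
HB.mixin Record isLocalField K & GRing.Field K & UniformZmodule K := {
  local_mul_continuous : continuous (fun x : K * K => x.1 * x.2) ;
  local_inv_continuous :
    forall x : K, x != 0 -> {for x, continuous (@GRing.inv K)} ;
  local_locally_compact : locally_compact [set: K] ;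
  local_nondiscrete : ~ (forall A : set K, open A) ;
  local_complete : forall F : set_system K,
    ProperFilter F -> cauchy F -> exists x : K, F --> x ;
  local_totally_disconnected : totally_disconnected [set: K]
}.

#[short(type="localFieldType")]
HB.structure Definition LocalField :=
  {K of GRing.Field K & UniformZmodule K & isLocalField K}.

(* MathComp-Analysis only builds sigma-algebras on pointed types; [pointed K] is
   K with the point 0. *)
Definition pointed (K : localFieldType) : Type := K.
HB.instance Definition _ (K : localFieldType) := Choice.on (pointed K).
HB.instance Definition _ (K : localFieldType) :=
  isPointed.Build (pointed K) (0 : K).

Notation borel K := (g_sigma_algebraType (@open K : set (set (pointed K)))).

Section complex_functions.
Context {d : measure_display} {T : measurableType d} {R : realType}.
Implicit Types (m : set T -> \bar R) (D : set T) (f g : T -> R[i]).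

Definition cmeasurable D f :=
  measurable_fun D (fun x => complex.Re (f x)) /\
  measurable_fun D (fun x => complex.Im (f x)).

Definition cintegral m D f : R[i] :=
  fine (\int[m]_(x in D) (complex.Re (f x))%:E)%E
  +i* fine (\int[m]_(x in D) (complex.Im (f x))%:E)%E.

(* Elements of L^1 and L^2 are handled through representatives. *)
Definition inL1 m f :=
  cmeasurable setT f /\ (\int[m]_x (normc (f x))%:E < +oo)%E.

Definition inL2 m f :=
  cmeasurable setT f /\ (\int[m]_x (normc (f x) ^+ 2)%:E < +oo)%E.

Definition L2dot m f g : R[i] := cintegral m setT (fun x => f x * (g x)^*).

End complex_functions.

Section wavelets.
Context {R : realType} {K : localFieldType}.
Implicit Types (mu : set (borel K) -> \bar R) (absK : K -> R) (chi : K -> R[i])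
  (f g psi : K -> R[i]).

Definition is_haar mu :=
  [/\ (forall (x : K) (A : set K), measurable (A : set (borel K)) ->
         mu [set x + y | y in A] = mu A),
      mu setT != 0%E,
      (forall A : set K, compact A -> (mu A < +oo)%E),
      (forall A : set K, measurable (A : set (borel K)) ->
         mu A = ereal_inf [set mu U | U in [set U : set K | open U /\ A `<=` U]])
    & (forall U : set K, open U ->
         mu U = ereal_sup
                  [set mu A | A in [set A : set K | compact A /\ A `<=` U]])].

Definition is_absolute_value mu absK :=
  absK 0 = 0 /\
  forall a : K, a != 0 -> forall A : set K, measurable (A : set (borel K)) ->
    mu [set a * x | x in A] = ((absK a)%:E * mu A)%E.

Definition ringD absK : set K := [set x | absK x <= 1].
Definition idealP absK : set K := [set x | absK x < 1].

(* The fractional ideal inverse to P; it is not the set of inverses of the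
   elements of P. *)
Definition idealPinv absK : set K :=
  [set x | forall y, idealP absK y -> ringD absK (x * y)].

Definition is_basic_character absK chi :=
  [/\ continuous (chi : K -> R[i]^o),
      (forall x y, chi (x + y) = chi x * chi y),
      (forall x, `|chi x| = 1),
      (forall x, ringD absK x -> chi x = 1)
    & (exists2 x, idealPinv absK x & chi x != 1)].

Definition fourierL1 mu chi f (xi : K) : R[i] :=
  cintegral mu setT (fun x : borel K => f x * (chi (x * xi))^*).

(* The extension by continuity of [fourierL1] from the dense subspace
   L^1 \cap L^2 to L^2, as a relation between representatives: F represents the
   Fourier transform of f. *)
Definition is_fourierL2 mu chi f F :=
  [/\ inL2 mu f, inL2 mu F &
    exists u : nat -> K -> R[i],
    [/\ (forall n, inL1 mu (u n) /\ inL2 mu (u n)),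
        (fun n => \int[mu]_x (normc (u n x - f x) ^+ 2)%:E)%E @ \oo --> 0%E
      & (fun n => \int[mu]_x (normc (fourierL1 mu chi (u n) x - F x) ^+ 2)%:E)%E
          @ \oo --> 0%E]].

Definition admissibility_constant mu absK (psihat : K -> R[i]) : \bar R :=
  (\int[mu]_(xi in [set xi | xi != 0%R]) (normc (psihat xi) ^+ 2 / absK xi)%:E)%E.

(* psihat represents the L^2 Fourier transform of psi. *)
Definition admissible_wavelet mu absK chi psi psihat :=
  is_fourierL2 mu chi psi psihat /\
  (admissibility_constant mu absK psihat < +oo)%E.

Definition dilated absK psi (a b : K) (x : K) : R[i] :=
  ((Num.sqrt (absK a))^-1)%:C * psi ((x - b) / a).

Definition wavelet_transform mu absK psi f (a b : K) : R[i] :=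
  L2dot mu (f : borel K -> R[i]) (dilated absK psi a b).

(* The measure |a|^-2 da db on {(a, b) | a != 0}.  As K is second countable,
   the product sigma-algebra is the Borel sigma-algebra of K * K. *)
Definition wavelet_measure mu absK (A : set (borel K * borel K)) : \bar R :=
  (\int[mu \x mu]_(p in A `&` [set p | p.1 != 0%R]) ((absK p.1 ^+ 2)^-1)%:E)%E.

End wavelets.

(* Main.v *)
(* On test functions f (locally constant with compact support) inversion is an
   explicit computation with the characteristic functions of discs, and Parseval
   follows. Test functions are dense, so the Fourier transform is an isometry on
   the intersection of L^1 and L^2. For a test function f, Parseval gives
     W f(a, b) = |a|^(1/2) \int fhat(xi) conj(psihat(a xi)) chi(b xi) dxi,
   which is, in b, the inverse Fourier transform of an element of L^1 and L^2.
   By Plancherel in b and Tonelli,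
     \int\int |W f(a, b)|^2 da db / |a|^2
       = \int |fhat(xi)|^2 (\int |psihat(a xi)|^2 da / |a|) dxi,
   and the inner integral is c_psi for every xi <> 0 because da / |a| is invariant
   under dilations. Density and Fatou's lemma extend the isometry to L^2, and
   polarization gives the inner products. The structure of the local field that
   this needs (ultrametric inequality, compact discs forming a countable base) is
   read off the Haar measure and the character. *)

Require Import Defs.
From HB Require Import structures.
From mathcomp Require Import all_boot all_order all_algebra.
From mathcomp Require Import all_classical all_reals all_analysis.
From mathcomp Require Import measurable_realfun complex ring lra.

Set Implicit Arguments.
Unset Strict Implicit.
Unset Printing Implicit Defensive.

Import Order.TTheory GRing.Theory Num.Theory.
Import numFieldNormedType.Exports.

Local Open Scope classical_set_scope.
Local Open Scope complex_scope.
Local Open Scope ring_scope.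
Import ComplexField.Normc.

(** * Topology of a local field *)

(** Norms enter only as the squared norm [sqL2]. The triangle and Cauchy-Schwarz inequalities are
    replaced by bounds with a free weight [t], such as $|zw| \le t|z|^2 + t^{-1}|w|^2$, and a good
    choice of [t] restores the sharp limit. Plancherel and the wavelet isometry are extended from
    test functions by the same lemma, [sqL2_limit]: the limit function is given beforehand by an
    integral, so pointwise convergence of the images identifies it and no completeness of $L^2$ is
    invoked. Since [psi] has only an $L^2$ transform, the Fourier formula for its coefficients is
    proved for integrable wavelets and carried to [psi] along the approximating sequence contained
    in [is_fourierL2]. Tonelli requires sigma-finiteness, and joint measurability of the field
    operations requires a countable base; both come from a sequence of compact discs exhausting the
    field. *)

Lemma unif_continuous_continuous (U V : uniformType) (f : U -> V) :
  unif_continuous f -> continuous f.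
Proof.
move=> uf x A /nbhsP[E entE EA].
have := nbhs_entourage x (uf _ entE); apply: filterS => y /xsectionP Ey.
by apply: EA; apply/xsectionP.
Qed.

Section local_field_topology.
Context {K : localFieldType}.
Implicit Types (x y a b : K) (A B U : set K).

(** Connected components are closed, so total disconnectedness makes points closed; a uniform space
    is regular, and a regular space with closed points is Hausdorff. *)
Lemma localfield_hausdorff : hausdorff_space K.
Proof.
have cl1 x : closed [set x].
  rewrite -(@local_totally_disconnected K x I).
  by apply: component_closed; exact: closedT.
move=> x y xy; apply: contrapT => /eqP; rewrite eq_sym => yx.
have oy : open (~` [set y]) by exact: closed_openC.
have /uniform_regular[B Bx clB] : nbhs x (~` [set y]).
  by apply: open_nbhs_nbhs; split => //= xyE; rewrite xyE eqxx in yx.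
suff cBy : closure B y by have /(_ erefl) := clB _ cBy.
by move=> C yC; exact: xy.
Qed.

Lemma localfield_closed1 x : closed [set x].
Proof. by apply: compact_closed; [exact: localfield_hausdorff|exact: compact_set1]. Qed.

Lemma localfield_compact_nbhs0 : exists2 C : set K, nbhs 0 C & compact C.
Proof.
have [C C0 [cC _]] := @local_locally_compact K 0 I.
by exists C => //; have : nbhs (0 : K) (fun t => [set: K] t -> C t) := C0; apply: filterS => x; apply.
Qed.

Lemma localfield_add_continuous : continuous (fun x : K * K => x.1 + x.2).
Proof. exact/unif_continuous_continuous/add_unif_continuous. Qed.

Lemma localfield_sub_continuous : continuous (fun x : K * K => x.1 - x.2).
Proof. exact/unif_continuous_continuous/sub_unif_continuous. Qed.

Lemma addl_continuous a : continuous (fun x => a + x).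
Proof.
move=> x; apply: (@continuous_comp _ _ _ (fun x => (a, x)) (fun z : K * K => z.1 + z.2)).
  by apply: cvg_pair => /=; [exact: cvg_cst|exact: cvg_id].
exact: localfield_add_continuous.
Qed.

Lemma mull_continuous a : continuous (fun x => a * x).
Proof.
move=> x; apply: (@continuous_comp _ _ _ (fun x => (a, x)) (fun z : K * K => z.1 * z.2)).
  by apply: cvg_pair => /=; [exact: cvg_cst|exact: cvg_id].
exact: local_mul_continuous.
Qed.

Lemma addl_imageE a A : [set a + x | x in A] = (fun x => - a + x) @^-1` A.
Proof.
apply/seteqP; split=> [_ [x Ax <-]|x Ax] /=; first by rewrite addKr.
by exists (- a + x) => //; rewrite addNKr.
Qed.

Lemma mull_imageE a A : a != 0 -> [set a * x | x in A] = (fun x => a^-1 * x) @^-1` A.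
Proof.
move=> a0; apply/seteqP; split=> [_ [x Ax <-]|x Ax] /=; first by rewrite mulKf.
by exists (a^-1 * x) => //; rewrite mulVKf.
Qed.

Lemma open_addl a A : open A -> open [set a + x | x in A].
Proof. by rewrite addl_imageE => oA; apply: open_comp => // x _; exact: addl_continuous. Qed.

Lemma open_mull a A : a != 0 -> open A -> open [set a * x | x in A].
Proof.
by move=> a0; rewrite mull_imageE// => oA; apply: open_comp => // x _; exact: mull_continuous.
Qed.

Lemma open_measurableK U : open U -> measurable (U : set (borel K)).
Proof. exact: sub_sigma_algebra. Qed.

Lemma closed_measurableK U : closed U -> measurable (U : set (borel K)).
Proof.
by move=> cU; rewrite -[U]setCK; apply: measurableC; apply: open_measurableK; exact: closed_openC.
Qed.

Lemma compact_measurableK U : compact U -> measurable (U : set (borel K)).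
Proof. by move=> cU; apply: closed_measurableK; apply: compact_closed => //; exact: localfield_hausdorff. Qed.

Lemma continuous_measurableK (f : K -> K) : continuous f ->
  measurable_fun setT (f : borel K -> borel K).
Proof.
move=> cf; apply: (@measurability _ _ (borel K) (borel K) setT f (@open K : set (set (pointed K))) (erefl _)).
move=> _ [U oU <-]; rewrite setTI; apply: open_measurableK.
by apply: open_comp => // x _; exact: cf.
Qed.

(* The tube lemma for multiplication by a compact set, at [a = 0]. *)
Lemma nbhs0_mul_compact (C U : set K) : compact C -> nbhs 0 U ->
  \forall a \near (0 : K), [set a * x | x in C] `<=` U.
Proof.
move=> cC U0.
have /compact_near_coveringP/(_ _ (nbhs (0 : K)) (fun a x => U (a * x)) _) := cC.
have h x : C x -> \forall x' \near x & a \near (0:K), U (a * x').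
  move=> _; have /= : (fun z : K * K => z.1 * z.2) @ (0 : K, x) --> (0 : K).
    by have := @local_mul_continuous K (0, x); rewrite /continuous_at /= mul0r.
  move=> /(_ _ U0) [[V1 V2] [/= n1 n2] h].
  exists (V2, V1) => //= -[y b] [/= yV bV].
  by apply: (h (b, y)).
move=> /(_ h); apply: filterS => a h' _ [x Cx <-]; exact: h'.
Qed.

End local_field_topology.

(** * The absolute value *)

(** Compactness in its near-covering form, with finite lists ordered by inclusion as the auxiliary
    filter: near [x], every list containing [x] works, so one list works for all of [C]. *)
Lemma compact_finite_translates {K : localFieldType} (C U : set K) :
  compact C -> nbhs 0 U ->
  exists s : seq K, C `<=` [set x | exists2 y, y \in s & U (x - y)].
Proof.
move=> /compact_near_coveringP cC U0.
pose F : set_system (seq K) :=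
  filter_from [set: seq K] (fun s => [set t : seq K | {subset s <= t}]).
have FF : Filter F.
  apply: filter_from_filter; first by exists [::].
  move=> s t _ _; exists (s ++ t) => // u st.
  by split=> x xs; apply: st; rewrite mem_cat xs ?orbT.
have [x Cx|s _ h] := cC _ F (fun s x => exists2 y, y \in s & U (x - y)) FF.
  exists ((fun y => - x + y) @^-1` U, [set t : seq K | {subset [:: x] <= t}]).
    split=> /=; last by exists [:: x].
    by apply: addl_continuous; rewrite addNr.
  move=> [y t] /= [Uy xt]; exists x; first by apply: xt; rewrite mem_head.
  by rewrite addrC.
by exists s; apply: h.
Qed.

Record normalized_haar {R : realType} {K : localFieldType}
    (mu : {measure set (borel K) -> \bar R}) (absK : K -> R) (chi : K -> R[i]) : Prop := {
  nh_haar : is_haar mu ;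
  nh_abs : is_absolute_value mu absK ;
  nh_norm : mu (ringD absK) = 1%E ;
  nh_char : is_basic_character absK chi }.

Section absolute_value.
Context {R : realType} {K : localFieldType}.
Context {mu : {measure set (borel K) -> \bar R}} {absK : K -> R} {chi : K -> R[i]}.
Context (H : normalized_haar mu absK chi).
Implicit Types (a b x y : K) (A C U : set K).

Lemma haar_addl a A : measurable (A : set (borel K)) -> mu [set a + x | x in A] = mu A.
Proof. by have [h _ _ _ _] := nh_haar H; exact: h. Qed.

Lemma haar_mull a A : a != 0 -> measurable (A : set (borel K)) ->
  mu [set a * x | x in A] = ((absK a)%:E * mu A)%E.
Proof. have [_ h] := nh_abs H; move=> a0; exact (h a a0 A). Qed.

Lemma haar_compact_lty C : compact C -> (mu C < +oo)%E.
Proof. by have [_ _ h _ _] := nh_haar H; exact: h. Qed.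

(** If [U] were null, finitely many null translates would cover any compact set, and inner
    regularity would make the whole space null. *)
Lemma haar_open_gt0 U : open U -> U !=set0 -> (0 < mu U)%E.
Proof.
move=> oU [u Uu]; rewrite lt0e measure_ge0 andbT; apply/negP => /eqP U0.
have [_ muT _ _ inner] := nh_haar H; move/eqP: muT; apply.
pose V := [set - u + x | x in U].
have oV : open V by exact: open_addl.
have V0 : mu V = 0%E by rewrite /V haar_addl//; exact: open_measurableK.
rewrite inner; last exact: openT.
apply/le_anti/andP; split; last first.
  by apply: ereal_sup_ubound; exists set0; rewrite ?measure0//; split=> //; exact: compact0.
apply: ge_ereal_sup => _ [C [cC _] <-].
have [s Cs] : exists s : seq K, C `<=` [set x | exists2 y, y \in s & V (x - y)].
  apply: compact_finite_translates => //; apply: open_nbhs_nbhs; split => //.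
  by exists u => //; rewrite addNr.
have mC := compact_measurableK cC.
(* Removing one open translate from [C] leaves a compact set covered by the remaining ones, hence
   the induction over all [C]. *)
elim: s C cC mC Cs => [|y s ih] C cC mC Cs.
  suff -> : C = set0 by rewrite measure0.
  by apply/seteqP; split=> // x /Cs[].
pose Vy := [set y + x | x in V].
have oVy : open Vy by exact: open_addl.
have mVy := open_measurableK oVy.
have muVy : mu Vy = 0%E by rewrite haar_addl//; exact: open_measurableK.
have mCV : measurable (C `\` Vy : set (borel K)) by exact: measurableD.
apply: (@le_trans _ _ (mu ((C `\` Vy) `|` Vy))).
  apply: le_measure; rewrite ?inE//; first exact: measurableU.
  by move=> x Cx; have [?|?] := pselect (Vy x); [right|left].
apply: (@le_trans _ _ (mu (C `\` Vy) + mu Vy)%E); first exact: measureU2.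
rewrite muVy adde0.
apply: ih => //.
  apply: (subclosed_compact _ cC) => [|x []//].
  apply: closedI; first by apply: compact_closed => //; exact: localfield_hausdorff.
  by exact: open_closedC.
move=> x [Cx Vx]; have [z] := Cs x Cx.
rewrite inE => /orP[/eqP -> Vxy|]; last by exists z.
by case: Vx; exists (x - y) => //; rewrite addrC subrK.
Qed.

(** A reference set of finite positive measure: [absK] is read off as the ratio between the measures
    of its dilates and its own. *)
Lemma compact_nbhs0_measure :
  exists C, [/\ nbhs 0 C, compact C & exists2 c : R, 0 < c & mu C = c%:E].
Proof.
have [C C0 cC] := @localfield_compact_nbhs0 K.
exists C; split => //.
have : (0 < mu C)%E.
  apply: (@lt_le_trans _ _ (mu (interior C))).
    by apply: haar_open_gt0; [exact: open_interior|exists 0].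
  apply: le_measure; rewrite ?inE; last exact: interior_subset.
    by apply: open_measurableK; exact: open_interior.
  exact: compact_measurableK.
have := haar_compact_lty cC.
case: (mu C) => // c _ c0; exists c => //; by rewrite -lte_fin.
Qed.

Lemma absK0 : absK 0 = 0. Proof. by have [] := nh_abs H. Qed.

Lemma absK_gt0 a : a != 0 -> 0 < absK a.
Proof.
move=> a0; have [C [C0 cC [c c0 muC]]] := compact_nbhs0_measure.
have : (0 < mu [set (a * x)%R | x in C])%E.
  apply: (@lt_le_trans _ _ (mu [set (a * x)%R | x in (interior C)])).
    apply: haar_open_gt0; first by apply: open_mull => //; exact: open_interior.
    by exists (a * 0); exists 0.
  have oC : open [set a * x | x in (interior C)] by apply: open_mull => //; exact: open_interior.
  apply: le_measure; rewrite ?inE.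
  - exact: open_measurableK.
  - apply: compact_measurableK; apply: continuous_compact => //.
    by apply: continuous_subspaceT; exact: mull_continuous.
  - by apply: image_subset; exact: interior_subset.
by rewrite haar_mull ?muC//; [rewrite lte_fin pmulr_lgt0|exact: compact_measurableK].
Qed.

Lemma absK_ge0 a : 0 <= absK a.
Proof. by have [->|/absK_gt0/ltW//] := eqVneq a 0; rewrite absK0. Qed.

Lemma absK_eq0 a : (absK a == 0) = (a == 0).
Proof.
by have [->|a0] := eqVneq a 0; rewrite ?absK0 ?eqxx//; apply/gt_eqF; exact: absK_gt0.
Qed.

Lemma measurable_mull a A : a != 0 -> measurable (A : set (borel K)) ->
  measurable ([set a * x | x in A] : set (borel K)).
Proof.
move=> a0 mA; rewrite mull_imageE// -[X in measurable X]setTI.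
by apply: (continuous_measurableK (@mull_continuous K _)).
Qed.

(** Dilating the reference set by [a * b], or by [b] and then [a], gives the same set; its finite
    positive measure cancels. *)
Lemma absKM a b : absK (a * b) = absK a * absK b.
Proof.
have [->|a0] := eqVneq a 0; first by rewrite !(mul0r, absK0).
have [->|b0] := eqVneq b 0; first by rewrite !(mulr0, absK0).
have [C [C0 cC [c c0 muC]]] := compact_nbhs0_measure.
have mC := compact_measurableK cC.
have : mu [set a * b * x | x in C] = mu [set a * x | x in [set b * x | x in C]].
  congr (mu _); apply/seteqP; split=> [_ [x Cx <-]|_ [_ [x Cx <-] <-]].
    by exists (b * x); rewrite ?mulrA//; exists x.
  by exists x; rewrite ?mulrA.
rewrite !haar_mull ?mulf_neq0// ?muC; last exact: measurable_mull.
by rewrite muleA -!EFinM => -[] /(mulIf (lt0r_neq0 c0)).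
Qed.

Lemma absK1 : absK 1 = 1.
Proof.
have /lt0r_neq0 := absK_gt0 (oner_neq0 K).
by move=> h; apply: (mulfI h); rewrite -absKM !mulr1.
Qed.

Lemma absKV a : absK a^-1 = (absK a)^-1.
Proof.
have [->|a0] := eqVneq a 0; first by rewrite !(invr0, absK0).
have h : absK a != 0 by rewrite absK_eq0.
by apply: (mulfI h); rewrite -absKM !divff// absK1.
Qed.

Lemma absKX a n : absK (a ^+ n) = absK a ^+ n.
Proof. by elim: n => [|n ih]; rewrite ?absK1// !exprS absKM ih. Qed.

Lemma chiD x y : chi (x + y) = chi x * chi y.
Proof. by have [_ h _ _ _] := nh_char H; exact: h. Qed.

Lemma normr_chi x : `|chi x| = 1.
Proof. by have [_ _ h _ _] := nh_char H; exact: h. Qed.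

Lemma chi_D x : absK x <= 1 -> chi x = 1.
Proof. by have [_ _ _ h _] := nh_char H; exact: h. Qed.

Lemma chi0 : chi 0 = 1.
Proof. by apply: chi_D; rewrite absK0. Qed.

Lemma chi_neq0 x : chi x != 0.
Proof. by rewrite -normr_gt0 normr_chi. Qed.

Lemma chiN x : chi (- x) = (chi x)^*.
Proof.
apply: (mulfI (chi_neq0 x)); rewrite -chiD subrr chi0.
by rewrite -[RHS]sqr_normc normr_chi expr1n.
Qed.

(* D is its own dual; this makes D a subgroup, and so yields the ultrametric
   inequality without van Dantzig's theorem. *)
Lemma chi_dual x : (forall y, absK y <= 1 -> chi (x * y) = 1) -> absK x <= 1.
Proof.
move=> h; rewrite leNgt; apply/negP => x1.
have [_ _ _ _ [z zP /eqP]] := nh_char H; apply.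
have x0 : x != 0 by apply: contraTneq x1 => ->; rewrite absK0 ltr10.
have /h : absK (z / x) <= 1.
  by apply: zP; rewrite /idealP /= absKV invf_lt1// (lt_trans ltr01).
by rewrite mulrC divfK.
Qed.

Lemma absK_add_le1 x y : absK x <= 1 -> absK y <= 1 -> absK (x + y) <= 1.
Proof.
move=> x1 y1; apply: chi_dual => z z1; rewrite mulrDl chiD !chi_D ?mulr1//.
- by rewrite absKM mulr_ile1// absK_ge0.
- by rewrite absKM mulr_ile1// absK_ge0.
Qed.

Lemma absKN x : absK (- x) = absK x.
Proof.
have h : absK (-1) ^+ 2 == 1 by rewrite -absKX sqrrN expr1n absK1.
by move: h; rewrite sqrp_eq1 ?absK_ge0// => /eqP h; rewrite -mulN1r absKM h mul1r.
Qed.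

Lemma absK_add x y t : absK x <= t -> absK y <= t -> absK (x + y) <= t.
Proof.
wlog xy : x y / absK y <= absK x.
  move=> h xt yt; have [|] := leP (absK y) (absK x); first by move=> ?; exact: h.
  by move=> /ltW ?; rewrite addrC; exact: h.
move=> xt _; apply: (le_trans _ xt).
have [x0|x0] := eqVneq x 0.
  by move: xy; rewrite x0 absK0 add0r.
have := absK_gt0 x0 => ax.
(* Dividing by the larger summand [x] brings both terms into the unit disc, where [absK_add_le1]
   applies. *)
rewrite -[X in X + y](divfK x0) -[y](divfK x0) -mulrDl absKM ger_pMl//.
by apply: absK_add_le1; rewrite ?divff// ?absK1// absKM absKV ler_pdivrMr// mul1r.
Qed.

Lemma absK_sub x y t : absK x <= t -> absK y <= t -> absK (x - y) <= t.
Proof. by move=> xt yt; apply: absK_add; rewrite ?absKN. Qed.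

(** Dilations fix $\{0\}$. A positive mass there would force $|a|=1$ for all $a\ne0$, so [D] would
    be the whole field and [chi] trivial, against the choice of the character. *)
Lemma haar_set0 : mu [set 0] = 0%E.
Proof.
have m0 : measurable ([set 0] : set (borel K)) by apply: closed_measurableK; exact: localfield_closed1.
have m0fin : (mu [set (0%R : K)] < +oo)%E by apply: haar_compact_lty; exact: compact_set1.
apply/eqP; apply/negPn/negP => mu0.
have abs1 a : a != 0 -> absK a = 1.
  move=> a0; have : mu [set a * x | x in [set 0]] = mu [set 0].
    by rewrite image_set1 mulr0.
  rewrite haar_mull//.
  have m0f : mu [set 0] \is a fin_num by rewrite ge0_fin_numE.
  rewrite -(fineK m0f) in mu0 *; rewrite -EFinM => -[] /(canRL (mulfK mu0)) ->.
  by rewrite divff.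
have [_ _ _ _ [z _ /eqP]] := nh_char H; apply; apply: chi_D.
by have [->|/abs1 ->//] := eqVneq z 0; rewrite absK0.
Qed.

(** Otherwise the interior of [U] would be $\{0\}$, open and hence of positive measure, against
    [haar_set0]. *)
Lemma exists_small (U : set K) : nbhs 0 U -> exists2 a, a != 0 & U a.
Proof.
move=> U0; apply: contrapT => h.
have : (0 < mu (interior U))%E by apply: haar_open_gt0; [exact: open_interior|exists 0].
suff -> : (interior U) = [set 0] by rewrite haar_set0 ltxx.
apply/seteqP; split=> [x /interior_subset Ux|_ ->//].
by apply: contrapT => /eqP x0; apply: h; exists x.
Qed.

(** Outer regularity at the null point 0 gives an open [U] with measure below [e * c]. For small [a]
    the dilate of the reference set lies in [U], whence $|a|c < ec$. *)
Lemma nbhs0_absK_lt (e : R) : 0 < e -> \forall a \near (0 : K), absK a < e.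
Proof.
move=> e0; have [C [C0 cC [c c0 muC]]] := compact_nbhs0_measure.
have [_ _ _ outer _] := nh_haar H.
have := outer [set 0] (closed_measurableK (@localfield_closed1 K 0)).
rewrite haar_set0 => inf0.
have : (ereal_inf [set mu U | U in [set U : set K | open U /\ [set 0%R] `<=` U]] < (e * c)%:E)%E.
  by rewrite -inf0 lte_fin mulr_gt0.
move=> /ereal_inf_lt [_ [U [oU U0] <-] muU].
have /(nbhs0_mul_compact cC) : nbhs 0 U by apply: open_nbhs_nbhs; split => //; exact: U0.
apply: filterS => a aCU; have [->|a0] := eqVneq a 0; first by rewrite absK0.
have mC := compact_measurableK cC.
have : ((absK a)%:E * c%:E < (e * c)%:E)%E.
  rewrite -muC -haar_mull//; apply: le_lt_trans muU; apply: le_measure => //; rewrite inE.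
    exact: measurable_mull.
  exact: open_measurableK.
by rewrite -EFinM lte_fin ltr_pM2r.
Qed.

Definition disc (t : R) : set K := [set x | absK x <= t].

Lemma disc_mull a t : a != 0 -> [set a * x | x in disc t] = disc (absK a * t).
Proof.
move=> a0; rewrite mull_imageE//; apply/funext => x; apply/propext.
rewrite /disc/= absKM absKV [_ * absK x]mulrC.
by rewrite ler_pdivrMr ?absK_gt0// [t * _]mulrC.
Qed.

(** Discs of positive radius are neighbourhoods of 0 by [nbhs0_absK_lt]. Openness of discs and
    measurability of locally constant functions both rest on this. *)
Lemma open_disc_invariant A t : 0 < t ->
  (forall x y, A x -> absK y <= t -> A (x + y)) -> open A.
Proof.
move=> t0 hA; rewrite openE => x Ax; rewrite /interior.
have : nbhs 0 (disc t) by apply: filterS (nbhs0_absK_lt t0) => y /ltW.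
have cx := @addl_continuous K (- x) x; rewrite /continuous_at addNr in cx.
move=> /cx Dx; have {Dx} : nbhs x [set y | disc t (- x + y)] := Dx.
by apply: filterS => y /=; rewrite /disc/= => /(hA _ _ Ax); rewrite addNKr.
Qed.

Lemma open_disc t : 0 < t -> open (disc t).
Proof. by move=> t0; apply: (@open_disc_invariant _ t) => // x y; exact: absK_add. Qed.

Lemma measurable_disc t : measurable (disc t : set (borel K)).
Proof.
have [t0|t0|<-] := ltgtP 0 t; first by apply: open_measurableK; exact: open_disc.
  suff -> : disc t = set0 by exact: measurable0.
  by apply/seteqP; split=> // x; rewrite /disc /= leNgt (lt_le_trans t0)// absK_ge0.
suff -> : disc 0 = [set 0] by apply: closed_measurableK; exact: localfield_closed1.
apply/seteqP; split=> [x|x ->]; rewrite /disc /= ?absK0// => h.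
by apply/eqP; rewrite -absK_eq0; apply/eqP/le_anti; rewrite h absK_ge0.
Qed.

Lemma measurable_absK : measurable_fun setT (absK : borel K -> R).
Proof.
apply: (measurability _ (RGenOInfty.measurableE R)).
move=> _ [_ [t ->] <-]; rewrite setTI -[X in measurable X]setCK.
apply: measurableC.
suff -> : ~` (absK @^-1` `]t, +oo[) = disc t by exact: measurable_disc.
by apply/seteqP; split=> x; rewrite /disc/= in_itv/= andbT leNgt => /negP.
Qed.

Lemma haar_disc a : a != 0 -> mu (disc (absK a)) = (absK a)%:E.
Proof.
move=> a0; rewrite -[in LHS](mulr1 (absK a)) -disc_mull// haar_mull//; last exact: measurable_disc.
by rewrite (nh_norm H) mule1.
Qed.

(* A compact C in D with mu C > 1/2 meets all its translates by elements of D,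
   so D = C - C. *)
Lemma compact_disc1 : compact (disc 1).
Proof.
have [_ _ _ _ inner] := nh_haar H.
have : ((2^-1)%:E < ereal_sup [set mu C | C in [set C : set K | compact C /\ C `<=` disc 1]])%E.
  by rewrite -inner ?(nh_norm H) ?lte_fin; [lra|exact: open_disc].
move=> /ereal_sup_gt [_ [C [cC CD] <-] muC].
suff -> : disc 1 = [set z.1 - z.2 | z in C `*` C].
  apply: continuous_compact; last exact: compact_setX.
  by apply: continuous_subspaceT; exact: localfield_sub_continuous.
apply/seteqP; split=> [x xD|_ [[y z] [/= /CD yD /CD zD] <-]]; last exact: absK_sub.
have mC := compact_measurableK cC.
have mxC : measurable ([set x + y | y in C] : set (borel K)).
  apply: compact_measurableK; apply: continuous_compact => //.
  by apply: continuous_subspaceT; exact: addl_continuous.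
apply: contrapT => h.
have dis : C `&` [set x + y | y in C] = set0.
  apply/seteqP; split=> // y [Cy [z Cz zy]]; apply: h; exists (y, z) => //=.
  by rewrite -zy addrK.
have : (mu (C `|` [set (x + y)%R | y in C]) <= mu (disc 1))%E.
  apply: le_measure; rewrite ?inE//; [exact: measurableU|exact: measurable_disc|].
  move=> y [/CD//|[z /CD zD <-]]; exact: absK_add.
have -> : mu (C `|` [set x + y | y in C]) = (mu C + mu [set (x + y)%R | y in C])%E.
  exact: measureU.
rewrite (nh_norm H) haar_addl//.
apply/negP; rewrite -ltNge (_ : 1%E = (2^-1 + 2^-1 : R)%:E); last by congr (_%:E); lra.
by rewrite EFinD lteD.
Qed.

Lemma compact_disc a : a != 0 -> compact (disc (absK a)).
Proof.
move=> a0; rewrite -[in disc _](mulr1 (absK a)) -disc_mull//.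
apply: continuous_compact; last exact: compact_disc1.
by apply: continuous_subspaceT; exact: mull_continuous.
Qed.

(** Since [disc 1] is compact, all its dilates by small [a] lie in [U]; [exists_small] supplies a
    nonzero such [a]. *)
Lemma disc_nbhs0 (U : set K) : nbhs 0 U -> exists2 a, a != 0 & disc (absK a) `<=` U.
Proof.
move=> /(nbhs0_mul_compact compact_disc1)/exists_small[a a0].
by rewrite disc_mull// mulr1 => h; exists a.
Qed.

Lemma exists_absK_gt1 : exists r, 1 < absK r.
Proof.
have [_ _ _ _ [z _ /eqP chiz]] := nh_char H; exists z.
by rewrite ltNge; apply/negP => /chi_D.
Qed.

End absolute_value.

(** * Countability and measurability of the field operations *)

Section countability.
Context {R : realType} {K : localFieldType}.
Context {mu : {measure set (borel K) -> \bar R}} {absK : K -> R} {chi : K -> R[i]}.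
Context (H : normalized_haar mu absK chi).
Implicit Types (a b x y : K) (A C U : set K).
Local Notation disc := (@disc R K absK).

(** Only the radii $|u_n|$ matter. They are the powers of some $|r|>1$, unbounded by Bernoulli's
    inequality. *)
Lemma disc_cover : exists u : nat -> K,
  [/\ (forall n, 1 <= absK (u n)), (forall n, absK (u n) <= absK (u n.+1)) &
    forall t : R, exists n, t <= absK (u n)].
Proof.
have [r r1] := exists_absK_gt1 H.
exists (fun n => r ^+ n); split=> [n|n|t]; rewrite ?(absKX H).
- exact/exprn_ege1/ltW.
- by rewrite exprS ler_peMl ?exprn_ge0 ?(absK_ge0 H)// ltW.
have r0 : 0 < absK r - 1 by rewrite subr_gt0.
have := archi_boundP (ltW (divr_gt0 (ltr_pwDl ltr01 (normr_ge0 t)) r0)).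
set n := Num.bound _ => /ltW tn; exists n.
rewrite (absKX H).
have -> : absK r = 1 + (absK r - 1) by rewrite addrC subrK.
apply: (@le_trans _ _ (1 + n%:R * (absK r - 1))).
  by move: tn; rewrite ler_pdivrMr// => tn; have := ler_norm t; lra.
elim: n {tn} => [|n ih]; first by rewrite mul0r addr0 expr0.
rewrite exprS; apply: (@le_trans _ _ ((1 + (absK r - 1)) * (1 + n%:R * (absK r - 1)))).
  have : 0 <= n%:R * (absK r - 1) ^+ 2 by rewrite mulr_ge0// exprn_ge0// ltW.
  by rewrite -natr1; nra.
by rewrite ler_pM2l// addrC subrK (lt_trans ltr01).
Qed.

Lemma disc_countable_net a : a != 0 ->
  exists S : nat -> K, forall x, exists k, disc (absK a) (x - S k).
Proof.
move=> a0; have [u [u1 _ ub]] := disc_cover.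
have u0 n : u n != 0 by rewrite -(absK_eq0 H) gt_eqF// (lt_le_trans ltr01).
have nD : nbhs 0 (disc (absK a)).
  apply: open_nbhs_nbhs; split; first by apply: (open_disc H); exact: (absK_gt0 H).
  by rewrite /disc/= (absK0 H) (absK_ge0 H).
have cov n : {s : seq K | disc (absK (u n)) `<=` [set x | exists2 y, y \in s & disc (absK a) (x - y)]}.
  by apply: cid; apply: compact_finite_translates => //; exact: (compact_disc H).
(* [k] encodes the index of a large disc and a position in its finite cover; codes without meaning
   yield the harmless centre 0. *)
exists (fun k => if unpickle k is Some (n, i) then nth 0 (sval (cov n)) i else 0) => x.
have [n xn] := ub (absK x).
have [y ys ay] := svalP (cov n) x xn.
by exists (pickle (n, index y (sval (cov n)))); rewrite pickleK nth_index.
Qed.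

(** Each radius $|u_n|^{-1}$ has countably many discs in its net, hence countably many boxes, and
    [G] is the union of the boxes it contains. This links continuity on the product space with
    measurability for the product sigma-algebra. *)
Lemma open_prod_measurable (G : set (K * K)) : open G ->
  measurable (G : set (borel K * borel K)).
Proof.
move=> oG; have [u [u1 _ ub]] := disc_cover.
have u0 n : u n != 0 by rewrite -(absK_eq0 H) gt_eqF// (lt_le_trans ltr01).
have [S hS] := choice (fun n => disc_countable_net (invr_neq0 (u0 n))).
pose B n k : set K := [set x | disc (absK (u n)^-1) (x - S n k)].
have mB n k : measurable (B n k : set (borel K)).
  apply: open_measurableK; apply: (@open_disc_invariant _ _ _ _ _ H _ (absK (u n)^-1)).
    by rewrite (absK_gt0 H) ?invr_neq0.
  by move=> x y; rewrite /B/disc/= addrAC; exact: (absK_add H).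
pose rect n k l : set (borel K * borel K) :=
  if `[< B n k `*` B n l `<=` G >] then B n k `*` B n l else set0.
suff -> : G = \bigcup_n \bigcup_k \bigcup_l rect n k l.
  apply: bigcupT_measurable => n; apply: bigcupT_measurable => k.
  apply: bigcupT_measurable => l; rewrite /rect; case: asboolP => // _.
  exact: measurableX.
apply/seteqP; split=> [[x y] Gxy|z [n _ [k _ [l _]]]]; last first.
  by rewrite /rect; case: asboolP => // h; exact: h.
have [[V W] [/= Vx Wy] VW] : nbhs (x, y) G by apply: open_nbhs_nbhs.
have toN (z : K) (V' : set K) : nbhs z V' ->
    exists2 a, a != 0 & forall v, disc (absK a) (v - z) -> V' v.
  move=> V'z; have : nbhs 0 ((fun v => z + v) @^-1` V').
    by apply: addl_continuous; rewrite addr0.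
  move=> /(disc_nbhs0 H)[a a0 h]; exists a => // v /h /=.
  by rewrite addrC subrK.
have [a a0 aV] := toN _ _ Vx; have [b b0 bW] := toN _ _ Wy.
have [n hn] := ub (Num.max (absK a)^-1 (absK b)^-1).
rewrite ge_max in hn; case/andP: hn => an bn.
have [k kx] := hS n x; have [l ly] := hS n y.
exists n => //; exists k => //; exists l => //; rewrite /rect.
have small (c : K) : c != 0 -> (absK c)^-1 <= absK (u n) -> absK (u n)^-1 <= absK c.
  move=> c0; rewrite (absKV H) => cn.
  by rewrite -[leRHS]invrK lef_pV2// posrE ?invr_gt0 ?(absK_gt0 H).
(* In an ultrametric disc any two points are within its radius of each other, so a box containing
   [(x, y)] may be recentred at [(x, y)]. *)
have close (p q s : K) : absK (p - q) <= absK (u n)^-1 -> absK (s - q) <= absK (u n)^-1 ->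
    absK (p - s) <= absK (u n)^-1.
  by move=> pq sq; rewrite -(subrKA q) -[q - s]opprB; exact: (absK_sub H).
case: asboolP => // -[] [p q] [/= pk ql]; apply: VW; split => /=.
- by apply: aV; apply: le_trans (small _ a0 an); exact: (close _ _ _ pk kx).
- by apply: bW; apply: le_trans (small _ b0 bn); exact: (close _ _ _ ql ly).
Qed.

Lemma continuous2_measurable (f : K * K -> K) : continuous f ->
  measurable_fun setT (f : borel K * borel K -> borel K).
Proof.
move=> cf; apply: (@measurability _ _ (borel K * borel K)%type (borel K) setT f
  (@open K : set (set (pointed K))) (erefl _)).
move=> _ [U oU <-]; rewrite setTI; apply: open_prod_measurable.
by apply: open_comp => // x _; exact: cf.
Qed.

(** Inversion is continuous off 0, so preimages of open sets are open up to the point 0, which maps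
    to itself by convention and belongs to the preimage exactly when [U] contains 0. *)
Lemma measurable_invK : measurable_fun setT (@GRing.inv K : borel K -> borel K).
Proof.
apply: (@measurability _ _ (borel K) (borel K) setT _ (@open K : set (set (pointed K))) (erefl _)).
move=> _ [U oU <-]; rewrite setTI.
have o0 : open [set x : K | x != 0 /\ U x^-1].
  rewrite openE => x [x0 Ux].
  have n1 : nbhs x (~` [set 0]).
    apply: open_nbhs_nbhs; split => /=; last exact/eqP.
    by apply: closed_openC; exact: localfield_closed1.
  have n2 : nbhs x (@GRing.inv K @^-1` U).
    by apply: local_inv_continuous => //; exact: open_nbhs_nbhs.
  rewrite /interior; near=> y; split; last by near: y.
  by apply/eqP; near: y.
have mz : measurable ([set 0] : set (borel K)).
  by apply: closed_measurableK; exact: (@localfield_closed1 K 0).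
have [U0|U0] := pselect (U 0).
  rewrite (_ : _ @^-1` U = [set 0] `|` [set x : K | x != 0 /\ U x^-1]).
    by apply: measurableU => //; exact: open_measurableK.
  apply/seteqP; split=> x /=; last by move=> [->|[]//]; rewrite invr0.
  by have [->|] := eqVneq x 0; [left|right].
rewrite (_ : _ @^-1` U = [set x : K | x != 0 /\ U x^-1]); first exact: open_measurableK.
apply/seteqP; split=> x /= => [Ux|[]//]; split=> //.
by apply: contra_notN U0 => /eqP x0; rewrite x0 invr0 in Ux.
Unshelve. all: by end_near.
Qed.

Lemma haar_sigma_finite : sigma_finite setT mu.
Proof.
have [u [u1 _ ub]] := disc_cover.
exists (fun n => disc (absK (u n))).
  apply/seteqP; split=> // x _; have [n xn] := ub (absK x).
  by exists n.
move=> n; split; first exact: (measurable_disc H).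
by rewrite (haar_disc H) ?ltry// -(absK_eq0 H) gt_eqF// (lt_le_trans ltr01).
Qed.

Section measurable_ops.
Context {d : measure_display} {T : measurableType d}.
Implicit Types f g : T -> K.

Lemma measurable_addK f g : measurable_fun setT (f : T -> borel K) -> measurable_fun setT (g : T -> borel K) ->
  measurable_fun setT ((fun t => f t + g t) : T -> borel K).
Proof.
by move=> mf mg; exact: (measurableT_comp (continuous2_measurable localfield_add_continuous) (measurable_fun_pair mf mg)).
Qed.

Lemma measurable_subK f g : measurable_fun setT (f : T -> borel K) -> measurable_fun setT (g : T -> borel K) ->
  measurable_fun setT ((fun t => f t - g t) : T -> borel K).
Proof.
by move=> mf mg; exact: (measurableT_comp (continuous2_measurable localfield_sub_continuous) (measurable_fun_pair mf mg)).
Qed.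

Lemma measurable_mulK f g : measurable_fun setT (f : T -> borel K) -> measurable_fun setT (g : T -> borel K) ->
  measurable_fun setT ((fun t => f t * g t) : T -> borel K).
Proof.
by move=> mf mg; exact: (measurableT_comp (continuous2_measurable local_mul_continuous) (measurable_fun_pair mf mg)).
Qed.

Lemma measurable_divK f g : measurable_fun setT (f : T -> borel K) -> measurable_fun setT (g : T -> borel K) ->
  measurable_fun setT ((fun t => f t / g t) : T -> borel K).
Proof.
by move=> mf mg; apply: measurable_mulK => //; exact: (measurableT_comp measurable_invK mg).
Qed.

End measurable_ops.

End countability.

(** * Integration of complex functions *)

Section normc_facts.
Context {R : realType}.
Implicit Types (z w : R[i]) (x y t : R).

Lemma sqr_normcE z : normc z ^+ 2 = complex.Re z ^+ 2 + complex.Im z ^+ 2.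
Proof. by case: z => a b; rewrite sqr_sqrtr// addr_ge0 ?sqr_ge0. Qed.

Lemma normc_ge0 z : 0 <= normc z.
Proof. by case: z => a b; exact: sqrtr_ge0. Qed.

Lemma normr_Re_le z : `|complex.Re z| <= normc z.
Proof.
rewrite -(ler_pXn2r (ltn0Sn 1)) ?nnegrE ?normc_ge0// sqr_normcE real_normK ?num_real//.
by rewrite lerDl sqr_ge0.
Qed.

Lemma normr_Im_le z : `|complex.Im z| <= normc z.
Proof.
rewrite -(ler_pXn2r (ltn0Sn 1)) ?nnegrE ?normc_ge0// sqr_normcE real_normK ?num_real//.
by rewrite lerDr sqr_ge0.
Qed.

Lemma normc_le_ReIm z : normc z <= `|complex.Re z| + `|complex.Im z|.
Proof.
rewrite -(ler_pXn2r (ltn0Sn 1)) ?nnegrE ?normc_ge0 ?addr_ge0// sqr_normcE.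
rewrite -[complex.Re z ^+ 2]real_normK ?num_real// -[complex.Im z ^+ 2]real_normK ?num_real//.
have := normr_ge0 (complex.Re z); have := normr_ge0 (complex.Im z); nra.
Qed.

Lemma normc_conjc z : normc z^* = normc z.
Proof. by case: z => a b; rewrite /= sqrrN. Qed.

Lemma normc_real x : normc x%:C = `|x|.
Proof. by rewrite /= expr0n addr0 sqrtr_sqr. Qed.

Lemma normc_normr1 z : `|z| = 1 -> normc z = 1.
Proof. by case: z => a b; rewrite normc_def => -[] /=. Qed.

Lemma mulr_conjc z : z * z^* = (normc z ^+ 2)%:C.
Proof.
by case: z => a b; rewrite sqr_normcE; apply/eqP; rewrite eq_complex /=; apply/andP; split;
  apply/eqP; ring.
Qed.

(** Completing the square in $t|z|-|w|$. The free weight lets this bound replace Cauchy-Schwarz once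
    integrated. *)
Lemma normc_mul_le z w t : 0 < t -> normc (z * w) <= t * normc z ^+ 2 + t^-1 * normc w ^+ 2.
Proof.
move=> t0; rewrite normcM; have := normc_ge0 z; have := normc_ge0 w.
move: (normc z) (normc w) => x y y0 x0.
have -> : t * x ^+ 2 + t^-1 * y ^+ 2 = t^-1 * ((t * x - y) ^+ 2) + 2 * (x * y).
  by field; rewrite gt_eqF.
have : 0 <= t^-1 * (t * x - y) ^+ 2 by rewrite mulr_ge0 ?sqr_ge0// invr_ge0 ltW.
have : 0 <= x * y by rewrite mulr_ge0.
lra.
Qed.

(** A triangle inequality for squares: as [t] tends to 0 the main coefficient tends to 1, at the
    price of a large coefficient on the error term. *)
Lemma sqr_normc_quasi z w t : 0 < t ->
  normc z ^+ 2 <= (1 + t) * normc w ^+ 2 + (1 + t^-1) * normc (z - w) ^+ 2.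
Proof.
move=> t0; rewrite !sqr_normcE.
case: z w => a b [c d] /=.
have h x y : x ^+ 2 <= (1 + t) * y ^+ 2 + (1 + t^-1) * (x - y) ^+ 2.
  have -> : (1 + t) * y ^+ 2 + (1 + t^-1) * (x - y) ^+ 2 =
    t^-1 * (t * y - (x - y)) ^+ 2 + x ^+ 2.
    by field; rewrite gt_eqF.
  by rewrite lerDr mulr_ge0 ?sqr_ge0// invr_ge0 ltW.
have := h a c; have := h b d; lra.
Qed.

End normc_facts.

Section cmeasurable_closure.
Context {d : measure_display} {T : measurableType d} {R : realType}.
Implicit Types (f g : T -> R[i]) (h : T -> R).

Lemma cmeasurable_cst (c : R[i]) : cmeasurable setT (fun _ : T => c).
Proof. by split; exact: measurable_cst. Qed.

Lemma cmeasurableD f g : cmeasurable setT f -> cmeasurable setT g ->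
  cmeasurable setT (fun x => f x + g x).
Proof.
move=> [f1 f2] [g1 g2]; split.
  rewrite (_ : (fun x => _) = (fun x => complex.Re (f x) + complex.Re (g x))); last first.
    by apply/funext => x; case: (f x) (g x) => ? ? [].
  exact: measurable_funD.
rewrite (_ : (fun x => _) = (fun x => complex.Im (f x) + complex.Im (g x))); last first.
  by apply/funext => x; case: (f x) (g x) => ? ? [].
exact: measurable_funD.
Qed.

Lemma cmeasurableM f g : cmeasurable setT f -> cmeasurable setT g ->
  cmeasurable setT (fun x => f x * g x).
Proof.
move=> [f1 f2] [g1 g2]; split.
  rewrite (_ : (fun x => _) = (fun x => complex.Re (f x) * complex.Re (g x) -
      complex.Im (f x) * complex.Im (g x))); last first.
    by apply/funext => x; case: (f x) (g x) => ? ? [].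
  by apply: measurable_funB; exact: measurable_funM.
rewrite (_ : (fun x => _) = (fun x => complex.Re (f x) * complex.Im (g x) +
    complex.Im (f x) * complex.Re (g x))); last first.
  by apply/funext => x; case: (f x) (g x) => ? ? [].
by apply: measurable_funD; exact: measurable_funM.
Qed.

Lemma cmeasurable_conj f : cmeasurable setT f -> cmeasurable setT (fun x => (f x)^*).
Proof.
move=> [f1 f2]; split.
  rewrite (_ : (fun x => _) = (fun x => complex.Re (f x)))//.
  by apply/funext => x; case: (f x).
rewrite (_ : (fun x => _) = (fun x => - complex.Im (f x))); first exact: measurable_funN.
by apply/funext => x; case: (f x).
Qed.

Lemma cmeasurable_real h : measurable_fun setT h -> cmeasurable setT (fun x => (h x)%:C).
Proof. by move=> mh; split => //; exact: measurable_cst. Qed.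

Lemma cmeasurableB f g : cmeasurable setT f -> cmeasurable setT g ->
  cmeasurable setT (fun x => f x - g x).
Proof.
move=> mf mg; rewrite (_ : (fun x => _) = (fun x => f x + (-1) * g x)).
  by apply: cmeasurableD => //; apply: cmeasurableM => //; exact: cmeasurable_cst.
by apply/funext => x; rewrite mulN1r.
Qed.

Lemma measurable_sqr_normc f : cmeasurable setT f ->
  measurable_fun setT (fun x => normc (f x) ^+ 2).
Proof.
move=> [f1 f2].
rewrite (_ : (fun x => _) = (fun x => complex.Re (f x) ^+ 2 + complex.Im (f x) ^+ 2)).
  by apply: measurable_funD; exact: measurable_funX.
by apply/funext => x; rewrite sqr_normcE.
Qed.

Lemma measurable_normc f : cmeasurable setT f -> measurable_fun setT (fun x => normc (f x)).
Proof.
move=> mf; rewrite (_ : (fun x => _) = (fun x => Num.sqrt (normc (f x) ^+ 2))).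
  apply: measurableT_comp (measurable_sqr_normc mf).
  by apply: continuous_measurable_fun; exact: sqrt_continuous.
by apply/funext => x; rewrite sqrtr_sqr ger0_norm// normc_ge0.
Qed.

Lemma cmeasurable_comp d' (T' : measurableType d') (g : T' -> T) f :
  measurable_fun setT g -> cmeasurable setT f -> cmeasurable setT (f \o g).
Proof.
move=> mg [f1 f2]; split; [exact: (measurableT_comp f1 mg)|exact: (measurableT_comp f2 mg)].
Qed.

End cmeasurable_closure.

Section complex_integral.
Context {d : measure_display} {T : measurableType d} {R : realType}.
Context (m : {measure set T -> \bar R}).
Implicit Types (f g : T -> R[i]).

Lemma inL1P f : inL1 m f <->
  m.-integrable setT (EFin \o (fun x => complex.Re (f x))) /\
  m.-integrable setT (EFin \o (fun x => complex.Im (f x))).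
Proof.
split=> [[[m1 m2] foo]|[/integrableP[m1 i1] /integrableP[m2 i2]]].
  split; apply/integrableP; split; try exact/measurable_EFinP.
  - apply: le_lt_trans foo; apply: ge0_le_integral => //.
    + by apply: measurableT_comp => //; exact/measurable_EFinP.
    + by apply/measurable_EFinP; exact: measurable_normc.
    + by move=> x _; rewrite lee_fin normr_Re_le.
  - apply: le_lt_trans foo; apply: ge0_le_integral => //.
    + by apply: measurableT_comp => //; exact/measurable_EFinP.
    + by apply/measurable_EFinP; exact: measurable_normc.
    + by move=> x _; rewrite lee_fin normr_Im_le.
have mf : cmeasurable setT f by split; exact/measurable_EFinP.
split=> //; apply: (@le_lt_trans _ _ (\int[m]_x (`|(complex.Re (f x))%:E| + `|(complex.Im (f x))%:E|))%E).
  apply: ge0_le_integral => //.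
  - by move=> x _; rewrite lee_fin normc_ge0.
  - by apply/measurable_EFinP; exact: measurable_normc.
  - by apply: emeasurable_funD; apply: measurableT_comp.
  - by move=> x _; rewrite lee_fin normc_le_ReIm.
rewrite ge0_integralD//; last 2 first.
- exact: measurableT_comp.
- exact: measurableT_comp.
exact: lte_add_pinfty.
Qed.

Lemma inL1_dom f (h : T -> \bar R) : cmeasurable setT f -> measurable_fun setT h ->
  (forall x, (normc (f x))%:E <= h x)%E -> (\int[m]_x h x < +oo)%E -> inL1 m f.
Proof.
move=> mf mh fh hoo; split=> //; apply: le_lt_trans hoo; apply: ge0_le_integral => //.
- by move=> x _; rewrite lee_fin normc_ge0.
- by apply/measurable_EFinP; exact: measurable_normc.
Qed.

Lemma inL1D f g : inL1 m f -> inL1 m g -> inL1 m (fun x => f x + g x).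
Proof.
move=> [mf fi] [mg gi]; apply: (@inL1_dom _ (fun x => (normc (f x))%:E + (normc (g x))%:E)%E).
- exact: cmeasurableD.
- by apply: emeasurable_funD; apply/measurable_EFinP; exact: measurable_normc.
- by move=> x; rewrite lee_fin le_normcD.
rewrite ge0_integralD//; last 4 first.
- by move=> x _; rewrite lee_fin normc_ge0.
- by apply/measurable_EFinP; exact: measurable_normc.
- by move=> x _; rewrite lee_fin normc_ge0.
- by apply/measurable_EFinP; exact: measurable_normc.
exact: lte_add_pinfty.
Qed.

Lemma inL1_bounded_mul (c : R) f g : cmeasurable setT g ->
  (forall x, normc (g x) <= c) -> inL1 m f -> inL1 m (fun x => f x * g x).
Proof.
move=> mg gc [mf fi]; apply: (@inL1_dom _ (fun x => c%:E * (normc (f x))%:E)%E).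
- exact: cmeasurableM.
- by apply: measurable_funeM; apply/measurable_EFinP; exact: measurable_normc.
- by move=> x; rewrite -EFinM lee_fin normcM mulrC ler_wpM2r ?normc_ge0.
rewrite ge0_integralZl//.
(* The bound on [g] at the default [point] shows that [c] is nonnegative. *)
- by rewrite lte_mul_pinfty// ?lee_fin ?(le_trans (normc_ge0 _) (gc point)).
- by apply/measurable_EFinP; exact: measurable_normc.
- by move=> x _; rewrite lee_fin normc_ge0.
- by rewrite lee_fin (le_trans (normc_ge0 _) (gc point)).
Qed.

Lemma inL1Z (c : R[i]) f : inL1 m f -> inL1 m (fun x => c * f x).
Proof.
move=> fi; rewrite (_ : (fun x => _) = (fun x => f x * c)).
  by apply: (@inL1_bounded_mul (normc c)) => //; exact: cmeasurable_cst.
by apply/funext => x; rewrite mulrC.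
Qed.

Lemma inL1_conj f : inL1 m f -> inL1 m (fun x => (f x)^*).
Proof.
move=> [mf fi]; split; first exact: cmeasurable_conj.
by under eq_integral do rewrite normc_conjc.
Qed.

Lemma inL1B f g : inL1 m f -> inL1 m g -> inL1 m (fun x => f x - g x).
Proof.
move=> fi gi; rewrite (_ : (fun x => _) = (fun x => f x + (-1) * g x)).
  by apply: inL1D => //; exact: inL1Z.
by apply/funext => x; rewrite mulN1r.
Qed.

Lemma eq_cintegral f g : f =1 g -> cintegral m setT f = cintegral m setT g.
Proof. by move=> fg; congr cintegral; exact/funext. Qed.

Lemma cintegralD f g : inL1 m f -> inL1 m g ->
  cintegral m setT (fun x => f x + g x) = cintegral m setT f + cintegral m setT g.
Proof.
move=> /inL1P[f1 f2] /inL1P[g1 g2]; rewrite /cintegral.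
apply/eqP; rewrite eq_complex/=; apply/andP; split; apply/eqP.
- rewrite -fineD; [|exact: integrable_fin_num..]; rewrite -integralD//.
  by congr fine; apply: eq_integral => x _ /=; case: (f x) (g x) => ? ? [].
- rewrite -fineD; [|exact: integrable_fin_num..]; rewrite -integralD//.
  by congr fine; apply: eq_integral => x _ /=; case: (f x) (g x) => ? ? [].
Qed.

Lemma cintegralZ (c : R[i]) f : inL1 m f ->
  cintegral m setT (fun x => c * f x) = c * cintegral m setT f.
Proof.
move=> /inL1P[f1 f2]; rewrite /cintegral; case: c => a b.
have ZR r (h : T -> R) : m.-integrable setT (EFin \o h) ->
   fine (\int[m]_x (r * h x)%:E)%E = r * fine (\int[m]_x (h x)%:E)%E.
  by move=> hi; exact: (@RintegralZl _ _ _ m setT h r).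
have ih r (h : T -> R) : m.-integrable setT (EFin \o h) ->
   m.-integrable setT (EFin \o (fun x => r * h x)).
  move=> hi; rewrite (_ : _ \o _ = (fun x => r%:E * (h x)%:E)%E)//.
  exact: (@integrableZl _ _ _ m setT measurableT r (EFin \o h)).
apply/eqP; rewrite eq_complex/=; apply/andP; split; apply/eqP.
- rewrite -!ZR//.
  have := @RintegralB _ _ _ m setT _ _ measurableT (ih a _ f1) (ih b _ f2).
  rewrite /Rintegral => <-; congr fine; apply: eq_integral => x _ /=.
  by case: (f x).
- rewrite -!ZR//.
  have := @RintegralD _ _ _ m setT _ _ measurableT (ih a _ f2) (ih b _ f1).
  rewrite /Rintegral => <-; congr fine; apply: eq_integral => x _ /=.
  by case: (f x).
Qed.

Lemma cintegralB f g : inL1 m f -> inL1 m g ->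
  cintegral m setT (fun x => f x - g x) = cintegral m setT f - cintegral m setT g.
Proof.
move=> fi gi; rewrite (@eq_cintegral _ (fun x => f x + (-1) * g x)).
  by rewrite cintegralD ?cintegralZ ?mulN1r//; exact: inL1Z.
by move=> x; rewrite mulN1r.
Qed.

Lemma cintegral_conj f : inL1 m f ->
  cintegral m setT (fun x => (f x)^*) = (cintegral m setT f)^*.
Proof.
move=> /inL1P[f1 f2]; rewrite /cintegral /=; congr (_ +i* _).
  by congr fine; apply: eq_integral => x _; case: (f x).
rewrite -[RHS]mulN1r.
have := @RintegralZl _ _ _ m setT (fun x => complex.Im (f x)) (-1) measurableT f2.
rewrite /Rintegral => <-; congr fine; apply: eq_integral => x _.
by case: (f x) => ? ?; rewrite /= mulN1r.
Qed.

(** Rotate by the conjugate of the integral [I]: the real part of $\int \bar I f$ is $|I|^2$ and is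
    at most $|I|\int|f|$; then divide by $|I|$. *)
Lemma le_normc_cintegral f : inL1 m f ->
  ((normc (cintegral m setT f))%:E <= \int[m]_x (normc (f x))%:E)%E.
Proof.
move=> fi; set I := cintegral m setT f.
have nf : (\int[m]_x (normc (f x))%:E)%E \is a fin_num.
  rewrite ge0_fin_numE; first by case: fi.
  by apply: integral_ge0 => x _; rewrite lee_fin normc_ge0.
have [I0|I0] := eqVneq (normc I) 0.
  by rewrite I0; apply: integral_ge0 => x _; rewrite lee_fin normc_ge0.
have Igt0 : 0 < normc I by rewrite lt_neqAle eq_sym I0 normc_ge0.
rewrite -(fineK nf) lee_fin -(ler_pM2l Igt0).
have mn : measurable_fun setT (fun x => (normc (f x))%:E).
  by apply/measurable_EFinP; apply: measurable_normc; case: fi.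
have eI : (\int[m]_x ((normc I)%:E * (normc (f x))%:E) =
    (normc I)%:E * \int[m]_x (normc (f x))%:E)%E.
  by apply: ge0_integralZl => //; rewrite ?lee_fin ?normc_ge0// => x _; rewrite lee_fin normc_ge0.
have reI : complex.Re (cintegral m setT (fun x => I^* * f x)) = normc I * normc I.
  by rewrite cintegralZ// -/I mulrC mulr_conjc /= expr2.
have [/integrable_fin_num cre _] := iffLR (inL1P _) (inL1Z (I^*) fi).
rewrite -reI -lee_fin EFinM (fineK nf) -eI.
have -> : (complex.Re (cintegral m setT (fun x => I^* * f x)))%:E =
    (\int[m]_x (complex.Re (I^* * f x))%:E)%E.
  by rewrite /cintegral/= fineK//; exact: cre.
clearbody I => {eI reI cre Igt0 I0}.
have [[mc _] _] := inL1Z (I^*) fi.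
apply: (@le_trans _ _ `|\int[m]_x (complex.Re (I^* * f x))%:E|)%E; first exact: lee_abs.
apply: (le_trans (le_abse_integral _ _ _)) => //; first exact/measurable_EFinP.
apply: ge0_le_integral => //.
- by apply: measurableT_comp => //; exact/measurable_EFinP.
- exact: measurable_funeM.
- by move=> x _; rewrite /= lee_fin (le_trans (normr_Re_le _))// normcM normc_conjc.
Qed.

Definition sqL2 f : \bar R := (\int[m]_x (normc (f x) ^+ 2)%:E)%E.

Lemma sqL2_ge0 f : (0 <= sqL2 f)%E.
Proof. by apply: integral_ge0 => x _; rewrite lee_fin sqr_ge0. Qed.

Lemma sqL2_fin f : inL2 m f -> sqL2 f \is a fin_num.
Proof. by move=> [_ foo]; rewrite ge0_fin_numE ?sqL2_ge0. Qed.

Lemma measurable_sqL2 f : cmeasurable setT f ->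
  measurable_fun setT (fun x => (normc (f x) ^+ 2)%:E).
Proof. by move=> mf; apply/measurable_EFinP; exact: measurable_sqr_normc. Qed.

(** Integrates a pointwise bound once for all; the quasi-triangle inequality and the stability of
    $L^2$ under sums and of products in $L^1$ are instances. *)
Lemma sqL2_linear_bound (a b : R) (h : T -> R) f g :
  0 <= a -> 0 <= b -> measurable_fun setT h -> (forall x, 0 <= h x) ->
  cmeasurable setT f -> cmeasurable setT g ->
  (forall x, h x <= a * normc (f x) ^+ 2 + b * normc (g x) ^+ 2) ->
  (\int[m]_x (h x)%:E <= a%:E * sqL2 f + b%:E * sqL2 g)%E.
Proof.
move=> a0 b0 mh h0 mf mg hle.
have pos (r : R) (k : T -> R[i]) : 0 <= r -> forall x, [set: T] x -> (0 <= r%:E * (normc (k x) ^+ 2)%:E)%E.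
  by move=> r0 x _; rewrite -EFinM lee_fin mulr_ge0// sqr_ge0.
have ms (r : R) (k : T -> R[i]) : cmeasurable setT k -> measurable_fun setT (fun x => r%:E * (normc (k x) ^+ 2)%:E)%E.
  by move=> mk; apply: measurable_funeM; exact: measurable_sqL2.
apply: (@le_trans _ _ (\int[m]_x (a%:E * (normc (f x) ^+ 2)%:E + b%:E * (normc (g x) ^+ 2)%:E))%E).
  apply: ge0_le_integral => //.
  - by move=> x _; rewrite lee_fin.
  - exact/measurable_EFinP.
  - by apply: emeasurable_funD; exact: ms.
  - by move=> x _; rewrite -!EFinM -EFinD lee_fin.
rewrite ge0_integralD//; [|exact: pos|exact: ms|exact: pos|exact: ms].
by rewrite !ge0_integralZl//; first [exact: measurable_sqL2 | by move=> x _; rewrite lee_fin sqr_ge0].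
Qed.

Lemma sqL2_quasi (t : R) f g : 0 < t -> cmeasurable setT f -> cmeasurable setT g ->
  (sqL2 f <= (1 + t)%:E * sqL2 g + (1 + t^-1)%:E * sqL2 (fun x => f x - g x)%R)%E.
Proof.
move=> t0 mf mg; apply: sqL2_linear_bound => //.
- by rewrite addr_ge0// ltW.
- by rewrite addr_ge0// ltW// invr_gt0.
- exact: measurable_sqr_normc.
- by move=> x; exact: sqr_ge0.
- exact: cmeasurableB.
- by move=> x; exact: sqr_normc_quasi.
Qed.

Lemma inL2D f g : inL2 m f -> inL2 m g -> inL2 m (fun x => f x + g x).
Proof.
move=> [mf fi] [mg gi]; split; first exact: cmeasurableD.
apply: (@le_lt_trans _ _ ((1 + 1)%:E * sqL2 f + (1 + 1^-1)%:E * sqL2 g)%E).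
  apply: sqL2_linear_bound => //.
  - by apply: measurable_sqr_normc; exact: cmeasurableD.
  - by move=> x; exact: sqr_ge0.
  by move=> x; have := @sqr_normc_quasi R (f x + g x) (f x) 1 ltr01; rewrite addrAC subrr add0r.
by apply: lte_add_pinfty; rewrite lte_mul_pinfty.
Qed.

Lemma sqL2Z (c : R[i]) f : cmeasurable setT f ->
  sqL2 (fun x => c * f x) = ((normc c ^+ 2)%:E * sqL2 f)%E.
Proof.
move=> mf; rewrite /sqL2 -ge0_integralZl//.
- by apply: eq_integral => x _; rewrite normcM exprMn EFinM.
- exact: measurable_sqL2.
- by move=> x _; rewrite lee_fin sqr_ge0.
- by rewrite lee_fin sqr_ge0.
Qed.

Lemma inL2Z (c : R[i]) f : inL2 m f -> inL2 m (fun x => c * f x).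
Proof.
move=> [mf fi]; split; first by apply: cmeasurableM => //; exact: cmeasurable_cst.
by rewrite -/(sqL2 _) sqL2Z// lte_mul_pinfty// lee_fin sqr_ge0.
Qed.

Lemma inL2B f g : inL2 m f -> inL2 m g -> inL2 m (fun x => f x - g x).
Proof.
move=> fi gi; rewrite (_ : (fun x => _) = (fun x => f x + (-1) * g x)).
  by apply: inL2D => //; exact: inL2Z.
by apply/funext => x; rewrite mulN1r.
Qed.

Lemma inL2_conj f : inL2 m f -> inL2 m (fun x => (f x)^*).
Proof.
move=> [mf fi]; split; first exact: cmeasurable_conj.
by under eq_integral do rewrite normc_conjc.
Qed.

Lemma inL1_mul f g : inL2 m f -> inL2 m g -> inL1 m (fun x => f x * g x).
Proof.
move=> [mf fi] [mg gi]; split; first exact: cmeasurableM.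
apply: (@le_lt_trans _ _ (1%:E * sqL2 f + 1^-1%:E * sqL2 g)%E).
  apply: sqL2_linear_bound => //.
  - by apply: measurable_normc; exact: cmeasurableM.
  - by move=> x; exact: normc_ge0.
  - by move=> x; exact: normc_mul_le.
by apply: lte_add_pinfty; rewrite lte_mul_pinfty.
Qed.

Lemma normc_cintegral_mul_le (t : R) f g : 0 < t -> inL2 m f -> inL2 m g ->
  ((normc (cintegral m setT (fun x => f x * g x)))%:E <= t%:E * sqL2 f + t^-1%:E * sqL2 g)%E.
Proof.
move=> t0 fi gi; apply: (le_trans (le_normc_cintegral (inL1_mul fi gi))).
have [mf _] := fi; have [mg _] := gi.
apply: sqL2_linear_bound => //.
- exact: ltW.
- by rewrite invr_ge0 ltW.
- by apply: measurable_normc; exact: cmeasurableM.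
- by move=> x; exact: normc_ge0.
- by move=> x; exact: normc_mul_le.
Qed.

Lemma fine_sqL2D f g : inL2 m f -> inL2 m g ->
  fine (sqL2 (fun x => f x + g x)) =
  fine (sqL2 f) + fine (sqL2 g) + 2 * complex.Re (L2dot m f g).
Proof.
move=> fi gi.
have fgi := inL1_mul fi (inL2_conj gi).
have [fg1 _] := iffLR (inL1P _) fgi.
have toI (k : T -> R[i]) : inL2 m k -> m.-integrable setT (EFin \o (fun x => normc (k x) ^+ 2)).
  move=> [mk ki]; apply/integrableP; split; first exact: measurable_sqL2.
  by under eq_integral do rewrite gee0_abs ?lee_fin ?sqr_ge0//.
have i2 : m.-integrable setT (EFin \o (fun x => 2 * complex.Re (f x * (g x)^*))).
  rewrite (_ : _ \o _ = (fun x => 2%:E * (complex.Re (f x * (g x)^*))%:E)%E)//.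
  exact: (@integrableZl _ _ _ m setT measurableT 2 _ fg1).
have if_ := toI _ fi; have ig := toI _ gi.
have ifg : m.-integrable setT (EFin \o (fun x => normc (f x) ^+ 2 + normc (g x) ^+ 2)).
  rewrite (_ : _ \o _ = (fun x => (normc (f x) ^+ 2)%:E + (normc (g x) ^+ 2)%:E)%E)//.
  exact: integrableD.
rewrite /sqL2 /L2dot /cintegral /=.
have := @RintegralZl _ _ _ m setT _ 2 measurableT fg1; rewrite /Rintegral => <-.
have := @RintegralD _ _ _ m setT _ _ measurableT if_ ig; rewrite /Rintegral => <-.
have := @RintegralD _ _ _ m setT _ _ measurableT ifg i2; rewrite /Rintegral => <-.
congr fine; apply: eq_integral => x _; congr (_%:E).
rewrite !sqr_normcE; case: (f x) (g x) => a b [a' b'] /=; ring.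
Qed.

Lemma L2dotZr (c : R[i]) f g : inL2 m f -> inL2 m g ->
  L2dot m f (fun x => c * g x) = c^* * L2dot m f g.
Proof.
move=> fi gi; rewrite /L2dot -cintegralZ; last by apply: inL1_mul => //; exact: inL2_conj.
by apply: eq_cintegral => x; rewrite rmorphM mulrCA.
Qed.

End complex_integral.

(** * Polarization between two spaces *)

Section isometries.
Context {d d' : measure_display} {T : measurableType d} {T' : measurableType d'} {R : realType}.
Context (m : {measure set T -> \bar R}) (m' : {measure set T' -> \bar R}).
Implicit Types (F G : T -> R[i]) (f g : T' -> R[i]).

(** The norms of [F] and [G] being matched, the sum [F + G] isolates the real part of the inner
    product, and [F + 'i * G] the imaginary part, because the real part of $\bar{i}z$ is the
    imaginary part of $z$. *)
Lemma polarization (c : R) F G f g :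
  inL2 m F -> inL2 m G -> inL2 m' f -> inL2 m' g ->
  sqL2 m F = (c%:E * sqL2 m' f)%E -> sqL2 m G = (c%:E * sqL2 m' g)%E ->
  sqL2 m (fun x => F x + G x) = (c%:E * sqL2 m' (fun x => f x + g x)%R)%E ->
  sqL2 m (fun x => F x + 'i * G x) = (c%:E * sqL2 m' (fun x => f x + 'i * g x)%R)%E ->
  L2dot m F G = c%:C * L2dot m' f g.
Proof.
move=> Fi Gi fi gi eF eG e1 e2.
have iGi := inL2Z 'i Gi; have igi := inL2Z 'i gi.
have fineE (r : \bar R) : r \is a fin_num -> fine (c%:E * r)%E = c * fine r.
  by move=> rf; rewrite fineM.
have norm_i : normc 'i = 1 :> R by rewrite /= expr0n expr1n add0r sqrtr1.
have sqi d0 (S : measurableType d0) (M : {measure set S -> \bar R}) (h : S -> R[i]) :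
    inL2 M h -> sqL2 M (fun x => 'i * h x) = sqL2 M h.
  by move=> [mh _]; rewrite sqL2Z// norm_i expr1n mul1e.
have ImE (z : R[i]) : complex.Re (('i)^* * z) = complex.Im z.
  by case: z => a b /=; ring.
have := congr1 fine e1; rewrite fineE; last exact/sqL2_fin/inL2D.
rewrite !fine_sqL2D// eF eG !fineE; [|exact: sqL2_fin..].
move=> h1.
have := congr1 fine e2; rewrite fineE; last exact/sqL2_fin/inL2D.
rewrite !fine_sqL2D// !sqi// eF eG !fineE; [|exact: sqL2_fin..].
rewrite !L2dotZr// !ImE => h2.
apply/eqP; rewrite eq_complex; apply/andP; split; apply/eqP.
  rewrite (_ : complex.Re (c%:C * _) = c * complex.Re (L2dot m' f g)); first lra.
  by case: (L2dot m' f g) => a b /=; ring.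
rewrite (_ : complex.Im (c%:C * _) = c * complex.Im (L2dot m' f g)); first lra.
by case: (L2dot m' f g) => a b /=; ring.
Qed.

End isometries.

(** * Limits of isometries *)

Section isometry_limit.
Context {d d' : measure_display} {T : measurableType d} {T' : measurableType d'} {R : realType}.
Context (m : {measure set T -> \bar R}) (m' : {measure set T' -> \bar R}).

(** The hypothesis has the shape produced by two successive quasi-triangle inequalities with small
    errors. *)
Lemma le_quasi_limit (a b : R) : 0 <= b ->
  (forall t e, 0 < t -> 0 < e -> a <= (1 + t) * ((1 + t) * b + e) + e) -> a <= b.
Proof.
move=> b0 h; apply/ler_addgt0Pr => e e0.
have b1 : 0 < 6 * (b + 1) by rewrite mulr_gt0// ltr_wpDl.
(* For $t\le1$ and error $e/6$ the right-hand side exceeds [b] by at most $3tb+3e/6$; the second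
   entry of the minimum gives $3tb\le e/2$. *)
pose t := Num.min 1 (e / (6 * (b + 1))).
have t0 : 0 < t by rewrite lt_min ltr01 divr_gt0.
have t1 : t <= 1 by rewrite ge_min lexx.
have tb : t * (6 * (b + 1)) <= e by rewrite -ler_pdivlMr// ge_min lexx orbT.
have e6 : 0 < e / 6 by rewrite divr_gt0.
apply: (le_trans (h t (e / 6) t0 e6)).
have : t * t * b <= t * b by rewrite ler_wpM2r// ler_piMl// ltW.
have : t * (e / 6) <= e / 6 by rewrite ler_piMl// ltW.
have : e / 6 * 6 = e by rewrite divfK.
nra.
Qed.

Lemma sqL2_subC d0 (S : measurableType d0) (M : {measure set S -> \bar R}) (f g : S -> R[i]) :
  sqL2 M (fun x => f x - g x) = sqL2 M (fun x => g x - f x).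
Proof. by apply: eq_integral => x _; rewrite -opprB normcN. Qed.

Lemma limn_einf_le (u : (\bar R)^nat) (C : \bar R) :
  (\forall n \near \oo, (u n <= C)%E) -> (limn_einf u <= C)%E.
Proof.
move=> [N _ hN]; rewrite limn_einf_lim; apply: lime_le; first exact: is_cvg_einfs.
apply: nearW => n; apply: (@le_trans _ _ (u (maxn n N))).
  by apply: ereal_inf_lbound; exists (maxn n N) => //=; exact: leq_maxl.
by apply: hN => /=; exact: leq_maxr.
Qed.

Context (c : R) (F : T -> R[i]) (F_ : nat -> T -> R[i]) (f : T' -> R[i]) (f_ : nat -> T' -> R[i]).
Hypotheses (c0 : 0 <= c) (mF : cmeasurable setT F) (mF_ : forall k, cmeasurable setT (F_ k)).
Hypotheses (fi : inL2 m' f) (fi_ : forall k, inL2 m' (f_ k)).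
Hypothesis F_cvg : forall x, (fun k => normc (F_ k x - F x)) @ \oo --> (0 : R).
Hypothesis isoF : forall k, sqL2 m (F_ k) = (c%:E * sqL2 m' (f_ k))%E.
Hypothesis isoB : forall k l, sqL2 m (fun x => F_ k x - F_ l x) =
  (c%:E * sqL2 m' (fun x => f_ k x - f_ l x)%R)%E.
Hypothesis f_cvg : forall k, (sqL2 m' (fun x => f_ k x - f x)%R <= (k.+1%:R^-1)%:E)%E.

(** Fatou in the second index: the left side is at most the lower limit over [l] of $\|F_k-F_l\|^2 =
    c\|f_k-f_l\|^2$, and for $l\ge k$ this is at most $c(2/(k+1)+2/(l+1))$. Square integrability of
    [F] is not known beforehand but follows from this bound. *)
Let F_dist k : (sqL2 m (fun x => F_ k x - F x)%R <= (4 * c * k.+1%:R^-1)%:E)%E.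
Proof.
pose u l x := (normc (F_ k x - F_ l x) ^+ 2)%:E.
have lim_u x : limn_einf (u ^~ x) = (normc (F_ k x - F x) ^+ 2)%:E.
  have : u ^~ x @ \oo --> (normc (F_ k x - F x) ^+ 2)%:E.
    apply: cvg_EFin; first by exact: nearW.
    rewrite /u /comp/=.
    have : (fun l => normc (F_ k x - F_ l x)) @ \oo --> normc (F_ k x - F x).
      apply: (@squeeze_cvgr _ _ _ _ (fun l => normc (F_ k x - F x) - normc (F_ l x - F x))
         (fun l => normc (F_ k x - F x) + normc (F_ l x - F x))).
      - apply: nearW => l; apply/andP; split.
          rewrite lerBlDr (le_trans _ (le_normcD _ _))// [leRHS](_ : _ = normc (F_ k x - F x))//.
          by congr normc; rewrite subrKA.
        rewrite -[normc (F_ l x - _)]normcN opprB.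
        by rewrite (le_trans _ (le_normcD _ _))// subrKA.
      - by rewrite -[X in _ --> X]subr0; apply: cvgB => //; exact: cvg_cst.
      - by rewrite -[X in _ --> X]addr0; apply: cvgD => //; exact: cvg_cst.
    move=> h; rewrite expr2; under eq_fun do rewrite expr2.
    exact: cvgM.
  by move=> h; rewrite is_cvg_limn_einfE; [exact/cvg_lim|apply/cvg_ex; eexists; exact: h].
rewrite /sqL2; under eq_integral do rewrite -lim_u.
apply: (le_trans (fatou _ _ _ _)) => //.
- by move=> l; apply: measurable_sqL2; exact: cmeasurableB.
- by move=> l x _; rewrite lee_fin sqr_ge0.
apply: limn_einf_le; exists k => // l /= kl.
rewrite -/(sqL2 m (fun x => F_ k x - F_ l x)) isoB.
have [mf _] := fi; have [mfk _] := fi_ k; have [mfl _] := fi_ l.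
have : (sqL2 m' (fun x => f_ k x - f_ l x)%R <=
    2%:E * sqL2 m' (fun x => f_ k x - f x)%R + 2%:E * sqL2 m' (fun x => f_ l x - f x)%R)%E.
  apply: sqL2_linear_bound => //.
  - by apply: measurable_sqr_normc; exact: cmeasurableB.
  - by move=> x; exact: sqr_ge0.
  - exact: cmeasurableB.
  - exact: cmeasurableB.
  move=> x; have := @sqr_normc_quasi R (f_ k x - f_ l x) (f_ k x - f x) 1 ltr01.
  by rewrite (_ : f_ k x - f_ l x - (f_ k x - f x) = - (f_ l x - f x)) ?normcN ?invr1//; ring.
have lk : (l.+1%:R : R)^-1 <= k.+1%:R^-1 by rewrite lef_pV2 ?posrE// ler_nat ltnS.
move=> h; apply: (@le_trans _ _ (c%:E * (4 * k.+1%:R^-1)%:E)%E); last first.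
  by rewrite -EFinM lee_fin mulrCA mulrA.
apply: lee_wpmul2l => //; apply: (le_trans h).
rewrite (_ : (4 * _)%:E = (2%:E * (k.+1%:R^-1)%:E + 2%:E * (k.+1%:R^-1)%:E)%E); last first.
  by rewrite -!EFinM -EFinD; congr (_%:E); ring.
apply: leeD; apply: lee_wpmul2l => //.
by apply: (le_trans (f_cvg l)); rewrite lee_fin.
Qed.

Lemma sqL2_limit : sqL2 m F = (c%:E * sqL2 m' f)%E.
Proof.
have Fi_ k : inL2 m (F_ k).
  by split => //; rewrite -/(sqL2 m (F_ k)) isoF lte_mul_pinfty//; case: (fi_ k).
have Di k : inL2 m (fun x => F_ k x - F x).
  by split; [exact: cmeasurableB|apply: le_lt_trans (F_dist k) _; exact: ltry].
(* [F] is the difference of [F_ 0] and [F_ 0 - F], both in $L^2$. *)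
have Fi : inL2 m F.
  have := inL2B (Fi_ 0%N) (Di 0%N); congr inL2; apply/funext => x.
  by rewrite opprB addrC subrK.
have fDi k : inL2 m' (fun x => f_ k x - f x) by exact: inL2B.
pose dk k := fine (sqL2 m (fun x => F_ k x - F x)).
have dkE k : dk k <= 4 * c * k.+1%:R^-1.
  by rewrite -lee_fin fineK ?sqL2_fin//; exact: F_dist.
have ek k : fine (sqL2 m' (fun x => f_ k x - f x)) <= k.+1%:R^-1.
  by rewrite -lee_fin fineK ?sqL2_fin//; exact: f_cvg.
have quasi d0 (S : measurableType d0) (M : {measure set S -> \bar R}) (g h : S -> R[i]) t :
    0 < t -> inL2 M g -> inL2 M h -> fine (sqL2 M g) <=
    (1 + t) * fine (sqL2 M h) + (1 + t^-1) * fine (sqL2 M (fun x => g x - h x)).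
  move=> t0 gi hi; have [mg _] := gi; have [mh _] := hi.
  have := sqL2_quasi M t0 mg mh.
  have /sqL2_fin/fineK <- := gi; have /sqL2_fin/fineK <- := hi.
  by have /sqL2_fin/fineK <- := inL2B gi hi; rewrite -!EFinM -EFinD lee_fin.
have Fk k : fine (sqL2 m (F_ k)) = c * fine (sqL2 m' (f_ k)).
  by rewrite isoF fineM ?sqL2_fin.
have B0 : 0 <= c * fine (sqL2 m' f) by rewrite mulr_ge0// fine_ge0// sqL2_ge0.
(* The large factor $1+t^{-1}$ is fixed before [k], so the error of order $1/(k+1)$ absorbs it. *)
have small t e : 0 < t -> 0 < e -> exists k, (1 + t^-1) * (4 * c * k.+1%:R^-1) <= e.
  move=> t0 e0; have tt : 0 <= (1 + t^-1) * (4 * c).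
    by rewrite mulr_ge0 ?mulr_ge0// addr_ge0// invr_ge0 ltW.
  have := archi_boundP (divr_ge0 tt (ltW e0)); set n := Num.bound _ => hn; exists n.
  rewrite mulrA ler_pdivrMr ?ltr0n// -ler_pdivrMl// mulrC.
  by rewrite (le_trans (ltW hn))// ler_nat.
suff e : fine (sqL2 m F) = c * fine (sqL2 m' f).
  by rewrite -(fineK (sqL2_fin Fi)) e EFinM fineK// sqL2_fin.
apply/le_anti/andP; split.
(* From [F] to [F_ k], across the isometry to [f_ k], then to [f]; the converse inequality runs the
   same chain backwards. *)
- apply: le_quasi_limit => // t e t0 e0; have [k hk] := small t e t0 e0.
  have t1 : 0 < 1 + t^-1 by rewrite addr_gt0 ?invr_gt0.
  apply: (le_trans (quasi _ _ m _ _ t t0 Fi (Fi_ k))).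
  rewrite sqL2_subC lerD//; last by apply: le_trans hk; rewrite ler_pM2l// dkE.
  rewrite ler_pM2l ?addr_gt0// Fk.
  apply: (le_trans (ler_wpM2l c0 (quasi _ _ m' _ _ t t0 (fi_ k) fi))).
  rewrite mulrDr mulrCA lerD2l mulrCA; apply: le_trans hk; rewrite ler_pM2l//.
  rewrite -mulrA -[leLHS]mul1r ler_pM// ?mulr_ge0 ?fine_ge0 ?sqL2_ge0// ?ler1n// ler_wpM2l//.
- apply: le_quasi_limit; first by rewrite fine_ge0// sqL2_ge0.
  move=> t e t0 e0; have [k hk] := small t e t0 e0.
  have t1 : 0 < 1 + t^-1 by rewrite addr_gt0 ?invr_gt0.
  apply: (le_trans (ler_wpM2l c0 (quasi _ _ m' _ _ t t0 fi (fi_ k)))).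
  rewrite mulrDr mulrCA -Fk lerD//.
    rewrite ler_pM2l ?addr_gt0//.
    apply: (le_trans (quasi _ _ m _ _ t t0 (Fi_ k) Fi)); rewrite lerD2l.
    by apply: le_trans hk; rewrite ler_pM2l// dkE.
  rewrite sqL2_subC mulrCA; apply: le_trans hk; rewrite ler_pM2l//.
  by rewrite -mulrA -[leLHS]mul1r ler_pM// ?mulr_ge0 ?fine_ge0 ?sqL2_ge0// ?ler1n// ler_wpM2l.
Qed.

End isometry_limit.

(** * Fubini's theorem for complex functions *)

Section complex_fubini.
Context {d1 d2 : measure_display} {T1 : measurableType d1} {T2 : measurableType d2} {R : realType}.
Context (m1 : {sigma_finite_measure set T1 -> \bar R}) (m2 : {sigma_finite_measure set T2 -> \bar R}).

(** Tonelli makes the inner integrals of the positive and negative parts measurable; [fine] is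
    measurable and turns infinite values into 0. *)
Lemma measurable_integral2 (h : T1 * T2 -> R) : measurable_fun setT h ->
  measurable_fun setT (fun x => fine (\int[m2]_y (h (x, y))%:E)%E).
Proof.
move=> mh; have mEh : measurable_fun setT (EFin \o h) by exact/measurable_EFinP.
have : measurable_fun setT (fun x => \int[m2]_y ((EFin \o h)^\+ (x, y)) - \int[m2]_y ((EFin \o h)^\- (x, y)))%E.
  apply: emeasurable_funB.
  - by apply: (measurable_fun_fubini_tonelli_F ((EFin \o h)^\+)%E) => //; exact: measurable_funepos.
  - by apply: (measurable_fun_fubini_tonelli_F ((EFin \o h)^\-)%E) => //; exact: measurable_funeneg.
move=> /(measurableT_comp (@fine_measurable R _ measurableT)).
congr (measurable_fun _ _); apply/funext => x /=; rewrite [in RHS]integralE.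
by congr (fine (_ - _)%E); apply: eq_integral => y _ /=; rewrite ?funeposE ?funenegE.
Qed.

Lemma measurable_integral1 (h : T1 * T2 -> R) : measurable_fun setT h ->
  measurable_fun setT (fun y => fine (\int[m1]_x (h (x, y))%:E)%E).
Proof.
move=> mh; have mEh : measurable_fun setT (EFin \o h) by exact/measurable_EFinP.
have : measurable_fun setT (fun y => \int[m1]_x ((EFin \o h)^\+ (x, y)) - \int[m1]_x ((EFin \o h)^\- (x, y)))%E.
  apply: emeasurable_funB.
  - by apply: (measurable_fun_fubini_tonelli_G ((EFin \o h)^\+)%E) => //; exact: measurable_funepos.
  - by apply: (measurable_fun_fubini_tonelli_G ((EFin \o h)^\-)%E) => //; exact: measurable_funeneg.
move=> /(measurableT_comp (@fine_measurable R _ measurableT)).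
congr (measurable_fun _ _); apply/funext => x /=; rewrite [in RHS]integralE.
by congr (fine (_ - _)%E); apply: eq_integral => y _ /=; rewrite ?funeposE ?funenegE.
Qed.

(** Almost every slice is integrable, so [fine] alters the inner integral on a null set only. *)
Lemma fine_fubini12 (h : T1 * T2 -> R) : (m1 \x m2)%E.-integrable setT (EFin \o h) ->
  (\int[m1]_x (fine (\int[m2]_y (h (x, y))%:E))%:E = \int[m1 \x m2]_z (h z)%:E)%E.
Proof.
move=> hi; rewrite -(integral12_prod_meas1 hi).
have mh : measurable_fun setT h by apply/measurable_EFinP; exact: measurable_int hi.
apply: ae_eq_integral => //.
- by apply/measurable_EFinP; exact: measurable_integral2.
- exact: (measurable_fubini_F hi).
have := integrable_ae measurableT (integrable_fubini_F hi).
by apply: filterS => x h1 _; rewrite fineK//; exact: h1.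
Qed.

Lemma fine_fubini21 (h : T1 * T2 -> R) : (m1 \x m2)%E.-integrable setT (EFin \o h) ->
  (\int[m2]_y (fine (\int[m1]_x (h (x, y))%:E))%:E = \int[m1 \x m2]_z (h z)%:E)%E.
Proof.
move=> hi; rewrite -(integral21_prod_meas1 hi).
have mh : measurable_fun setT h by apply/measurable_EFinP; exact: measurable_int hi.
apply: ae_eq_integral => //.
- by apply/measurable_EFinP; exact: measurable_integral1.
- exact: (measurable_fubini_G hi).
have := ae_integrable2 hi.
by apply: filterS => y /(integrable_fin_num measurableT) h1 _; rewrite fineK.
Qed.

Lemma cmeasurable_cintegral2 (h : T1 * T2 -> R[i]) : cmeasurable setT h ->
  cmeasurable setT (fun x => cintegral m2 setT (fun y => h (x, y))).
Proof.
move=> [h1 h2]; split => /=.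
- exact: (measurable_integral2 h1).
- exact: (measurable_integral2 h2).
Qed.

Lemma cmeasurable_cintegral1 (h : T1 * T2 -> R[i]) : cmeasurable setT h ->
  cmeasurable setT (fun y => cintegral m1 setT (fun x => h (x, y))).
Proof.
move=> [h1 h2]; split => /=.
- exact: (measurable_integral1 h1).
- exact: (measurable_integral1 h2).
Qed.

Lemma cfubini12 (h : T1 * T2 -> R[i]) : inL1 (m1 \x m2)%E h ->
  cintegral m1 setT (fun x => cintegral m2 setT (fun y => h (x, y))) =
  cintegral (m1 \x m2)%E setT h.
Proof.
move=> /inL1P[h1 h2]; rewrite /cintegral /=; congr (fine _ +i* fine _).
- exact: (fine_fubini12 h1).
- exact: (fine_fubini12 h2).
Qed.

Lemma cfubini21 (h : T1 * T2 -> R[i]) : inL1 (m1 \x m2)%E h ->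
  cintegral m2 setT (fun y => cintegral m1 setT (fun x => h (x, y))) =
  cintegral (m1 \x m2)%E setT h.
Proof.
move=> /inL1P[h1 h2]; rewrite /cintegral /=; congr (fine _ +i* fine _).
- exact: (fine_fubini21 h1).
- exact: (fine_fubini21 h2).
Qed.

(** As [k] is unimodular, Tonelli factors the integral of the modulus into the two $L^1$ norms. *)
Lemma inL1_prod (f : T1 -> R[i]) (g : T2 -> R[i]) (k : T1 * T2 -> R[i]) :
  inL1 m1 f -> inL1 m2 g -> cmeasurable setT k -> (forall z, normc (k z) = 1) ->
  inL1 (m1 \x m2)%E (fun z => f z.1 * g z.2 * k z).
Proof.
move=> [mf fi] [mg gi] mk k1.
have mf1 : cmeasurable setT (fun z : T1 * T2 => f z.1).
  exact: (cmeasurable_comp measurable_fst mf).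
have mg2 : cmeasurable setT (fun z : T1 * T2 => g z.2).
  exact: (cmeasurable_comp measurable_snd mg).
have mfgk : cmeasurable setT (fun z => f z.1 * g z.2 * k z).
  by apply: cmeasurableM => //; exact: cmeasurableM.
split=> //; have mn := measurable_normc mfgk.
rewrite (fubini_tonelli1 (fun z => (normc (f z.1 * g z.2 * k z))%:E)); last 2 first.
- exact/measurable_EFinP.
- by move=> z; rewrite lee_fin normc_ge0.
rewrite /fubini_F/=.
have gf : (\int[m2]_x (normc (g x))%:E)%E \is a fin_num.
  by rewrite ge0_fin_numE// integral_ge0// => x _; rewrite lee_fin normc_ge0.
rewrite (eq_integral (fun x => (normc (f x))%:E * \int[m2]_y (normc (g y))%:E)%E); last first.
  move=> x _; rewrite -ge0_integralZl//.
  - by apply: eq_integral => y _; rewrite !normcM k1 mulr1 EFinM.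
  - by apply/measurable_EFinP; exact: measurable_normc.
  - by move=> y _; rewrite lee_fin normc_ge0.
  - by rewrite lee_fin normc_ge0.
rewrite ge0_integralZr//.
- by rewrite -(fineK gf) muleC lte_mul_pinfty// lee_fin fine_ge0// integral_ge0// => x _; rewrite lee_fin normc_ge0.
- by apply/measurable_EFinP; exact: measurable_normc.
- by move=> y _; rewrite lee_fin normc_ge0.
- by apply: integral_ge0 => x _; rewrite lee_fin normc_ge0.
Qed.

End complex_fubini.

(** * Integration against Haar measure *)

Section exchange.
Context {d1 d2 : measure_display} {T1 : measurableType d1} {T2 : measurableType d2} {R : realType}.
Context (m1 : {sigma_finite_measure set T1 -> \bar R}) (m2 : {sigma_finite_measure set T2 -> \bar R}).

(** Fubini in the form suited to Fourier kernels; it yields both [fourier_exchange] and the Fourier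
    formula for wavelet coefficients. *)
Lemma cintegral_exchange (f : T1 -> R[i]) (g : T2 -> R[i]) (k : T1 * T2 -> R[i]) :
  inL1 m1 f -> inL1 m2 g -> cmeasurable setT k -> (forall z, normc (k z) = 1) ->
  cintegral m2 setT (fun y => g y * cintegral m1 setT (fun x => f x * k (x, y))) =
  cintegral m1 setT (fun x => f x * cintegral m2 setT (fun y => g y * k (x, y))).
Proof.
move=> fi gi mk k1.
have k1x x : inL1 m2 (fun y => g y * k (x, y)).
  apply: (@inL1_bounded_mul _ _ _ _ 1) => //; last by move=> y; rewrite k1.
  exact: (cmeasurable_comp (measurable_pair1 x) mk).
have k2y y : inL1 m1 (fun x => f x * k (x, y)).
  apply: (@inL1_bounded_mul _ _ _ _ 1) => //; last by move=> x; rewrite k1.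
  exact: (cmeasurable_comp (measurable_pair2 y) mk).
have h := inL1_prod fi gi mk k1.
transitivity (cintegral m2 setT (fun y => cintegral m1 setT (fun x => f x * g y * k (x, y)))).
  apply: eq_cintegral => y; rewrite -cintegralZ//.
  by apply: eq_cintegral => x; rewrite mulrCA mulrA.
rewrite (cfubini21 h) -(cfubini12 h); apply: eq_cintegral => x.
rewrite -cintegralZ//=; by apply: eq_cintegral => y; rewrite mulrA.
Qed.

End exchange.

Section haar_integral.
Context {R : realType} {K : localFieldType}.
Context {mu : {sigma_finite_measure set (borel K) -> \bar R}} {absK : K -> R} {chi : K -> R[i]}.
Context (H : normalized_haar mu absK chi).
Local Notation disc := (@disc R K absK).
Implicit Types (a b x y : K).

Lemma measurable_affine a b : measurable_fun setT ((fun x => a * x + b) : borel K -> borel K).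
Proof.
apply: (measurable_addK H); last exact: measurable_cst.
by apply: (measurable_mulK H); first exact: measurable_cst.
Qed.

Lemma haar_affine a b (A : set K) : a != 0 -> measurable (A : set (borel K)) ->
  mu [set x | A (a * x + b)] = ((absK a)^-1%:E * mu A)%E.
Proof.
move=> a0 mA.
have mA' : measurable ([set - b + x | x in A] : set (borel K)).
  rewrite addl_imageE -[X in measurable X]setTI.
  by apply: (continuous_measurableK (@addl_continuous K _)).
rewrite -(absKV H) -(haar_addl H (- b) mA) -(haar_mull H (invr_neq0 a0) mA').
congr (mu _); rewrite addl_imageE mull_imageE ?invr_eq0// invrK opprK.
by apply/seteqP; split=> x /=; rewrite addrC.
Qed.

(** By [haar_affine] the image of [mu] under the affine map is [mu] scaled by $|a|^{-1}$. *)
Lemma ge0_integral_affine a b (h : K -> \bar R) : a != 0 ->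
  measurable_fun setT (h : borel K -> \bar R) -> (forall x, 0 <= h x)%E ->
  (\int[mu]_x h (a * x + b)%R = (absK a)^-1%:E * \int[mu]_x h x)%E.
Proof.
move=> a0 mh h0.
have a1 : 0 <= (absK a)^-1 by rewrite invr_ge0 (absK_ge0 H).
have := @ge0_integral_pushforward _ _ _ _ R _ (measurable_affine a b) mu setT h measurableT mh.
rewrite preimage_setT => <-; last by move=> x _; exact: h0.
rewrite (eq_measure_integral (mscale (NngNum a1) mu)); last first.
- by move=> ? A mA _; exact: haar_affine.
- exact: measurable_affine.
- by rewrite ge0_integral_mscale.
Qed.

Lemma cmeasurable_affine a b (f : K -> R[i]) : cmeasurable setT (f : borel K -> R[i]) ->
  cmeasurable setT ((fun x => f (a * x + b)) : borel K -> R[i]).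
Proof. by move=> mf; exact: (cmeasurable_comp (measurable_affine a b) mf). Qed.

Lemma sqL2_affine a b (f : K -> R[i]) : a != 0 -> cmeasurable setT (f : borel K -> R[i]) ->
  sqL2 mu (fun x => f (a * x + b)) = ((absK a)^-1%:E * sqL2 mu f)%E.
Proof.
move=> a0 mf; apply: (@ge0_integral_affine a b (fun x => (normc (f x) ^+ 2)%:E)) => //.
- exact: measurable_sqL2.
- by move=> x; rewrite lee_fin sqr_ge0.
Qed.

Lemma inL2_affine a b (f : K -> R[i]) : a != 0 -> inL2 mu f ->
  inL2 mu (fun x => f (a * x + b)).
Proof.
move=> a0 [mf fi]; split; first exact: cmeasurable_affine.
by rewrite -/(sqL2 mu _) sqL2_affine// lte_mul_pinfty// lee_fin invr_ge0 (absK_ge0 H).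
Qed.

Lemma inL1_affine a b (f : K -> R[i]) : a != 0 -> inL1 mu f ->
  inL1 mu (fun x => f (a * x + b)).
Proof.
move=> a0 [mf fi]; split; first exact: cmeasurable_affine.
rewrite (@ge0_integral_affine a b (fun x => (normc (f x))%:E))//.
- by rewrite lte_mul_pinfty// lee_fin invr_ge0 (absK_ge0 H).
- by apply/measurable_EFinP; exact: measurable_normc.
- by move=> x; rewrite lee_fin normc_ge0.
Qed.

Lemma cintegral_affine a b (f : K -> R[i]) : a != 0 -> inL1 mu f ->
  cintegral mu setT (fun x => f (a * x + b)) = ((absK a)^-1)%:C * cintegral mu setT f.
Proof.
move=> a0 fi; have [[m1 m2] _] := fi; have [i1 i2] := iffLR (inL1P _ _) fi.
have [j1 j2] := iffLR (inL1P _ _) (inL1_affine b a0 fi).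
have h (k : K -> R) : measurable_fun setT (k : borel K -> R) ->
    mu.-integrable setT (EFin \o (k : borel K -> R)) ->
    fine (\int[mu]_x (k (a * x + b)%R)%:E)%E = (absK a)^-1 * fine (\int[mu]_x (k x)%:E)%E.
  move=> mk ik; have mEk : measurable_fun setT (EFin \o (k : borel K -> R)) by exact/measurable_EFinP.
  have p1 := integrable_fin_num measurableT (integrable_funepos measurableT ik).
  have p2 := integrable_fin_num measurableT (integrable_funeneg measurableT ik).
  rewrite -[(absK a)^-1]/(fine ((absK a)^-1)%:E) -fineM ?(integrable_fin_num _ ik)//.
  congr fine; rewrite [LHS]integralE [in RHS]integralE muleBr//; last first.
    by rewrite fin_num_adde_defr.
  congr (_ - _)%E.
  - rewrite -(@ge0_integral_affine a b (EFin \o k)^\+%E)//.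
    + by apply: eq_integral => x _; rewrite /= ?funeposE.
    + exact: measurable_funepos.
  - rewrite -(@ge0_integral_affine a b (EFin \o k)^\-%E)//.
    + by apply: eq_integral => x _; rewrite /= ?funenegE.
    + exact: measurable_funeneg.
rewrite /cintegral (h (fun x => complex.Re (f x)))// (h (fun x => complex.Im (f x)))//.
by apply/eqP; rewrite eq_complex/=; apply/andP; split; apply/eqP; ring.
Qed.

Lemma cintegral_translate b (f : K -> R[i]) : inL1 mu f ->
  cintegral mu setT (fun x => f (x + b)) = cintegral mu setT f.
Proof.
move=> fi; have := cintegral_affine b (oner_neq0 K) fi.
rewrite (absK1 H) invr1 mul1r => <-.
by apply: eq_cintegral => x; rewrite mul1r.
Qed.

Lemma chi_locally_constant x y : absK y <= 1 -> chi (x + y) = chi x.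
Proof. by move=> y1; rewrite (chiD H) (chi_D H y1) mulr1. Qed.

Lemma cmeasurable_locally_constant (f : K -> R[i]) t : 0 < t ->
  (forall x y, absK y <= t -> f (x + y) = f x) -> cmeasurable setT (f : borel K -> R[i]).
Proof.
move=> t0 hf; split=> _ B mB; rewrite setTI; apply: open_measurableK;
  apply: (open_disc_invariant H t0) => x y /=; by [move=> + yt; rewrite hf].
Qed.

Lemma cmeasurable_chi : cmeasurable setT (chi : borel K -> R[i]).
Proof. by apply: (@cmeasurable_locally_constant _ 1) => // x y; exact: chi_locally_constant. Qed.

Lemma normc_chi x : normc (chi x) = 1.
Proof. by apply: normc_normr1; exact: (normr_chi H). Qed.

Lemma cmeasurable_kernel : cmeasurable setT ((fun z => (chi (z.1 * z.2))^*) : borel K * borel K -> R[i]).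
Proof.
apply: cmeasurable_conj; apply: (cmeasurable_comp _ cmeasurable_chi).
by apply: (measurable_mulK H); [exact: measurable_fst|exact: measurable_snd].
Qed.

Lemma normc_kernel (z : K * K) : normc (chi (z.1 * z.2))^* = 1.
Proof. by rewrite normc_conjc normc_chi. Qed.

Lemma cmeasurable_chir y : cmeasurable setT ((fun x => chi (x * y)) : borel K -> R[i]).
Proof.
apply: (cmeasurable_comp _ cmeasurable_chi).
by apply: (measurable_mulK H) => //; exact: measurable_cst.
Qed.

Lemma inL1_chi y (f : K -> R[i]) : inL1 mu f -> inL1 mu (fun x => f x * chi (x * y)).
Proof.
move=> fi; apply: (@inL1_bounded_mul _ _ _ _ 1) => //; first exact: cmeasurable_chir.
by move=> x; rewrite normc_chi.
Qed.

Lemma inL1_conj_chi y (f : K -> R[i]) : inL1 mu f -> inL1 mu (fun x => f x * (chi (x * y))^*).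
Proof.
move=> fi; apply: (@inL1_bounded_mul _ _ _ _ 1) => //.
  by apply: cmeasurable_conj; exact: cmeasurable_chir.
by move=> x; rewrite normc_conjc normc_chi.
Qed.

Definition ind (t : R) (x : K) : R[i] := (\1_(disc t) x : R)%:C.

Lemma indE t x : ind t x = if absK x <= t then 1 else 0.
Proof.
rewrite /ind indicE; case: ifPn => xt; first by rewrite mem_set.
by rewrite memNset//= => /idP; rewrite (negPf xt).
Qed.

Lemma normc_ind t x : normc (ind t x) = \1_(disc t) x.
Proof. by rewrite normc_real ger0_norm. Qed.

Lemma cmeasurable_ind t : cmeasurable setT (ind t : borel K -> R[i]).
Proof. by apply: cmeasurable_real; apply: measurable_indic; exact: (measurable_disc H). Qed.

Lemma inL1_ind a : a != 0 -> inL1 mu (ind (absK a)).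
Proof.
move=> a0; split; first exact: cmeasurable_ind.
under eq_integral do rewrite normc_ind.
by rewrite integral_indic ?setIT ?(haar_disc H) ?ltry//; exact: (measurable_disc H).
Qed.

Lemma cintegral_ind a : a != 0 -> cintegral mu setT (ind (absK a)) = (absK a)%:C.
Proof.
move=> a0; have mD := measurable_disc H (absK a).
have e1 : (\int[mu]_x (complex.Re (ind (absK a) x))%:E)%E = (absK a)%:E.
  by rewrite /ind/= integral_indic ?setIT// (haar_disc H).
have e2 : (\int[mu]_x (complex.Im (ind (absK a) x))%:E)%E = 0%E by exact: integral0_eq.
by rewrite /cintegral e1 e2.
Qed.

(** Orthogonality of characters on the compact group [disc (absK a)]: a trivial character integrates
    to the measure of the disc, a nontrivial one to 0. *)
Lemma cintegral_ind_chi a y : a != 0 ->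
  cintegral mu setT (fun x => ind (absK a) x * chi (x * y)) = (absK a)%:C * ind (absK a)^-1 y.
Proof.
move=> a0; have aK0 := absK_gt0 H a0; rewrite (indE (absK a)^-1 y); case: ifPn => ya.
  rewrite mulr1 -(cintegral_ind a0); apply: eq_cintegral => x; rewrite indE.
  case: ifPn => xa; last by rewrite mul0r.
  rewrite mul1r (chi_D H)// (absKM H).
  by rewrite -(divff (lt0r_neq0 aK0)) ler_pM ?(absK_ge0 H).
(* If $\chi(zy)$ were 1 on the whole disc, self-duality of [D] would put [a * y] in [D]. *)
have [z za chiz] : exists2 z, absK z <= absK a & chi (z * y) != 1.
  apply: contrapT => h; move/negP: ya; apply.
  have : absK (a * y) <= 1.
    apply: (chi_dual H) => w w1; apply: contrapT => /eqP chiw.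
    by apply: h; exists (a * w); rewrite 1?mulrAC// (absKM H) ler_piMr// ltW.
  by rewrite (absKM H) -ler_pdivlMl// mulr1.
rewrite mulr0; set f := (fun x => _); have fi : inL1 mu f by apply: inL1_chi; exact: inL1_ind.
(* Translation by [z] preserves the disc and multiplies the integrand by $\chi(zy)\ne1$, so the
   integral equals itself times a factor other than 1. *)
have := cintegral_translate z fi.
rewrite (@eq_cintegral _ _ _ _ _ (fun x : borel K => chi (z * y) * f x)); last first.
  move=> x; rewrite /f mulrDl (chiD H) !indE.
  have -> : (absK (x + z) <= absK a) = (absK x <= absK a).
    apply/idP/idP => xa; last exact: (absK_add H).
    by rewrite -(addrK z x); exact: (absK_sub H).
  by rewrite mulrA mulrC.
rewrite cintegralZ// => /eqP; rewrite -subr_eq0 -[X in _ - X]mul1r -mulrBl mulf_eq0.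
by rewrite subr_eq0 (negPf chiz) => /eqP.
Qed.

End haar_integral.

(** * The Fourier transform of test functions *)

Section bounded_functions.
Context {d : measure_display} {T : measurableType d} {R : realType}.
Context (m : {measure set T -> \bar R}).

Lemma inL2_bounded_inL1 (M : R) (f : T -> R[i]) : inL1 m f ->
  (forall x, normc (f x) <= M) -> inL2 m f.
Proof.
move=> [mf fi] fM; split => //.
have M0 : 0 <= M by exact: le_trans (normc_ge0 _) (fM point).
have mn : measurable_fun setT (fun x => (normc (f x))%:E).
  by apply/measurable_EFinP; exact: measurable_normc.
apply: (@le_lt_trans _ _ (\int[m]_x (M%:E * (normc (f x))%:E))%E).
  apply: ge0_le_integral => //.
  - by move=> x _; rewrite lee_fin sqr_ge0.
  - exact: measurable_sqL2.
  - exact: measurable_funeM.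
  - by move=> x _; rewrite -EFinM lee_fin expr2 ler_wpM2r// normc_ge0.
rewrite ge0_integralZl//; first by rewrite lte_mul_pinfty.
by move=> x _; rewrite lee_fin normc_ge0.
Qed.

Lemma L2dot_self (f : T -> R[i]) : L2dot m f f = (fine (sqL2 m f))%:C.
Proof.
rewrite /L2dot /cintegral; congr (_ +i* _).
  by congr fine; apply: eq_integral => x _; rewrite mulr_conjc.
rewrite (_ : (\int[m]_x _)%E = 0%E)//.
by apply: integral0_eq => x _; rewrite mulr_conjc.
Qed.

End bounded_functions.

Section test_functions.
Context {R : realType} {K : localFieldType}.
Context {mu : {sigma_finite_measure set (borel K) -> \bar R}} {absK : K -> R} {chi : K -> R[i]}.
Context (H : normalized_haar mu absK chi).
Local Notation disc := (@disc R K absK).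
Local Notation ind := (@ind R K absK).
Local Notation fhat := (@fourierL1 R K mu chi).
Implicit Types (a b x y : K) (f g h : K -> R[i]).

Definition locally_constant_on (a : K) f :=
  (forall x, absK a < absK x -> f x = 0) /\
  (forall x y, absK y <= (absK a)^-1 -> f (x + y) = f x).

(* Schwartz-Bruhat functions: [a] gives at once a disc carrying the support and
   a dual disc of periods; asking for a bound spares a compactness argument. *)
Definition test_fun f := exists a (M : R),
  [/\ 1 <= absK a, locally_constant_on a f & forall x, normc (f x) <= M].

Lemma absK_ge1_neq0 a : 1 <= absK a -> a != 0.
Proof. by move=> a1; rewrite -(absK_eq0 H) gt_eqF// (lt_le_trans ltr01). Qed.

Lemma locally_constant_on_le a b f : 1 <= absK a -> absK a <= absK b ->
  locally_constant_on a f -> locally_constant_on b f.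
Proof.
move=> a1 ab [f1 f2]; split=> [x bx|x y yb]; first by apply: f1; exact: le_lt_trans bx.
apply: f2; apply: (le_trans yb); rewrite lef_pV2// posrE (lt_le_trans ltr01)//.
exact: (le_trans a1).
Qed.

Lemma locally_constant_on_mul_ind a f : locally_constant_on a f ->
  f = (fun x => ind (absK a) x * f x).
Proof.
move=> [f1 _]; apply/funext => x; rewrite indE; case: ifPn => [_|]; first by rewrite mul1r.
by rewrite -ltNge => /f1 ->; rewrite mulr0.
Qed.

Lemma test_fun_inL1 f : test_fun f -> inL1 mu f.
Proof.
move=> [a [M [a1 fa fM]]]; have a0 := absK_ge1_neq0 a1.
rewrite (locally_constant_on_mul_ind fa).
apply: (@inL1_bounded_mul _ _ _ mu M) => //; last exact: (inL1_ind H).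
apply: (@cmeasurable_locally_constant _ _ mu _ _ H _ (absK a)^-1); last by case: fa.
by rewrite invr_gt0 (absK_gt0 H).
Qed.

Lemma test_fun_inL2 f : test_fun f -> inL2 mu f.
Proof.
move=> tf; have fi := test_fun_inL1 tf; case: tf => [a [M [_ _ fM]]].
exact: (inL2_bounded_inL1 fi fM).
Qed.

Lemma test_fun_comb (c : R[i]) f g : test_fun f -> test_fun g ->
  test_fun (fun x => f x + c * g x).
Proof.
move=> [a [M [a1 fa fM]]] [b [N [b1 gb gN]]].
have [e [e1 ae be]] : exists e, [/\ 1 <= absK e, absK a <= absK e & absK b <= absK e].
  have [|/ltW] := leP (absK a) (absK b); first by exists b.
  by exists a.
have [f1 f2] := locally_constant_on_le a1 ae fa.
have [g1 g2] := locally_constant_on_le b1 be gb.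
exists e, (M + normc c * N); split=> //.
  split=> [x xe|x y ye]; first by rewrite f1// g1// mulr0 addr0.
  by rewrite f2// g2.
by move=> x; rewrite (le_trans (le_normcD _ _))// lerD// normcM ler_wpM2l ?normc_ge0.
Qed.

Lemma test_funB f g : test_fun f -> test_fun g -> test_fun (fun x => f x - g x).
Proof.
move=> tf tg; have := test_fun_comb (-1) tf tg; congr test_fun.
by apply/funext => x; rewrite mulN1r.
Qed.

Lemma cmeasurable_fourier f : inL1 mu f -> cmeasurable setT (fhat f : borel K -> R[i]).
Proof.
move=> [mf _]; apply: (@cmeasurable_cintegral1 _ _ _ _ _ mu
  (fun z : borel K * borel K => f z.1 * (chi (z.1 * z.2))^*)).
apply: cmeasurableM; last exact: (cmeasurable_kernel H).
exact: (cmeasurable_comp measurable_fst mf).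
Qed.

Lemma normc_fourier_le f xi : inL1 mu f ->
  ((normc (fhat f xi))%:E <= \int[mu]_x (normc (f x))%:E)%E.
Proof.
move=> fi; apply: (le_trans (le_normc_cintegral (inL1_conj_chi H xi fi))).
by under eq_integral do rewrite normcM normc_conjc (normc_chi H) mulr1.
Qed.

Lemma fourierB f g xi : inL1 mu f -> inL1 mu g ->
  fhat (fun x => f x - g x) xi = fhat f xi - fhat g xi.
Proof.
move=> fi gi; rewrite /fourierL1 -cintegralB; [|exact: (inL1_conj_chi H)..].
by apply: eq_cintegral => x; rewrite mulrBl.
Qed.

Lemma fourier_exchange f g : inL1 mu f -> inL1 mu g ->
  cintegral mu setT (fun xi => g xi * fhat f xi) =
  cintegral mu setT (fun x => f x * fhat g x).
Proof.
move=> fi gi; have := cintegral_exchange fi gi (cmeasurable_kernel H) (normc_kernel H).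
move=> /= ->; apply: eq_cintegral => x; congr (_ * _).
by apply: eq_cintegral => y; rewrite [x * y]mulrC.
Qed.

(** Duality of the two conditions: a support in the disc of radius $|a|$ gives periods of size
    $|a|^{-1}$ on the other side because [chi] is trivial on [D], and periods give back a support by
    the translation argument of [cintegral_ind_chi]. *)
Lemma locally_constant_on_fourier a f : a != 0 -> inL1 mu f ->
  locally_constant_on a f -> locally_constant_on a (fhat f).
Proof.
move=> a0 fi [f1 f2]; have aK0 := absK_gt0 H a0.
split=> [xi axi|xi eta eta1]; last first.
  apply: eq_cintegral => x.
  have [xa|/f1 ->] := leP (absK x) (absK a); last by rewrite !mul0r.
  rewrite mulrDr (chiD H) [chi (x * eta)](chi_D H) ?mulr1//.
  by rewrite (absKM H) -(divff (lt0r_neq0 aK0)) ler_pM ?(absK_ge0 H).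
have [z za chiz] : exists2 z, absK z <= (absK a)^-1 & chi (z * xi) != 1.
  apply: contrapT => h; move: axi; rewrite ltNge => /negP; apply.
  have : absK (a^-1 * xi) <= 1.
    apply: (chi_dual H) => w w1; apply: contrapT => /eqP chiw.
    apply: h; exists (a^-1 * w); rewrite 1?mulrAC// (absKM H) (absKV H) ler_piMr//.
    by rewrite invr_ge0 ltW.
  by rewrite (absKM H) (absKV H) ler_pdivrMl// mulr1.
have fxi := inL1_conj_chi H xi fi.
have := cintegral_translate H z fxi.
rewrite (@eq_cintegral _ _ _ _ _ (fun x : borel K => (chi (z * xi))^* * (f x * (chi (x * xi))^*))); last first.
  by move=> x; rewrite f2// mulrDl (chiD H) rmorphM/=; ring.
rewrite cintegralZ// => /eqP; rewrite -subr_eq0 -[X in _ - X]mul1r -mulrBl mulf_eq0.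
by rewrite subr_eq0 -[1]conjc1 (inj_eq (can_inj (@conjcK R))) (negPf chiz) => /eqP.
Qed.

Lemma test_fun_fourier f : test_fun f -> test_fun (fhat f).
Proof.
move=> tf; have fi := test_fun_inL1 tf; case: tf => a [M [a1 fa fM]].
exists a, (fine (\int[mu]_x (normc (f x))%:E)%E); split=> //.
  by apply: locally_constant_on_fourier => //; exact: absK_ge1_neq0.
move=> x; rewrite -lee_fin fineK; first exact: normc_fourier_le.
by case: fi => _ foo; rewrite ge0_fin_numE// integral_ge0// => y _; rewrite lee_fin normc_ge0.
Qed.

(** The transform is supported in the disc of radius $|a|$, so the character may be cut off there.
    Exchanging the integrals leaves the average of [f] over the disc of radius $|a|^{-1}$ around
    [x], on which [f] is constant. *)
Lemma fourier_inversion f x : test_fun f ->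
  cintegral mu setT (fun xi => fhat f xi * chi (x * xi)) = f x.
Proof.
move=> tf; have fi := test_fun_inL1 tf; case: tf => a [M [a1 fa fM]].
have a0 := absK_ge1_neq0 a1; have aK0 := absK_gt0 H a0.
have Fa := locally_constant_on_fourier a0 fi fa.
pose g (xi : borel K) := ind (absK a) xi * chi (xi * x).
have gi : inL1 mu g by apply: (inL1_chi H); exact: (inL1_ind H).
rewrite (@eq_cintegral _ _ _ _ _ (fun xi : borel K => g xi * fhat f xi)); last first.
  by move=> xi; rewrite {1}(locally_constant_on_mul_ind Fa) /g [x * _]mulrC mulrAC.
rewrite fourier_exchange//.
have gE y : fhat g y = (absK a)%:C * ind (absK a)^-1 (y - x).
  rewrite -(opprB x y) (_ : ind _ (- _) = ind (absK a)^-1 (x - y)); last first.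
    by rewrite !indE (absKN H).
  rewrite -(cintegral_ind_chi H _ a0); apply: eq_cintegral => z.
  by rewrite /g -mulrA mulrBr (chiD H) (chiN H).
rewrite (@eq_cintegral _ _ _ _ _ (fun y : borel K => (f x * (absK a)%:C) * ind (absK a^-1) (y - x))); last first.
  move=> y; rewrite gE (absKV H) indE; case: ifPn => yx; last by rewrite !mulr0.
  by case: fa => _ f2; rewrite -[in f y](subrK x y) addrC f2// !mulr1.
have ii : inL1 mu (ind (absK a^-1)) by apply: (inL1_ind H); rewrite invr_eq0.
rewrite cintegralZ; last first.
  have := inL1_affine H (- x) (oner_neq0 K) ii.
  by congr inL1; apply/funext => y; rewrite mul1r.
rewrite (cintegral_translate H (- x) ii) (cintegral_ind H) ?invr_eq0// (absKV H).
by rewrite -mulrA -rmorphM/= divff ?mulr1// gt_eqF.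
Qed.

(** Moving the transform across the integral by [fourier_exchange] applies it to the conjugate of
    [fhat f], which gives the conjugate of [f] by inversion. *)
Lemma test_fun_parseval f : test_fun f -> sqL2 mu (fhat f) = sqL2 mu f.
Proof.
move=> tf; have fi := test_fun_inL1 tf; have tF := test_fun_fourier tf.
have e : L2dot mu (fhat f) (fhat f) = L2dot mu f f.
  have Fci := inL1_conj (test_fun_inL1 tF).
  rewrite /L2dot (@eq_cintegral _ _ _ _ _ (fun xi : borel K => (fhat f xi)^* * fhat f xi)); last first.
    by move=> xi; rewrite mulrC.
  rewrite fourier_exchange//; apply: eq_cintegral => x; congr (_ * _).
  rewrite -(fourier_inversion x tf) -cintegral_conj; last first.
    have := inL1_chi H x (test_fun_inL1 tF); congr inL1; apply/funext => y.
    by rewrite [x * y]mulrC.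
  by apply: eq_cintegral => xi; rewrite rmorphM/= [x * xi]mulrC.
have := congr1 (@complex.Re R) e; rewrite !L2dot_self /= => e'.
by rewrite -(fineK (sqL2_fin (test_fun_inL2 tF))) e' fineK// (sqL2_fin (test_fun_inL2 tf)).
Qed.

End test_functions.

(** * Density of test functions and Plancherel *)

Lemma cvg0_exists_le {R : realType} (u : (\bar R)^nat) (e : R) : 0 < e ->
  u @ \oo --> 0%E -> exists n, (u n <= e%:E)%E.
Proof.
move=> e0 u0; apply: contrapT => h; move: e0; apply/negP; rewrite -leNgt -lee_fin.
rewrite (_ : 0%:E = limn u); last by apply/esym/cvg_lim.
apply: lime_ge; first by apply/cvg_ex; exists 0%E.
apply: nearW => n; rewrite leNgt; apply/negP => un.
by apply: h; exists n; exact: ltW.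
Qed.

(** * Approximation reduced to indicator functions *)

Section gauge.
Context {d : measure_display} {T : measurableType d} {R : realType}.
Context (m : {measure set T -> \bar R}) (th : R).
Hypothesis th0 : 0 <= th.
Implicit Types (f g : T -> R[i]).

(* [th = 0] measures approximation in L^2, [th = 1] simultaneous approximation
   in L^1 and L^2. *)
Definition gauge f : \bar R := (\int[m]_x (th * normc (f x) + normc (f x) ^+ 2)%:E)%E.

Lemma measurable_gauge f : cmeasurable setT f ->
  measurable_fun setT (fun x => (th * normc (f x) + normc (f x) ^+ 2)%:E).
Proof.
move=> mf; apply/measurable_EFinP; apply: measurable_funD; last exact: measurable_sqr_normc.
by apply: measurable_funM => //; exact: measurable_normc.
Qed.

Lemma gauge_bound (a b : R) f g h : 0 <= a -> 0 <= b ->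
  cmeasurable setT f -> cmeasurable setT g -> cmeasurable setT h ->
  (forall x, th * normc (h x) + normc (h x) ^+ 2 <=
    a * (th * normc (f x) + normc (f x) ^+ 2) + b * (th * normc (g x) + normc (g x) ^+ 2)) ->
  (gauge h <= a%:E * gauge f + b%:E * gauge g)%E.
Proof.
move=> a0 b0 mf mg mh hle.
have pos k x : 0 <= th * normc (k x : R[i]) + normc (k x) ^+ 2 :> R.
  by rewrite addr_ge0 ?sqr_ge0// mulr_ge0// normc_ge0.
have ms (r : R) k : cmeasurable setT k -> measurable_fun setT (fun x : T => r%:E * (th * normc (k x) + normc (k x) ^+ 2)%:E)%E.
  by move=> mk; apply: measurable_funeM; exact: measurable_gauge.
rewrite /gauge -!ge0_integralZl//; try exact: measurable_gauge; try by move=> x _; rewrite lee_fin.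
rewrite -ge0_integralD//; try exact: ms; try by move=> x _; rewrite -EFinM lee_fin mulr_ge0.
apply: ge0_le_integral => //.
- by move=> x _; rewrite lee_fin.
- exact: measurable_gauge.
- by apply: emeasurable_funD; exact: ms.
- by move=> x _; rewrite -!EFinM -EFinD lee_fin.
Qed.

Lemma gaugeD f g : cmeasurable setT f -> cmeasurable setT g ->
  (gauge (fun x => f x + g x)%R <= 2%:E * gauge f + 2%:E * gauge g)%E.
Proof.
move=> mf mg; apply: gauge_bound => //; first exact: cmeasurableD.
move=> x; have := @sqr_normc_quasi R (f x + g x) (f x) 1 ltr01.
rewrite addrAC subrr add0r invr1 => h.
have : th * normc (f x + g x) <= th * (normc (f x) + normc (g x)).
  by rewrite ler_wpM2l// le_normcD.
have := mulr_ge0 th0 (normc_ge0 (f x)); have := mulr_ge0 th0 (normc_ge0 (g x)).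
lra.
Qed.

(** The two terms of the gauge scale by $|c|$ and $|c|^2$, and the sum dominates both. *)
Lemma gaugeZ (c : R[i]) f : cmeasurable setT f ->
  (gauge (fun x => c * f x)%R <= (normc c + normc c ^+ 2)%:E * gauge f)%E.
Proof.
move=> mf; have m0 := @cmeasurable_cst _ T R 0.
have c0 : 0 <= normc c + normc c ^+ 2 by rewrite addr_ge0 ?sqr_ge0 ?normc_ge0.
have := @gauge_bound (normc c + normc c ^+ 2) 0 f (fun=> 0) (fun x => c * f x) c0 (lexx 0) mf m0.
rewrite mul0e adde0; apply; first by apply: cmeasurableM => //; exact: cmeasurable_cst.
move=> x; rewrite mul0r addr0 normcM.
have h1 := normc_ge0 c; have h2 := mulr_ge0 th0 (normc_ge0 (f x)).
have h3 := sqr_ge0 (normc (f x)); have h4 := sqr_ge0 (normc c).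
rewrite exprMn; have := mulr_ge0 h1 h3; have := mulr_ge0 h4 h2.
lra.
Qed.

Lemma sqL2_le_gauge f : cmeasurable setT f -> (sqL2 m f <= gauge f)%E.
Proof.
move=> mf; apply: ge0_le_integral => //.
- by move=> x _; rewrite lee_fin sqr_ge0.
- exact: measurable_sqL2.
- exact: measurable_gauge.
- by move=> x _; rewrite lee_fin lerDr mulr_ge0// normc_ge0.
Qed.

Variable P : (T -> R[i]) -> Prop.
Hypothesis Pmeas : forall f, P f -> cmeasurable setT f.
Hypothesis Pcomb : forall (c : R[i]) f g, P f -> P g -> P (fun x => f x + c * g x).
Hypothesis P0 : P (fun=> 0).

Definition gauge_closure f := cmeasurable setT f /\
  forall e : R, 0 < e -> exists2 g, P g & (gauge (fun x => f x - g x)%R <= e%:E)%E.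

Lemma gauge_closure0 : gauge_closure (fun=> 0).
Proof.
split; first exact: cmeasurable_cst.
move=> e e0; exists (fun=> 0) => //; rewrite (_ : gauge _ = 0%E) ?lee_fin ?ltW//.
by apply: integral0_eq => x _; rewrite subrr normc0 mulr0 expr0n addr0.
Qed.

Lemma gauge_closure_comb (c : R[i]) f g : gauge_closure f -> gauge_closure g ->
  gauge_closure (fun x => f x + c * g x).
Proof.
move=> [mf hf] [mg hg].
have mcg : cmeasurable setT (fun x => c * g x) by apply: cmeasurableM => //; exact: cmeasurable_cst.
split; first exact: cmeasurableD.
move=> e e0; have e4 : 0 < e / 4 by rewrite divr_gt0.
have [f' Pf' f'e] := hf _ e4.
pose C := normc c + normc c ^+ 2.
have C0 : 0 <= C by rewrite addr_ge0 ?sqr_ge0 ?normc_ge0.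
have C1 : 0 < C + 1 by rewrite ltr_wpDl.
(* The quarters offset the factors 2 of [gaugeD]; dividing by [C + 1] makes sense for [c = 0]
   too. *)
have [g' Pg' g'e] := hg _ (divr_gt0 e4 C1).
exists (fun x => f' x + c * g' x); first exact: Pcomb.
have mff' := cmeasurableB mf (Pmeas Pf'); have mgg' := cmeasurableB mg (Pmeas Pg').
have mcgg' : cmeasurable setT (fun x => c * (g x - g' x)).
  by apply: cmeasurableM => //; exact: cmeasurable_cst.
rewrite (_ : (fun x => _) = (fun x => (f x - f' x) + c * (g x - g' x))); last first.
  by apply/funext => x; ring.
apply: (le_trans (gaugeD mff' mcgg')).
have -> : e%:E = (2%:E * (e / 4)%:E + 2%:E * (e / 4)%:E)%E.
  by rewrite -!EFinM -EFinD; congr (_%:E); field.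
apply: leeD; apply: lee_wpmul2l => //; apply: (le_trans (gaugeZ _ mgg')).
apply: (@le_trans _ _ (C%:E * (e / 4 / (C + 1))%:E)%E); first exact: lee_wpmul2l.
by rewrite -EFinM lee_fin mulrA ler_pdivrMr//; nra.
Qed.

Lemma gauge_closure_lim f : cmeasurable setT f ->
  (forall e : R, 0 < e -> exists2 g, gauge_closure g & (gauge (fun x => f x - g x)%R <= e%:E)%E) ->
  gauge_closure f.
Proof.
move=> mf h; split=> // e e0; have e4 : 0 < e / 4 by rewrite divr_gt0.
have [g [mg hg] fg] := h _ e4; have [g' Pg' gg'] := hg _ e4.
exists g' => //.
rewrite (_ : (fun x => _) = (fun x => (f x - g x) + (g x - g' x))); last first.
  by apply/funext => x; ring.
apply: (le_trans (gaugeD (cmeasurableB mf mg) (cmeasurableB mg (Pmeas Pg')))).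
have -> : e%:E = (2%:E * (e / 4)%:E + 2%:E * (e / 4)%:E)%E.
  by rewrite -!EFinM -EFinD; congr (_%:E); field.
by apply: leeD; exact: lee_wpmul2l.
Qed.

Hypothesis Pindic : forall A, measurable A -> (m A < +oo)%E ->
  gauge_closure (fun x => (\1_A x : R)%:C).

Import HBNNSimple.

(** A simple function is a finite combination of indicators of its level sets. At a level $r\ne0$
    the measure is finite, as $r^2$ times it is at most the gauge; level 0 contributes nothing. *)
Let closure_nnsfun (s : {nnsfun T >-> R}) : (gauge (fun x => (s x)%:C) < +oo)%E ->
  gauge_closure (fun x => (s x)%:C).
Proof.
move=> soo.
have ms (r : R) : measurable (s @^-1` [set r]) by exact: measurable_funPTI.
have lev (r : R) : r != 0 -> (m (s @^-1` [set r]) < +oo)%E.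
  move=> r0; have r2 : 0 < r ^+ 2 by rewrite exprn_even_gt0.
  have : ((r ^+ 2)%:E * m (s @^-1` [set r]) < +oo)%E.
    apply: le_lt_trans soo; rewrite -[s @^-1` _]setIT -integral_indic// -ge0_integralZl//; last first.
    - by rewrite lee_fin ltW.
    - by apply/measurable_EFinP; exact: measurable_indic.
    apply: ge0_le_integral => //.
    - by move=> x _; rewrite -EFinM lee_fin mulr_ge0// ltW.
    - by apply: measurable_funeM; apply/measurable_EFinP; exact: measurable_indic.
    - by apply: measurable_gauge; apply: cmeasurable_real; exact: measurable_funP.
    move=> x _; rewrite -EFinM lee_fin indicE; case: (boolP (x \in _)) => [|_].
      rewrite inE => sx; have {}sx : s x = r := sx.
      by rewrite mulr1 normc_real sx real_normK ?num_real// lerDr mulr_ge0.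
    by rewrite mulr0 addr_ge0 ?sqr_ge0// mulr_ge0// normc_ge0.
  rewrite !ltey; apply: contraNN => /eqP ->; rewrite gt0_muley// lte_fin.
have -> : (fun x => (s x)%:C) = (fun x => (\sum_(y <- finmap.enum_fset (fset_set (range s))) (y * \1_(s @^-1` [set y]) x))%:C).
  by apply/funext => x; rewrite fimfunE fsbig_finite.
elim: (finmap.enum_fset _) => [|y l ih].
  have := gauge_closure0; congr gauge_closure; apply/funext => x.
  by rewrite big_nil.
have [->|y0] := eqVneq y 0.
  move: ih; congr gauge_closure; apply/funext => x.
  by rewrite big_cons mul0r add0r.
have := gauge_closure_comb (y%:C) ih (Pindic (ms y) (lev y y0)).
congr gauge_closure; apply/funext => x.
by rewrite big_cons addrC rmorphD rmorphM.
Qed.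

(** Simple functions increasing to [f] converge to it in gauge by dominated convergence, the gauge
    integrand of [f] being the majorant. *)
Let closure_nonneg (f : T -> R) : measurable_fun setT f -> (forall x, 0 <= f x) ->
  (gauge (fun x => (f x)%:C) < +oo)%E -> gauge_closure (fun x => (f x)%:C).
Proof.
move=> mf f0 foo.
have mEf : measurable_fun setT (EFin \o f) by exact/measurable_EFinP.
pose s := nnsfun_approx measurableT mEf.
have sf n x : s n x <= f x.
  have := @le_approx _ _ _ setT (EFin \o f) n x.
  rewrite -(nnsfun_approxE measurableT mEf) => h.
  by rewrite -lee_fin; apply: h => //= y _; rewrite lee_fin.
have cs x : s n x @[n --> \oo] --> f x.
  have Ef0 y : [set: T] y -> (0 <= (EFin \o f) y)%E by rewrite lee_fin.
  have := @cvg_nnsfun_approx _ _ _ _ measurableT _ mEf Ef0 x I.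
  by move=> /fine_cvg.
apply: gauge_closure_lim; first exact: cmeasurable_real.
move=> e e0.
pose F n x := (th * (f x - s n x) + (f x - s n x) ^+ 2)%:E.
pose G x := (th * f x + f x ^+ 2)%:E.
have mF n : measurable_fun setT (F n).
  by apply/measurable_EFinP; apply: measurable_funD; [apply: measurable_funM => //|apply: measurable_funX]; exact: measurable_funB.
have mG : measurable_fun setT G.
  by apply/measurable_EFinP; apply: measurable_funD; [exact: measurable_funM|exact: measurable_funX].
have G0 x : (0 <= G x)%E by rewrite lee_fin addr_ge0 ?mulr_ge0.
have F0 n x : (0 <= F n x)%E by rewrite lee_fin addr_ge0 ?sqr_ge0// mulr_ge0// subr_ge0.
have [] := @dominated_convergence _ _ _ m setT measurableT F (cst 0%E) G mF.
- exact: measurable_cst.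
- apply: aeW => x _; apply: cvg_EFin; first exact: nearW.
  have c0 : f x - s n x @[n --> \oo] --> 0.
    by rewrite -(subrr (f x)); apply: cvgB => //; exact: cvg_cst.
  rewrite /comp/= -[X in _ --> X]addr0 -[X in _ --> X + _](mulr0 th) -[X in _ --> _ + X](mulr0 (0 : R)).
  apply: cvgD; first exact: cvgMr.
  by under eq_fun do rewrite expr2; exact: cvgM.
- apply/integrableP; split => //; under eq_integral do rewrite gee0_abs//.
  apply: le_lt_trans foo; rewrite le_eqVlt; apply/orP; left; apply/eqP.
  by apply: eq_integral => x _; rewrite /G normc_real ger0_norm.
- apply: aeW => x n _; rewrite gee0_abs// lee_fin.
  have := sf n x; have : 0 <= s n x by []; have := f0 x => fx0 sx0 sfx.
  rewrite lerD// ?ler_wpM2l// ?gerBl//.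
  by rewrite ler_pXn2r// ?nnegrE ?subr_ge0// gerBl.
move=> _ _; rewrite integral0 => Fcvg.
have [n Fn] : exists n, (\int[m]_x F n x <= e%:E)%E.
  exact: cvg0_exists_le.
exists (fun x => (s n x)%:C).
  apply: closure_nnsfun; apply: le_lt_trans foo; apply: ge0_le_integral => //.
  - by move=> x _; rewrite lee_fin addr_ge0 ?sqr_ge0// mulr_ge0// normc_ge0.
  - by apply: measurable_gauge; apply: cmeasurable_real; exact: measurable_funP.
  - by apply: measurable_gauge; exact: cmeasurable_real.
  - move=> x _; rewrite lee_fin !normc_real !ger0_norm// lerD ?ler_wpM2l//.
    by rewrite ler_pXn2r// nnegrE.
apply: le_trans Fn; rewrite le_eqVlt; apply/orP; left; apply/eqP.
by apply: eq_integral => x _; rewrite -rmorphB normc_real ger0_norm// subr_ge0.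
Qed.

Let gauge_le f g : cmeasurable setT f -> cmeasurable setT g ->
  (forall x, normc (f x) <= normc (g x)) -> (gauge f <= gauge g)%E.
Proof.
move=> mf mg fg; apply: ge0_le_integral => //.
- by move=> x _; rewrite lee_fin addr_ge0 ?sqr_ge0// mulr_ge0// normc_ge0.
- exact: measurable_gauge.
- exact: measurable_gauge.
- by move=> x _; rewrite lee_fin lerD ?ler_wpM2l// ler_pXn2r// nnegrE normc_ge0.
Qed.

(** The positive and negative parts of the real and imaginary parts are dominated by $|f|$, hence
    have finite gauge, and recombine with coefficients $1,-1,i,-i$. *)
Lemma gauge_dense f : cmeasurable setT f -> (gauge f < +oo)%E -> gauge_closure f.
Proof.
move=> mf foo; have [mre mim] := mf.
have part (h : T -> R) : measurable_fun setT h -> (forall x, 0 <= h x) ->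
    (forall x, h x <= normc (f x)) -> gauge_closure (fun x => (h x)%:C).
  move=> mh h0 hf; apply: closure_nonneg => //.
  apply: le_lt_trans foo; apply: gauge_le => //.
  by move=> x; rewrite normc_real ger0_norm.
have pos_le (r : R) (z : R[i]) : `|r| <= normc z -> Num.max r 0 <= normc z.
  by move=> rz; rewrite ge_max normc_ge0 andbT (le_trans (ler_norm _)).
have re x := normr_Re_le (f x); have im x := normr_Im_le (f x).
have p1 := part (fun x => Num.max (complex.Re (f x)) 0).
have p2 := part (fun x => Num.max (- complex.Re (f x)) 0).
have p3 := part (fun x => Num.max (complex.Im (f x)) 0).
have p4 := part (fun x => Num.max (- complex.Im (f x)) 0).
have mmax (h : T -> R) : measurable_fun setT h -> measurable_fun setT (fun x => Num.max (h x) 0).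
  by move=> mh; exact: measurable_funrpos.
have max0 (r : R) : 0 <= Num.max r 0 by rewrite le_max lexx orbT.
have {}p1 := p1 (mmax _ mre) (fun=> max0 _) (fun x => pos_le _ _ (re x)).
have {}p2 := p2 (mmax _ (measurable_funN mre)) (fun=> max0 _).
have {}p3 := p3 (mmax _ mim) (fun=> max0 _) (fun x => pos_le _ _ (im x)).
have {}p4 := p4 (mmax _ (measurable_funN mim)) (fun=> max0 _).
have {}p2 : gauge_closure (fun x => (Num.max (- complex.Re (f x)) 0)%:C).
  by apply: p2 => x; apply: pos_le; rewrite normrN.
have {}p4 : gauge_closure (fun x => (Num.max (- complex.Im (f x)) 0)%:C).
  by apply: p4 => x; apply: pos_le; rewrite normrN.
have := gauge_closure_comb (- 'i) (gauge_closure_comb 'i (gauge_closure_comb (-1) p1 p2) p3) p4.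
congr gauge_closure; apply/funext => x; case: (f x) => a b /=.
have maxE (r : R) : Num.max r 0 - Num.max (- r) 0 = r.
  by case: (leP r 0) => r0; [rewrite max_l ?oppr_ge0// sub0r opprK|rewrite max_r ?subr0// oppr_le0 ltW].
apply/eqP; rewrite eq_complex/=; apply/andP; split; apply/eqP.
- by rewrite -[RHS](maxE a); ring.
- by rewrite -[RHS](maxE b); ring.
Qed.

End gauge.

Section density.
Context {R : realType} {K : localFieldType}.
Context {mu : {sigma_finite_measure set (borel K) -> \bar R}} {absK : K -> R} {chi : K -> R[i]}.
Context (H : normalized_haar mu absK chi).
Local Notation disc := (@disc R K absK).
Local Notation test_fun := (@test_fun R K absK).
Implicit Types (a b x y : K) (f g h : K -> R[i]).

(** One radius serves for the size of [C] and, inverted, for a thickening inside [U], as [test_fun]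
    demands. Near-covering along $n\to\infty$ makes it uniform over [C]. *)
Lemma compact_thickening (C U : set K) : compact C -> open U -> C `<=` U ->
  exists a, [/\ 1 <= absK a, C `<=` disc (absK a) &
    forall x y, C x -> absK y <= (absK a)^-1 -> U (x + y)].
Proof.
move=> /compact_near_coveringP cC oU CU.
have [u [u1 uS ub]] := disc_cover H.
have u_le m n : (m <= n)%N -> absK (u m) <= absK (u n).
  exact: (@homo_leq _ (fun n => absK (u n)) <=%R lexx le_trans uS).
have u0 n : 0 < absK (u n) by rewrite (lt_le_trans ltr01).
pose P n x := absK x <= absK (u n) /\
  forall y, absK y <= (absK (u n))^-1 -> U (x + y).
have cov x : C x -> \forall x' \near x & n \near \oo, P n x'.
  move=> Cx.
  have : nbhs 0 [set y | U (x + y)].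
    by apply: addl_continuous; rewrite addr0; apply: open_nbhs_nbhs; split => //; exact: CU.
  move=> /(disc_nbhs0 H)[b b0 bU].
  have [n1 hn1] := ub (Num.max (absK x) (absK b)); rewrite ge_max in hn1.
  case/andP: hn1 => xn1 bn1; have [n2 hn2] := ub (absK b)^-1.
  (* [n1] bounds the points of the disc around [x], [n2] makes the thickening no larger than [b];
     both persist for larger [n]. *)
  exists ([set x' | disc (absK b) (- x + x')], [set n | (maxn n1 n2 <= n)%N]).
    split => /=; last by exists (maxn n1 n2).
    apply: (@addl_continuous K (- x) x); rewrite addNr.
    apply: open_nbhs_nbhs; split; first by apply: (open_disc H); exact: (absK_gt0 H).
    by rewrite /disc/= (absK0 H) (absK_ge0 H).
  move=> [x' n] /= [bx']; rewrite geq_max => /andP[n1n n2n]; split.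
    rewrite -(addNKr x x'); apply: (absK_add H).
      exact: (le_trans xn1 (u_le _ _ n1n)).
    exact: (le_trans bx' (le_trans bn1 (u_le _ _ n1n))).
  move=> y yn; rewrite -(addNKr x x') -addrA; apply: bU.
  apply: (absK_add H) => //; apply: (le_trans yn).
  rewrite -[leRHS]invrK lef_pV2 ?posrE ?invr_gt0 ?(absK_gt0 H b0) ?u0//.
  exact: (le_trans hn2 (u_le _ _ n2n)).
have [n _ h] := cC nat \oo P _ cov.
have hn := h n (leqnn n).
exists (u n); split => // [x Cx|x y Cx]; first by have [] := hn x Cx.
by have [_] := hn x Cx; apply.
Qed.

(** Regularity gives an open [U] around [A] and a compact [C] in [U] with almost the same measure.
    Thickening [C] by a small disc gives [V] between [C] and [U], and $|1_A-1_V| \le 1_{U\setminus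
    A}+1_{U\setminus V}$. *)
Lemma test_fun_indic_approx (A : set K) (e : R) : measurable (A : set (borel K)) ->
  (mu A < +oo)%E -> 0 < e ->
  exists2 V : set K, test_fun (fun x => (\1_V x : R)%:C) &
    (\int[mu]_x (`|\1_A x - \1_V x| : R)%:E <= e%:E)%E.
Proof.
move=> mA Afin e0; have e2 : 0 < e / 2 by rewrite divr_gt0.
have Af : mu A \is a fin_num by rewrite ge0_fin_numE.
have [_ _ _ outer inner] := nh_haar H.
have : (ereal_inf [set mu U | U in [set U : set K | open U /\ A `<=` U]] < mu A + (e / 2)%:E)%E.
  by rewrite -(outer A mA) lteDl.
move=> /ereal_inf_lt [_ [U [oU AU] <-] muU].
have Ufin : (mu U < +oo)%E by apply: (lt_le_trans muU); rewrite leey.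
have Uf : mu U \is a fin_num by rewrite ge0_fin_numE.
have : (mu U - (e / 2)%:E < ereal_sup [set mu C | C in [set C : set K | compact C /\ C `<=` U]])%E.
  by rewrite -(inner U oU) lteBlDr// lteDl.
move=> /ereal_sup_gt [_ [C [cC CU] <-] muC].
have [a [a1 Ca aU]] := compact_thickening cC oU CU.
have a0 : 0 < absK a by exact: (lt_le_trans ltr01).
pose V : set K := [set x | exists2 c, C c & absK (x - c) <= (absK a)^-1].
have CV : C `<=` V by move=> c Cc; exists c => //; rewrite subrr (absK0 H) invr_ge0 ltW.
have VU : V `<=` U by move=> x [c Cc xc]; rewrite -(subrK c x) addrC; exact: aU.
have Vinv x y : absK y <= (absK a)^-1 -> V x -> V (x + y).
  by move=> ya [c Cc xc]; exists c => //; rewrite addrAC; exact: (absK_add H).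
have mV : measurable (V : set (borel K)).
  apply: open_measurableK; apply: (@open_disc_invariant _ _ _ _ _ H _ (absK a)^-1).
    by rewrite invr_gt0.
  by move=> x y Vx ya; exact: Vinv.
exists V.
  exists a, 1; split => //; last first.
    by move=> x; rewrite normc_real ger0_norm ?indicE ?lern1 ?leq_b1.
  split=> [x xa|x y ya].
    rewrite indicE memNset//= => -[c /Ca ca xc]; move: xa; rewrite ltNge => /negP; apply.
    rewrite -(subrK c x); apply: (absK_add H) => //; apply: (le_trans xc).
    by rewrite (le_trans _ a1)// invf_le1.
  congr (_%:C); rewrite !indicE; congr (_%:R); congr nat_of_bool.
  apply/idP/idP; rewrite !inE => Vx; last exact: Vinv.
  by rewrite -(addrK y x); apply: Vinv => //; rewrite (absKN H).
have mU := open_measurableK oU; have mC := compact_measurableK cC.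
have muUA : (mu (U `\` A) <= (e / 2)%:E)%E.
  rewrite measureD// (setIidr AU) leeBlDr// addeC; exact: ltW.
have muUV : (mu (U `\` V) <= (e / 2)%:E)%E.
  have Vf : mu V \is a fin_num.
    by rewrite ge0_fin_numE// (le_lt_trans _ Ufin)// le_measure// inE.
  rewrite measureD// (setIidr VU) leeBlDr// addeC -leeBlDr//.
  by apply: (le_trans (ltW muC)); rewrite le_measure// inE.
apply: (@le_trans _ _ (mu (U `\` A) + mu (U `\` V))%E); last first.
  by apply: (le_trans (leeD muUA muUV)); rewrite -EFinD lee_fin -splitr.
have mUA : measurable (U `\` A : set (borel K)) by exact: measurableD.
have mUV : measurable (U `\` V : set (borel K)) by exact: measurableD.
rewrite -[X in (_ <= mu X + _)%E]setIT -[X in (_ <= _ + mu X)%E]setIT -!integral_indic//.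
rewrite -ge0_integralD//; last 2 first.
- by apply/measurable_EFinP; exact: measurable_indic.
- by apply/measurable_EFinP; exact: measurable_indic.
apply: ge0_le_integral => //.
- by apply/measurable_EFinP; apply: measurableT_comp => //; apply: measurable_funB; exact: measurable_indic.
- by apply: emeasurable_funD; apply/measurable_EFinP; exact: measurable_indic.
move=> x _; rewrite -EFinD lee_fin !indicE !in_setD.
have : x \in A -> x \in U by rewrite !inE; exact: AU.
have : x \in V -> x \in U by rewrite !inE; exact: VU.
case: (x \in A); case: (x \in V); case: (x \in U) => VxU AxU;
  rewrite /= ?subrr ?normr0 ?subr0 ?sub0r ?normrN ?normr1 ?addr0 ?add0r//.
- by have := AxU isT.
- by have := VxU isT.
Qed.

Lemma test_fun_dense (th : R) f (e : R) : 0 <= th -> cmeasurable setT (f : borel K -> R[i]) ->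
  (gauge mu th f < +oo)%E -> 0 < e ->
  exists2 g, test_fun g & (gauge mu th (fun x => f x - g x)%R <= e%:E)%E.
Proof.
move=> th0 mf foo e0.
have tm g : test_fun g -> cmeasurable setT (g : borel K -> R[i]).
  by move=> /(test_fun_inL1 H)[].
have tc (c : R[i]) g h : test_fun g -> test_fun h -> test_fun (fun x => g x + c * h x).
  by move=> tg tch; exact: test_fun_comb.
have t0 : test_fun (fun=> 0).
  exists 1, 0; split => //; first by rewrite (absK1 H).
  by move=> x; rewrite normc0.
have [] := @gauge_dense _ _ R mu th th0 test_fun tm tc t0 _ f mf foo; last by move=> _ /(_ e e0).
move=> A mA Afin; split; first by apply: cmeasurable_real; exact: measurable_indic.
move=> e' e'0; have th1 : 0 < th + 1 by rewrite ltr_wpDl.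
have [V tV VE] := test_fun_indic_approx mA Afin (divr_gt0 e'0 th1).
exists (fun x => (\1_V x : R)%:C) => //; have [mV _] := tm _ tV.
have mn : measurable_fun setT (fun x : borel K => (`|\1_A x - \1_V x| : R)%:E).
  apply/measurable_EFinP; apply: measurableT_comp => //; apply: measurable_funB => //.
(* A difference of indicators has modulus 0 or 1, so its square does not exceed its modulus. *)
apply: (@le_trans _ _ (\int[mu]_x ((th + 1)%:E * (`|\1_A x - \1_V x| : R)%:E))%E).
  apply: ge0_le_integral => //.
  - by move=> x _; rewrite lee_fin addr_ge0 ?sqr_ge0// mulr_ge0// normc_ge0.
  - apply: measurable_gauge; apply: cmeasurableB; last exact: tm.
    by apply: cmeasurable_real; exact: measurable_indic.
  - exact: measurable_funeM.
  move=> x _; rewrite -EFinM lee_fin -rmorphB normc_real mulrDl mul1r lerD2l.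
  rewrite expr2 ler_piMr// !indicE.
  by case: (x \in A); case: (x \in V); rewrite /= ?subrr ?normr0 ?subr0 ?sub0r ?normrN ?normr1.
rewrite ge0_integralZl//; last by rewrite lee_fin ltW.
apply: (@le_trans _ _ ((th + 1)%:E * (e' / (th + 1))%:E)%E).
  by apply: lee_wpmul2l => //; rewrite lee_fin ltW.
by rewrite -EFinM lee_fin mulrC divfK// gt_eqF.
Qed.

Lemma test_fun_dense_L2 f : inL2 mu f -> exists g : nat -> K -> R[i],
  (forall n, test_fun (g n)) /\
  (forall n, (sqL2 mu (fun x => g n x - f x)%R <= (n.+1%:R^-1)%:E)%E).
Proof.
move=> [mf fi].
have foo : (gauge mu 0 f < +oo)%E.
  by rewrite /gauge; under eq_integral do rewrite mul0r add0r.
have h n : exists g, test_fun g /\ (gauge mu 0 (fun x => f x - g x)%R <= (n.+1%:R^-1)%:E)%E.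
  have [|g tg ge] := @test_fun_dense 0 f n.+1%:R^-1 (lexx 0) mf foo; last by exists g.
  by rewrite invr_gt0.
have [g hg] := choice h; exists g; split => n; first by have [] := hg n.
have [tg gn] := hg n; rewrite sqL2_subC; apply: le_trans gn.
apply: sqL2_le_gauge => //; apply: cmeasurableB => //.
by have [] := test_fun_inL1 H tg.
Qed.

(** The gauge with [th = 1] approximates in both norms at once: the $L^1$ part makes the transforms
    converge at every point, the $L^2$ part controls the norms in [sqL2_limit]. *)
Theorem fourier_plancherel f : inL1 mu f -> inL2 mu f ->
  sqL2 mu (fourierL1 mu chi f) = sqL2 mu f.
Proof.
move=> f1 f2; have [mf f1oo] := f1; have [_ f2oo] := f2.
have foo : (gauge mu 1 f < +oo)%E.
  rewrite /gauge; under eq_integral do rewrite mul1r EFinD.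
  rewrite ge0_integralD//.
  - exact: lte_add_pinfty.
  - by move=> x _; rewrite lee_fin normc_ge0.
  - by apply/measurable_EFinP; exact: measurable_normc.
  - by move=> x _; rewrite lee_fin sqr_ge0.
  - exact: measurable_sqL2.
have h n : exists g, test_fun g /\ (gauge mu 1 (fun x => f x - g x)%R <= (n.+1%:R^-1)%:E)%E.
  have [|g tg ge] := @test_fun_dense 1 f n.+1%:R^-1 ler01 mf foo; last by exists g.
  by rewrite invr_gt0.
have [g hg] := choice h.
have tg n : test_fun (g n) by have [] := hg n.
have gn n := (hg n).2.
have g1 n := test_fun_inL1 H (tg n).
have mg n : cmeasurable setT (g n : borel K -> R[i]) by have [] := g1 n.
rewrite -[RHS]mul1e.
apply: (@sqL2_limit _ _ _ _ R mu mu 1 (fourierL1 mu chi f) (fun n => fourierL1 mu chi (g n)) f g) => //.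
- exact: (cmeasurable_fourier H).
- by move=> k; exact: (cmeasurable_fourier H).
- by move=> k; exact: (test_fun_inL2 H).
- move=> xi; have bound n : normc (fourierL1 mu chi (g n) xi - fourierL1 mu chi f xi) <= n.+1%:R^-1.
    rewrite -(fourierB H)// -lee_fin; apply: (le_trans (normc_fourier_le H _ _)).
      exact: inL1B.
    apply: le_trans (gn n); apply: ge0_le_integral => //.
    + by move=> x _; rewrite lee_fin normc_ge0.
    + by apply/measurable_EFinP; apply: measurable_normc; exact: cmeasurableB.
    + by apply: measurable_gauge; exact: cmeasurableB.
    + by move=> x _; rewrite lee_fin mul1r -normcN opprB lerDl sqr_ge0.
  apply: (@squeeze_cvgr _ _ _ _ (fun=> 0) (fun n => n.+1%:R^-1)).
  + by apply: nearW => n; rewrite normc_ge0 bound.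
  + exact: cvg_cst.
  + exact: cvg_harmonic.
- by move=> k; rewrite mul1e (test_fun_parseval H).
- move=> k l; rewrite mul1e -(test_fun_parseval H (test_funB (tg k) (tg l))).
  by congr (sqL2 _ _); apply/funext => xi; rewrite (fourierB H xi (g1 k) (g1 l)).
- move=> k; rewrite sqL2_subC; apply: le_trans (gn k).
  by apply: sqL2_le_gauge => //; exact: cmeasurableB.
Qed.

End density.

(** * Measures with a density *)

Section density_measure.
Context {d : measure_display} {T : measurableType d} {R : realType}.
Context (m : {measure set T -> \bar R}) (h : T -> R).
Hypotheses (mh : measurable_fun setT h) (h0 : forall x, 0 <= h x).

(** Packaging a density as a measure makes the $L^2$ lemmas and [sqL2_limit] available for
    $|a|^{-2}\,da\,db$. *)
Definition dens (A : set T) : \bar R := (\int[m]_(x in A) (h x)%:E)%E.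

Let dens0 : dens set0 = 0%E. Proof. exact: integral_set0. Qed.

Let dens_ge0 A : (0 <= dens A)%E.
Proof. by apply: integral_ge0 => x _; rewrite lee_fin. Qed.

Let dens_sigma_additive : semi_sigma_additive dens.
Proof.
move=> F mF tF mUF; rewrite /dens ge0_integral_bigcup//.
- by apply: is_cvg_ereal_nneg_natsum => n _; exact: dens_ge0.
- by apply/measurable_EFinP; exact: measurable_funTS.
- by move=> x _; rewrite lee_fin.
Qed.

HB.instance Definition _ := isMeasure.Build _ _ _ dens dens0 dens_ge0 dens_sigma_additive.

Definition density_measure : {measure set T -> \bar R} := dens.

Import HBNNSimple.

Let integral_indic_density A : measurable A ->
  (\int[density_measure]_x (\1_A x)%:E = \int[m]_x ((\1_A x)%:E * (h x)%:E))%E.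
Proof.
move=> mA; rewrite integral_indic// setIT /density_measure /= /dens integral_mkcond.
apply: eq_integral => x _; rewrite patchE indicE; case: ifPn => _; first by rewrite mul1e.
by rewrite mul0e.
Qed.

(** Clear for indicators, hence for simple functions; monotone convergence on both sides gives the
    rest. *)
Lemma ge0_integral_density (f : T -> \bar R) : measurable_fun setT f ->
  (forall x, 0 <= f x)%E ->
  (\int[density_measure]_x f x = \int[m]_x (f x * (h x)%:E))%E.
Proof.
move=> mf f0.
have mEh : measurable_fun setT (EFin \o h) by exact/measurable_EFinP.
pose s := nnsfun_approx measurableT mf.
have ms n : measurable_fun setT (fun x => (s n x)%:E) by exact/measurable_EFinP.
have fs x : f x = limn (fun n => (s n x)%:E).
  by apply/esym/cvg_lim => //; apply: cvg_nnsfun_approx.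
have ns x : {homo (fun n => (s n x)%:E) : a b / (a <= b)%N >-> (a <= b)%E}.
  by move=> a b ab; rewrite lee_fin; exact/lefP/nd_nnsfun_approx.
transitivity (limn (fun n => \int[density_measure]_x (s n x)%:E)%E).
  rewrite -monotone_convergence//.
  - by apply: eq_integral => x _.
  - by move=> n x _; rewrite lee_fin.
transitivity (limn (fun n => \int[m]_x ((s n x)%:E * (h x)%:E))%E); last first.
  rewrite -monotone_convergence//.
  - apply: eq_integral => x _; apply/cvg_lim => //; apply: cvgeZr => //.
    exact: cvg_nnsfun_approx.
  - by move=> n; exact: emeasurable_funM.
  - by move=> n x _; rewrite mule_ge0 ?lee_fin.
  - by move=> x _ a b ab; apply: lee_wpmul2r; rewrite ?lee_fin//; apply: ns.
congr (limn _); apply/funext => n.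
transitivity (\int[density_measure]_x (\sum_(y \in range (s n)) (y * \1_(s n @^-1` [set y]) x)%:E))%E.
  by apply: eq_integral => x _; rewrite [in LHS]fimfunE -fsumEFin.
transitivity (\int[m]_x (\sum_(y \in range (s n)) ((y * \1_(s n @^-1` [set y]) x)%:E * (h x)%:E)))%E; last first.
  apply: eq_integral => x _; rewrite [in RHS]fimfunE -fsumEFin// ge0_mule_fsuml//.
  by move=> y; exact: nnfun_muleindic_ge0.
have mi r : measurable_fun setT (fun x => (r * \1_(s n @^-1` [set r]) x)%:E).
  by apply/measurable_EFinP; exact: measurable_funM.
rewrite ge0_integral_fsum//; last by move=> y x _; exact: nnfun_muleindic_ge0.
rewrite ge0_integral_fsum//; last 2 first.
- by move=> y; exact: emeasurable_funM.
- by move=> y x _; rewrite mule_ge0 ?lee_fin// -lee_fin nnfun_muleindic_ge0.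
apply: eq_fsbigr => r rr.
have r0 : 0 <= r by move: rr; rewrite inE => -[x _ <-].
under eq_integral do rewrite EFinM.
under [RHS]eq_integral do rewrite EFinM -muleA.
rewrite !ge0_integralZl//.
- by rewrite integral_indic_density.
- apply: emeasurable_funM => //; apply/measurable_EFinP; exact: measurable_indic.
- by move=> x _; rewrite mule_ge0 ?lee_fin.
- by apply/measurable_EFinP; exact: measurable_indic.
Qed.

End density_measure.

(** * The wavelet transform *)

Section wavelet.
Context {R : realType} {K : localFieldType}.
Context {mu : {sigma_finite_measure set (borel K) -> \bar R}} {absK : K -> R} {chi : K -> R[i]}.
Context (H : normalized_haar mu absK chi).
Local Notation fhat := (@fourierL1 R K mu chi).
Local Notation test_fun := (@test_fun R K absK).
Local Notation W := (@wavelet_transform R K mu absK).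
Implicit Types (a b x y xi : K) (u f g psi psihat : K -> R[i]).

Let conj_realc (r : R) : (r%:C)^* = r%:C.
Proof. exact: conjc_real. Qed.

Lemma dilatedE psi a b : a != 0 ->
  dilated absK psi a b = (fun x => ((Num.sqrt (absK a))^-1)%:C * psi (a^-1 * x + (- (b / a)))).
Proof. by move=> a0; apply/funext => x; rewrite /dilated mulrBl [x / a]mulrC. Qed.

Lemma sqrt_absK_gt0 a : a != 0 -> 0 < Num.sqrt (absK a).
Proof. by move=> a0; rewrite sqrtr_gt0 (absK_gt0 H). Qed.

Lemma dilated0 psi b x : dilated absK psi 0 b x = 0.
Proof. by rewrite /dilated (absK0 H) sqrtr0 invr0 mul0r. Qed.

Lemma inL2_dilated psi a b : inL2 mu psi -> inL2 mu (dilated absK psi a b).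
Proof.
move=> psi2; have [->|a0] := eqVneq a 0.
  rewrite (_ : dilated _ _ _ _ = (fun x => 0 * psi x)); first exact: inL2Z.
  by apply/funext => x; rewrite dilated0 mul0r.
by rewrite dilatedE//; apply: inL2Z; apply: (inL2_affine H) => //; rewrite invr_eq0.
Qed.

Lemma sqL2_dilated psi a b : a != 0 -> inL2 mu psi ->
  sqL2 mu (dilated absK psi a b) = sqL2 mu psi.
Proof.
move=> a0 psi2; have [mpsi _] := psi2; have aV0 : a^-1 != 0 by rewrite invr_eq0.
rewrite dilatedE// sqL2Z; last exact: (cmeasurable_affine H).
rewrite (sqL2_affine H)// normc_real ger0_norm ?invr_ge0// exprVn sqr_sqrtr ?(absK_ge0 H)//.
by rewrite (absKV H) invrK muleA -EFinM mulVf ?mul1e// (absK_eq0 H).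
Qed.

Lemma dilatedB psi1 psi2 a b x :
  dilated absK (fun x => psi1 x - psi2 x) a b x =
  dilated absK psi1 a b x - dilated absK psi2 a b x.
Proof. by rewrite /dilated mulrBr. Qed.

Lemma wavelet_transform_comb psi (c : R[i]) f g a b : inL2 mu psi -> inL2 mu f -> inL2 mu g ->
  W psi (fun x => f x + c * g x) a b = W psi f a b + c * W psi g a b.
Proof.
move=> psi2 f2 g2; have d2 := inL2_conj (inL2_dilated a b psi2).
rewrite /wavelet_transform /L2dot -cintegralZ; last exact: inL1_mul.
rewrite -cintegralD; [|exact: inL1_mul|by apply: inL1Z; exact: inL1_mul].
by apply: eq_cintegral => x; rewrite mulrDl mulrA.
Qed.

Lemma wavelet_transformB psi f g a b : inL2 mu psi -> inL2 mu f -> inL2 mu g ->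
  W psi (fun x => f x - g x) a b = W psi f a b - W psi g a b.
Proof.
move=> psi2 f2 g2; rewrite -mulN1r -wavelet_transform_comb//.
by congr (W psi _ a b); apply/funext => x; rewrite mulN1r.
Qed.

(** The coefficient integrates out the last variable of a function measurable on a triple product,
    so it is jointly measurable in the other two. *)
Lemma cmeasurable_wavelet psi f : cmeasurable setT (psi : borel K -> R[i]) ->
  cmeasurable setT (f : borel K -> R[i]) ->
  cmeasurable setT (fun p : borel K * borel K => W psi f p.1 p.2).
Proof.
move=> mpsi mf.
have m11 : measurable_fun setT (fun z : (borel K * borel K) * borel K => z.1.1).
  exact: (measurableT_comp measurable_fst measurable_fst).
have m12 : measurable_fun setT (fun z : (borel K * borel K) * borel K => z.1.2).
  exact: (measurableT_comp measurable_snd measurable_fst).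
have m2 : measurable_fun setT (fun z : (borel K * borel K) * borel K => z.2).
  exact: measurable_snd.
apply: (@cmeasurable_cintegral2 _ _ _ _ _ mu (fun z : (borel K * borel K) * borel K =>
  f z.2 * (dilated absK psi z.1.1 z.1.2 z.2)^*)).
apply: cmeasurableM; first exact: (cmeasurable_comp m2 mf).
apply: cmeasurable_conj; apply: cmeasurableM.
  apply: cmeasurable_real.
  rewrite (_ : (fun t => _) = (fun z : (borel K * borel K) * borel K => Num.sqrt (absK (z.1.1)^-1))); last first.
    by apply/funext => z; rewrite (absKV H) sqrtrV// (absK_ge0 H).
  apply: measurableT_comp; first by apply: continuous_measurable_fun; exact: sqrt_continuous.
  have mi := measurableT_comp (@measurable_invK K) m11.
  exact: (measurableT_comp (measurable_absK H) mi).
apply: (cmeasurable_comp _ mpsi); apply: (measurable_divK H) => //.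
exact: (measurable_subK H).
Qed.

(** Substituting $ax+b$ for $x$, inverting [f] at that point and exchanging integrals produces the
    conjugate transform of [u] at [a * xi]. The Jacobian $|a|$ and the normalization $|a|^{-1/2}$
    combine to $|a|^{1/2}$. *)
Lemma wavelet_transform_fourier_L1 u f a b : a != 0 -> test_fun f -> inL1 mu u ->
  W u f a b = (Num.sqrt (absK a))%:C *
    cintegral mu setT (fun xi => fhat f xi * chi (b * xi) * (fhat u (a * xi))^*).
Proof.
move=> a0 tf u1; have f1 := test_fun_inL1 H tf; have F1 := test_fun_inL1 H (test_fun_fourier H tf).
have s0 := sqrt_absK_gt0 a0; have [mu_ _] := u1.
have Fchi1 : inL1 mu (fun xi => fhat f xi * chi (b * xi)).
  have := inL1_chi H b F1; congr inL1; apply/funext => xi; by rewrite [b * xi]mulrC.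
have uc1 := inL1_conj u1.
pose G x := f x * (dilated absK u a b x)^*.
have GE x : G (a * x + b) = ((Num.sqrt (absK a))^-1)%:C * ((u x)^* * f (a * x + b)).
  rewrite /G /dilated addrK mulrAC divff// mul1r rmorphM/= conj_realc.
  by rewrite mulrCA [f _ * _]mulrC.
have [M fM] : exists M : R, forall x, normc (f x) <= M by case: tf => e [M [_ _ fM]]; exists M.
have G1 : inL1 mu G.
  have d1 : inL1 mu (dilated absK u a b).
    by rewrite dilatedE//; apply: inL1Z; apply: (inL1_affine H) => //; rewrite invr_eq0.
  have := inL1_bounded_mul f1.1 fM (inL1_conj d1); congr inL1.
  by apply/funext => x; rewrite mulrC.
have Gi := cintegral_affine H b a0 G1.
have WE : W u f a b = (absK a)%:C * cintegral mu setT (fun x => G (a * x + b)).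
  by rewrite Gi mulrA -rmorphM/= divff ?mul1r// (absK_eq0 H).
have ufi : inL1 mu (fun x => (u x)^* * f (a * x + b)).
  apply: (inL1_bounded_mul (cmeasurable_affine H a b f1.1) _ uc1).
  by move=> x; exact: fM.
rewrite WE (@eq_cintegral _ _ _ _ _ (fun x : borel K => ((Num.sqrt (absK a))^-1)%:C * ((u x)^* * f (a * x + b)))); last first.
  by move=> x; exact: GE.
rewrite cintegralZ// mulrA -rmorphM/=.
have -> : absK a * (Num.sqrt (absK a))^-1 = Num.sqrt (absK a).
  by rewrite -{1}(sqr_sqrtr (absK_ge0 H a)) expr2 mulfK// gt_eqF.
congr (_ * _).
pose k (z : borel K * borel K) := chi (z.2 * (a * z.1)).
have mk : cmeasurable setT k.
  apply: (cmeasurable_comp _ (cmeasurable_chi H)); apply: (measurable_mulK H); first exact: measurable_snd.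
  by apply: (measurable_mulK H); [exact: measurable_cst|exact: measurable_fst].
have k1 z : normc (k z) = 1 by exact: (normc_chi H).
rewrite (@eq_cintegral _ _ _ _ _ (fun y : borel K => (u y)^* *
   cintegral mu setT (fun xi : borel K => fhat f xi * chi (b * xi) * k (xi, y)))); last first.
  move=> y; congr (_ * _); rewrite -(fourier_inversion H _ tf); apply: eq_cintegral => xi.
  by rewrite -mulrA /k/= -(chiD H); congr (_ * chi _); ring.
rewrite (cintegral_exchange Fchi1 uc1 mk k1); apply: eq_cintegral => xi; congr (_ * _).
rewrite -cintegral_conj; last exact: (inL1_conj_chi H).
by apply: eq_cintegral => y; rewrite /k/= rmorphM/= conjCK.
Qed.

Lemma inL2_fourier u : inL1 mu u -> inL2 mu u -> inL2 mu (fhat u).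
Proof.
move=> u1 u2; split; first exact: (cmeasurable_fourier H).
by rewrite -/(sqL2 mu _) (fourier_plancherel H)//; case: u2.
Qed.

Lemma sqL2_conj f : sqL2 mu (fun x => (f x)^*) = sqL2 mu f.
Proof. by apply: eq_integral => x _; rewrite normc_conjc. Qed.

Lemma sqL2_mul_chi b f : sqL2 mu (fun xi => f xi * chi (b * xi)) = sqL2 mu f.
Proof. by apply: eq_integral => xi _; rewrite normcM (normc_chi H) mulr1. Qed.

Lemma inL2_mul_chi b f : inL2 mu f -> inL2 mu (fun xi => f xi * chi (b * xi)).
Proof.
move=> [mf foo]; split; last by rewrite -/(sqL2 mu _) sqL2_mul_chi.
apply: cmeasurableM => //; apply: (cmeasurable_comp _ (cmeasurable_chi H)).
by apply: (measurable_mulK H) => //; exact: measurable_cst.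
Qed.

(** For fixed [a], [b] and [f], the left side is continuous in [psi] and the right side in [psihat]
    for the $L^2$ norm, and the identity is known for the integrable approximants [u n] and their
    transforms. *)
Lemma wavelet_transform_fourier psi psihat f a b : is_fourierL2 mu chi psi psihat ->
  a != 0 -> test_fun f ->
  W psi f a b = (Num.sqrt (absK a))%:C *
    cintegral mu setT (fun xi => fhat f xi * chi (b * xi) * (psihat (a * xi))^*).
Proof.
move=> [psi2 psihat2 [u [u12 ucvg Fucvg]]] a0 tf.
have f2 := test_fun_inL2 H tf; have tF := test_fun_fourier H tf; have F2 := test_fun_inL2 H tF.
have F'2 := inL2_mul_chi b F2.
set s := Num.sqrt (absK a); have s0 : 0 < s := sqrt_absK_gt0 a0.
have aK0 := absK_gt0 H a0.
pose T (v : K -> R[i]) := cintegral mu setT (fun xi : borel K => fhat f xi * chi (b * xi) * (v (a * xi))^*).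
rewrite -/(T psihat); apply/eqP; rewrite -subr_eq0; apply/eqP/eq0_normc/le_anti.
rewrite normc_ge0 andbT.
pose Nf := fine (sqL2 mu f).
have Nf0 : 0 <= Nf by rewrite fine_ge0// sqL2_ge0.
have NfE : sqL2 mu f = Nf%:E by rewrite fineK// sqL2_fin.
(* With squared errors at most $t^2$ and weight [t], the product bounds give $t N_f + t$ on the left
   and $s(tN_f+|a|^{-1}t)$ on the right; the sum is [C * t], hence [t := e / C]. *)
pose C := (1 + s) * Nf + (1 + s * (absK a)^-1).
have C0 : 0 < C by rewrite ltr_wpDl ?mulr_ge0 ?addr_ge0 ?ltr_wpDr ?invr_ge0 ?mulr_ge0 ?invr_ge0// ltW.
apply/ler_addgt0Pr => e e0; rewrite add0r.
pose t := e / C; have t0 : 0 < t by rewrite divr_gt0.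
have [n un Fun] : exists2 n, (sqL2 mu (fun x => u n x - psi x)%R <= (t ^+ 2)%:E)%E &
    (sqL2 mu (fun x => fhat (u n) x - psihat x)%R <= (t ^+ 2)%:E)%E.
  have : (fun n => sqL2 mu (fun x => u n x - psi x)%R + sqL2 mu (fun x => fhat (u n) x - psihat x)%R)%E @ \oo --> 0%E.
    by rewrite -[X in _ --> X]adde0; apply: cvgeD.
  move=> /(cvg0_exists_le (exprn_gt0 2 t0))[n hn]; exists n.
    by apply: le_trans hn; rewrite leeDl// sqL2_ge0.
  by apply: le_trans hn; rewrite leeDr// sqL2_ge0.
have [u1 u2] := u12 n; have Fu2 := inL2_fourier u1 u2.
have -> : W psi f a b - s%:C * T psihat = (W psi f a b - W (u n) f a b) -
    s%:C * (T psihat - T (fhat (u n))).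
  by rewrite (wavelet_transform_fourier_L1 _ a0 tf u1) -/s -/(T _); ring.
apply: (le_trans (le_normcD _ _)); rewrite normcN normcM normc_real (ger0_norm (ltW s0)).
have d2 v : inL2 mu v -> inL2 mu (fun x => (dilated absK v a b x)^*).
  by move=> v2; apply: inL2_conj; exact: inL2_dilated.
have B1 : normc (W psi f a b - W (u n) f a b) <= t * Nf + t.
  have du2 := inL2B psi2 u2.
  have -> : W psi f a b - W (u n) f a b = L2dot mu f (dilated absK (fun x => psi x - u n x) a b).
    rewrite /wavelet_transform /L2dot -cintegralB; [|exact: inL1_mul (d2 _ _)..].
    by apply: eq_cintegral => x; rewrite dilatedB rmorphB mulrBr.
  rewrite -lee_fin; apply: (le_trans (normc_cintegral_mul_le t0 f2 (d2 _ du2))).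
  rewrite sqL2_conj sqL2_dilated// sqL2_subC NfE EFinD EFinM leeD2l//.
  apply: (@le_trans _ _ (t^-1%:E * (t ^+ 2)%:E)%E).
    by apply: lee_wpmul2l => //; rewrite lee_fin invr_ge0 ltW.
  by rewrite -EFinM lee_fin expr2 mulKf// gt_eqF.
have B2 : normc (T psihat - T (fhat (u n))) <= t * Nf + (absK a)^-1 * t.
  have dF2 := inL2B psihat2 Fu2.
  have aff v : inL2 mu v -> inL2 mu (fun xi => (v (a * xi))^*).
    move=> v2; have := inL2_conj (inL2_affine H 0 a0 v2); congr inL2.
    by apply/funext => xi; rewrite addr0.
  have -> : T psihat - T (fhat (u n)) = cintegral mu setT (fun xi : borel K =>
      fhat f xi * chi (b * xi) * (psihat (a * xi) - fhat (u n) (a * xi))^*).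
    rewrite -cintegralB; [|exact: inL1_mul (aff _ _)..].
    by apply: eq_cintegral => xi; rewrite rmorphB mulrBr.
  rewrite -lee_fin; apply: (le_trans (normc_cintegral_mul_le t0 F'2 (aff _ dF2))).
  rewrite sqL2_mul_chi (test_fun_parseval H tf) sqL2_conj.
  have := sqL2_affine H 0 a0 dF2.1; under [X in sqL2 _ X]eq_fun do rewrite addr0.
  move=> ->; rewrite sqL2_subC NfE EFinD EFinM leeD2l//.
  apply: (@le_trans _ _ (t^-1%:E * ((absK a)^-1%:E * (t ^+ 2)%:E))%E).
    by do 2 (apply: lee_wpmul2l => //; first by rewrite lee_fin invr_ge0 ltW).
  by rewrite -!EFinM lee_fin mulrCA expr2 mulKf// gt_eqF.
apply: (le_trans (lerD B1 (ler_wpM2l (ltW s0) B2))).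
rewrite (_ : _ + _ = C * t); last by rewrite /C; ring.
by rewrite /t mulrC divfK// gt_eqF.
Qed.

End wavelet.

Section bounded_mul.
Context {d : measure_display} {T : measurableType d} {R : realType}.
Context (m : {measure set T -> \bar R}).

Lemma inL2_bounded_mul (M : R) (f g : T -> R[i]) : cmeasurable setT g ->
  (forall x, normc (g x) <= M) -> inL2 m f -> inL2 m (fun x => g x * f x).
Proof.
move=> mg gM [mf foo]; split; first exact: cmeasurableM.
apply: (@le_lt_trans _ _ (sqL2 m (fun x => M%:C * f x))); last first.
  by rewrite sqL2Z// lte_mul_pinfty// lee_fin sqr_ge0.
have M0 : 0 <= M by exact: le_trans (normc_ge0 _) (gM point).
apply: ge0_le_integral => //.
- by move=> x _; rewrite lee_fin sqr_ge0.
- by apply: measurable_sqL2; exact: cmeasurableM.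
- by apply: measurable_sqL2; apply: cmeasurableM => //; exact: cmeasurable_cst.
- move=> x _; rewrite lee_fin ler_pXn2r// ?nnegrE ?normc_ge0// !normcM.
  by rewrite normc_real ger0_norm// ler_wpM2r// normc_ge0.
Qed.

End bounded_mul.

(** * The wavelet isometry on test functions *)

Section isometry.
Context {R : realType} {K : localFieldType}.
Context {mu : {sigma_finite_measure set (borel K) -> \bar R}} {absK : K -> R} {chi : K -> R[i]}.
Context (H : normalized_haar mu absK chi).
Local Notation fhat := (@fourierL1 R K mu chi).
Local Notation test_fun := (@test_fun R K absK).
Local Notation W := (@wavelet_transform R K mu absK).
Implicit Types (a b x y xi : K) (u f g : K -> R[i]).
Context (psi psihat : K -> R[i]) (psiP : admissible_wavelet mu absK chi psi psihat).
Local Notation c_psi := (admissibility_constant mu absK psihat).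

Let psi2 : inL2 mu psi. Proof. by case: psiP => -[]. Qed.
Let psihat2 : inL2 mu psihat. Proof. by case: psiP => -[]. Qed.

(** Conjugation turns the inverse transform in [b] into the forward transform of [h], to which
    Plancherel applies: [h] is integrable as a product of two $L^2$ functions, and square integrable
    because [fhat f] is bounded. *)
Lemma sqL2_wavelet_slice f a : a != 0 -> test_fun f ->
  sqL2 mu (fun b => W psi f a b) =
  ((absK a)%:E * \int[mu]_xi (normc (fhat f xi) ^+ 2 * normc (psihat (a * xi)%R) ^+ 2)%:E)%E.
Proof.
move=> a0 tf; have tF := test_fun_fourier H tf; have F2 := test_fun_inL2 H tF.
pose h (xi : borel K) := (fhat f xi)^* * psihat (a * xi).
have pa2 : inL2 mu (fun xi => psihat (a * xi)).
  have := inL2_affine H 0 a0 psihat2; congr inL2; apply/funext => xi.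
  by rewrite addr0.
have h1 : inL1 mu h by apply: inL1_mul => //; exact: inL2_conj.
have h2 : inL2 mu h.
  case: (tF) => e [M [_ _ FM]]; apply: (@inL2_bounded_mul _ _ _ mu M) => //.
    by apply: cmeasurable_conj; case: F2.
  by move=> x; rewrite normc_conjc.
have WE : (fun b => W psi f a b) = (fun b => (Num.sqrt (absK a))%:C * (fhat h b)^*).
  apply/funext => b; rewrite (wavelet_transform_fourier H b psiP.1 a0 tf); congr (_ * _).
  rewrite -cintegral_conj; last exact: (inL1_conj_chi H).
  apply: eq_cintegral => xi; rewrite /h !rmorphM/= !conjCK [b * xi]mulrC; ring.
rewrite WE sqL2Z; last by apply: cmeasurable_conj; exact: (cmeasurable_fourier H).
rewrite normc_real ger0_norm// sqr_sqrtr ?(absK_ge0 H)//; congr (_ * _)%E.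
rewrite sqL2_conj (fourier_plancherel H h1 h2); apply: eq_integral => xi _.
by rewrite /h normcM normc_conjc exprMn.
Qed.

Let dens2 (p : borel K * borel K) : R := (absK p.1 ^+ 2)^-1.

Let dens2_ge0 p : 0 <= dens2 p.
Proof. by rewrite invr_ge0 sqr_ge0. Qed.

Let measurable_absKV d (T : measurableType d) (h : T -> borel K) : measurable_fun setT h ->
  measurable_fun setT (fun t => (absK (h t))^-1).
Proof.
move=> mh; rewrite (_ : (fun t => _) = (fun t => absK (h t)^-1)).
  have mi := measurableT_comp (@measurable_invK K) mh.
  exact: (measurableT_comp (measurable_absK H) mi).
by apply/funext => t; rewrite (absKV H).
Qed.

Let measurable_dens2 : measurable_fun setT dens2.
Proof.
rewrite (_ : dens2 = (fun p => (absK p.1)^-1 ^+ 2)).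
  by apply: measurable_funX; apply: measurable_absKV; exact: measurable_fst.
by apply/funext => p; rewrite exprVn.
Qed.

Definition wavelet_density : {measure set (borel K * borel K) -> \bar R} :=
  density_measure (mu \x mu)%E measurable_dens2 dens2_ge0.

(** The density takes the value $0^{-1}=0$ on $a=0$, so integrating over the whole product adds
    nothing. *)
Lemma wavelet_measureE : wavelet_measure mu absK = wavelet_density.
Proof.
apply/funext => A; rewrite /wavelet_measure /wavelet_density /density_measure /= /dens.
rewrite integral_mkcondr; apply: eq_integral => p _.
rewrite patchE; case: ifPn => // p0.
have {p0} : p.1 = 0.
  by apply/eqP; apply: contraNT p0 => p0; rewrite inE.
by rewrite /dens2 => ->; rewrite (absK0 H) expr0n/= invr0.
Qed.

Lemma integral_wavelet_orbit xi : xi != 0 ->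
  (\int[mu]_a ((absK a)^-1 * normc (psihat (a * xi)%R) ^+ 2)%:E = c_psi)%E.
Proof.
move=> xi0; have [mp _] := psihat2; have axi0 := absK_gt0 H xi0.
pose k (eta : borel K) : \bar R := ((absK eta)^-1 * normc (psihat eta) ^+ 2)%:E.
have mk : measurable_fun setT k.
  apply/measurable_EFinP; apply: measurable_funM; last exact: measurable_sqr_normc.
  by apply: measurable_absKV; exact: measurable_id.
have k0 eta : (0 <= k eta)%E by rewrite lee_fin mulr_ge0 ?sqr_ge0// invr_ge0 (absK_ge0 H).
have -> : c_psi = (\int[mu]_eta k eta)%E.
  rewrite /admissibility_constant integral_mkcond; apply: eq_integral => eta _.
  rewrite patchE /k mulrC; case: ifPn => // eta0.
  have {eta0} -> : eta = 0 by apply/eqP; apply: contraNT eta0 => eta0; rewrite inE.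
  by rewrite (absK0 H) invr0 ?mulr0 ?mul0r.
have := ge0_integral_affine H 0 xi0 mk k0.
move=> /(congr1 (fun r => (absK xi)%:E * r)%E); rewrite muleA -EFinM divff ?gt_eqF// mul1e => <-.
rewrite -ge0_integralZl//; last 2 first.
- exact: (measurableT_comp mk (measurable_affine H xi 0)).
- by rewrite lee_fin ltW.
apply: eq_integral => a _; rewrite /k addr0 -EFinM (absKM H) invfM -mulrA.
by rewrite mulVKf ?gt_eqF// [xi * a]mulrC.
Qed.

Lemma sqL2_wavelet_test f : test_fun f ->
  sqL2 wavelet_density (fun p => W psi f p.1 p.2) = (c_psi * sqL2 mu f)%E.
Proof.
move=> tf; have f2 := test_fun_inL2 H tf; have tF := test_fun_fourier H tf.
have [mF _] := test_fun_inL2 H tF; have [mf _] := f2; have [mp _] := psi2; have [mph _] := psihat2.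
have mW := cmeasurable_wavelet H mp mf.
have mEdens : measurable_fun setT (fun p => (dens2 p)%:E) by exact/measurable_EFinP.
rewrite /sqL2 ge0_integral_density; last 2 first.
- exact: measurable_sqL2.
- by move=> p; rewrite lee_fin sqr_ge0.
rewrite (fubini_tonelli1 (fun p : borel K * borel K => (normc (W psi f p.1 p.2) ^+ 2)%:E * (dens2 p)%:E)%E); last 2 first.
- by apply: emeasurable_funM => //; exact: measurable_sqL2.
- by move=> p; rewrite mule_ge0// lee_fin ?sqr_ge0.
(* Plancherel on the slice at [a] contributes $|a|$, turning the weight $|a|^{-2}$ into $|a|^{-1}$;
   at [a = 0] both sides vanish. *)
pose k (p : borel K * borel K) : R :=
  (absK p.1)^-1 * (normc (fhat f p.2) ^+ 2 * normc (psihat (p.1 * p.2)) ^+ 2).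
have mk : measurable_fun setT k.
  apply: measurable_funM; first by apply: measurable_absKV; exact: measurable_fst.
  apply: measurable_funM.
    by apply: measurable_sqr_normc; exact: (cmeasurable_comp measurable_snd mF).
  apply: measurable_sqr_normc; apply: (cmeasurable_comp _ mph).
  by apply: (measurable_mulK H); [exact: measurable_fst|exact: measurable_snd].
have k0 p : 0 <= k p by rewrite mulr_ge0 ?invr_ge0 ?(absK_ge0 H)// mulr_ge0 ?sqr_ge0.
have mpa a : cmeasurable setT ((fun xi => psihat (a * xi)) : borel K -> R[i]).
  apply: (cmeasurable_comp _ mph); apply: (measurable_mulK H) => //; exact: measurable_cst.
transitivity (\int[mu]_a \int[mu]_xi (k (a, xi))%:E)%E.
  apply: eq_integral => a _.
  transitivity (\int[mu]_b ((normc (W psi f a b) ^+ 2)%:E * ((absK a ^+ 2)^-1)%:E))%E; first by [].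
  have [->|a0] := eqVneq a 0.
    rewrite [LHS]integral0_eq; last by move=> b _; rewrite (absK0 H) expr0n/= invr0 mule0.
    by rewrite integral0_eq// => xi _; rewrite /k/= (absK0 H) invr0 mul0r.
  have aK0 := absK_gt0 H a0.
  have mWa : cmeasurable setT ((fun b => W psi f a b) : borel K -> R[i]).
    exact: (cmeasurable_comp (measurable_pair1 a) mW).
  rewrite ge0_integralZr//; last 3 first.
  - exact: measurable_sqL2.
  - by move=> b _; rewrite lee_fin sqr_ge0.
  - by rewrite lee_fin invr_ge0 sqr_ge0.
  rewrite -/(sqL2 mu (fun b => W psi f a b)) sqL2_wavelet_slice// muleC muleA -EFinM.
  have -> : (absK a ^+ 2)^-1 * absK a = (absK a)^-1 by rewrite expr2 invfM divfK// gt_eqF.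
  rewrite -ge0_integralZl//.
  - apply/measurable_EFinP; apply: measurable_funM; exact: measurable_sqr_normc.
  - by move=> xi _; rewrite lee_fin mulr_ge0 ?sqr_ge0.
  - by rewrite lee_fin invr_ge0 ltW.
rewrite (@fubini_tonelli _ _ _ _ R mu mu (EFin \o k)); last 2 first.
- exact/measurable_EFinP.
- by move=> p; rewrite lee_fin.
have mG : measurable_fun setT (fun xi : borel K => \int[mu]_a (k (a, xi))%:E)%E.
  apply: (measurable_fun_fubini_tonelli_G (EFin \o k)); first exact/measurable_EFinP.
  by move=> p; rewrite lee_fin.
have c0 : (0 <= c_psi)%E.
  by apply: integral_ge0 => xi _; rewrite lee_fin mulr_ge0 ?sqr_ge0// invr_ge0 (absK_ge0 H).
transitivity (\int[mu]_xi (c_psi * (normc (fhat f xi) ^+ 2)%:E))%E.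
  (* The inner integral is evaluated by [integral_wavelet_orbit] except at [xi = 0], a null
     point. *)
  apply: ge0_ae_eq_integral => //.
  - by apply: measurable_funeM; exact: measurable_sqL2.
  - by move=> xi _; apply: integral_ge0 => a _; rewrite lee_fin.
  - by move=> xi _; rewrite mule_ge0// lee_fin sqr_ge0.
  exists [set 0]; split.
  - by apply: closed_measurableK; exact: (@localfield_closed1 K 0).
  - exact: (haar_set0 H).
  move=> xi h; apply/eqP; apply: contra_notT h => xi0 _.
  rewrite -(integral_wavelet_orbit xi0) muleC -ge0_integralZl//; last 3 first.
  - apply/measurable_EFinP; apply: measurable_funM; first by apply: measurable_absKV; exact: measurable_id.
    apply: measurable_sqr_normc; apply: (cmeasurable_comp _ mph).
    by apply: (measurable_mulK H) => //; exact: measurable_cst.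
  - by move=> a _; rewrite lee_fin mulr_ge0 ?sqr_ge0// invr_ge0 (absK_ge0 H).
  - by rewrite lee_fin sqr_ge0.
  by apply: eq_integral => a _; rewrite -EFinM /k/= mulrCA.
rewrite ge0_integralZl//; last 2 first.
- exact: measurable_sqL2.
- by move=> xi _; rewrite lee_fin sqr_ge0.
by rewrite -/(sqL2 mu (fhat f)) (test_fun_parseval H tf).
Qed.

End isometry.

(** Product measures and Tonelli use the bundled sigma-finite structure, whereas sigma-finiteness of
    Haar measure is a derived fact; an equality of measures allows rewriting one into the other. *)
Lemma sigma_finite_measure_of d (T : measurableType d) (R : realType)
    (m : {measure set T -> \bar R}) : sigma_finite setT m ->
  exists m' : {sigma_finite_measure set T -> \bar R}, (m' : {measure set T -> \bar R}) = m.
Proof.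
move=> sf.
pose sfin := @isSFinite.Build d T R m (sfinite_measure_sigma_finite sf).
pose sfin2 := @isSigmaFinite.Build d T R m sf.
pose m' : {sigma_finite_measure set T -> \bar R} := HB.pack (Measure.sort m) sfin sfin2.
exists m'.
by case: m sf @sfin @sfin2 @m' => m [].
Qed.

Section complex_density.
Context {d : measure_display} {T : measurableType d} {R : realType}.
Context (m : {measure set T -> \bar R}) (h : T -> R).
Context (mh : measurable_fun setT h) (h0 : forall x, 0 <= h x).
Local Notation hm := (density_measure m mh h0).

Lemma inL1_density (f : T -> R[i]) : inL1 hm f -> inL1 m (fun x => f x * (h x)%:C).
Proof.
move=> [mf foo]; split.
  by apply: cmeasurableM => //; exact: cmeasurable_real.
move: foo; rewrite ge0_integral_density.
- congr (_ < _)%E; apply: eq_integral => x _.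
  by rewrite normcM normc_real ger0_norm// EFinM.
- by apply/measurable_EFinP; exact: measurable_normc.
- by move=> x; rewrite lee_fin normc_ge0.
Qed.

(** As $h\ge0$, multiplication by [h] commutes with positive and negative parts, which reduces the
    claim to [ge0_integral_density]. *)
Lemma cintegral_density (f : T -> R[i]) : cmeasurable setT f ->
  cintegral hm setT f = cintegral m setT (fun x => f x * (h x)%:C).
Proof.
move=> [mre mim].
have key (k : T -> R) : measurable_fun setT k ->
    (\int[hm]_x (k x)%:E = \int[m]_x (k x * h x)%:E)%E.
  move=> mk; have mEk : measurable_fun setT (EFin \o k) by exact/measurable_EFinP.
  rewrite [LHS]integralE [RHS]integralE; congr (_ - _)%E.
    rewrite ge0_integral_density//; last exact: measurable_funepos.
    apply: eq_integral => x _; rewrite !funeposE -!EFin_max -EFinM; congr (_%:E).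
    by rewrite maxr_pMl// mul0r.
  rewrite ge0_integral_density//; last exact: measurable_funeneg.
  apply: eq_integral => x _; rewrite !funenegE -!EFinN -!EFin_max -EFinM; congr (_%:E).
  by rewrite maxr_pMl// mul0r mulNr.
rewrite /cintegral !key//; congr (fine _ +i* fine _); apply: eq_integral => x _; congr (_%:E);
  by case: (f x) => a b /=; ring.
Qed.

End complex_density.

(** * Extension to all of $L^2$ and inner products *)

Section wavelet_isometry.
Context {R : realType} {K : localFieldType}.
Context {mu : {sigma_finite_measure set (borel K) -> \bar R}} {absK : K -> R} {chi : K -> R[i]}.
Context (H : normalized_haar mu absK chi).
Local Notation W := (@wavelet_transform R K mu absK).
Implicit Types (a b x y xi : K) (u f g : K -> R[i]).
Context (psi psihat : K -> R[i]) (psiP : admissible_wavelet mu absK chi psi psihat).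
Local Notation c_psi := (admissibility_constant mu absK psihat).
Local Notation nu := (@wavelet_density R K mu absK chi H).

Let psi2 : inL2 mu psi. Proof. by case: psiP => -[]. Qed.

Let c_ge0 : (0 <= c_psi)%E.
Proof.
by apply: integral_ge0 => xi _; rewrite lee_fin mulr_ge0 ?sqr_ge0// invr_ge0 (absK_ge0 H).
Qed.

Let c_fin : (fine c_psi)%:E = c_psi.
Proof. by rewrite fineK// ge0_fin_numE//; case: psiP. Qed.

(** Supplies the pointwise convergence that [sqL2_limit] asks for, by the weighted product bound
    against the dilated wavelet. *)
Lemma wavelet_transform_cvg f (g : nat -> K -> R[i]) a b : inL2 mu f ->
  (forall n, inL2 mu (g n)) ->
  (forall n, (sqL2 mu (fun x => g n x - f x)%R <= (n.+1%:R^-1)%:E)%E) ->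
  (fun n => normc (W psi (g n) a b - W psi f a b)) @ \oo --> (0 : R).
Proof.
move=> f2 g2 gf; have d2 := inL2_conj (inL2_dilated H a b psi2).
pose P := fine (sqL2 mu (fun x => (dilated absK psi a b x)^*)).
have P0 : 0 <= P by rewrite fine_ge0// sqL2_ge0.
apply/cvgr0Pnorm_le => e e0.
(* Then $t^{-1}(P+1)=e/2$, and a large [n] brings the other term below $e/2$; [P + 1] keeps [t]
   positive. *)
pose t := 2 * (P + 1) / e.
have t0 : 0 < t by rewrite divr_gt0// mulr_gt0// ltr_wpDl.
have e2t : 0 < e / 2 / t by apply: divr_gt0 => //; exact: divr_gt0.
near=> n; rewrite ger0_norm ?normc_ge0// -(wavelet_transformB H)//.
rewrite -lee_fin; apply: (le_trans (normc_cintegral_mul_le t0 (inL2B (g2 n) f2) d2)).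
rewrite (_ : e%:E = (t%:E * (e / 2 / t)%:E + t^-1%:E * (P + 1)%:E)%E); last first.
  by rewrite -!EFinM -EFinD /t; congr (_%:E); field; rewrite !gt_eqF// ltr_wpDl.
apply: leeD.
  apply: lee_wpmul2l; first by rewrite lee_fin ltW.
  apply: (le_trans (gf n)); rewrite lee_fin ltW//.
  by near: n; exact: (near_infty_natSinv_lt (PosNum e2t)).
apply: lee_wpmul2l; first by rewrite lee_fin invr_ge0 ltW.
by rewrite -(fineK (sqL2_fin d2)) lee_fin lerDl.
Unshelve. all: by end_near. Qed.

Theorem wavelet_isometry f : inL2 mu f ->
  sqL2 nu (fun p => W psi f p.1 p.2) = ((fine c_psi)%:E * sqL2 mu f)%E.
Proof.
move=> f2; have [g [tg gf]] := test_fun_dense_L2 H f2.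
have g2 n := test_fun_inL2 H (tg n).
have mW h : inL2 mu h -> cmeasurable setT (fun p : borel K * borel K => W psi h p.1 p.2).
  by move=> h2; apply: (cmeasurable_wavelet H); [case: psi2|case: h2].
apply: (@sqL2_limit _ _ _ _ R nu mu _ _ (fun n p => W psi (g n) p.1 p.2) f g) => //.
- by rewrite fine_ge0.
- exact: mW.
- by move=> n; exact: mW.
- by move=> p; exact: wavelet_transform_cvg.
- by move=> n; rewrite c_fin (sqL2_wavelet_test H psiP (tg n)).
- move=> k l; rewrite c_fin -(sqL2_wavelet_test H psiP (test_funB (tg k) (tg l))).
  by congr sqL2; apply/funext => p; rewrite (wavelet_transformB H).
Qed.

Lemma inL2_wavelet f : inL2 mu f -> inL2 nu (fun p => W psi f p.1 p.2).
Proof.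
move=> f2; split; first by apply: (cmeasurable_wavelet H); [case: psi2|case: f2].
rewrite -/(sqL2 nu _) wavelet_isometry// lte_mul_pinfty// ?lee_fin ?fine_ge0//.
by case: f2.
Qed.

Lemma L2dot_wavelet f g : inL2 mu f -> inL2 mu g ->
  L2dot nu (fun p => W psi f p.1 p.2) (fun p => W psi g p.1 p.2) =
  (fine c_psi)%:C * L2dot mu f g.
Proof.
move=> f2 g2; have ig2 := inL2Z 'i g2.
apply: (polarization (inL2_wavelet f2) (inL2_wavelet g2) f2 g2
  (wavelet_isometry f2) (wavelet_isometry g2)).
- rewrite -(wavelet_isometry (inL2D f2 g2)); congr sqL2; apply/funext => p.
  have := wavelet_transform_comb H 1 p.1 p.2 psi2 f2 g2; rewrite mul1r => <-.
  by congr (W psi _ _ _); apply/funext => x; rewrite mul1r.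
- rewrite -(wavelet_isometry (inL2D f2 ig2)); congr sqL2; apply/funext => p.
  by rewrite -(wavelet_transform_comb H _ _ _ psi2 f2 g2).
Qed.

(** A product of two $L^2$ coefficients is integrable for the weighted measure, so Fubini applies
    with [b] outside; the restriction to $a\ne0$ matches the zero value of the density at $a=0$. *)
Lemma iterated_wavelet f g : inL2 mu f -> inL2 mu g ->
  cintegral mu setT (fun b => cintegral mu [set a | a != 0] (fun a =>
    W psi f a b * (W psi g a b)^* / (absK a ^+ 2)%:C)) =
  (fine c_psi)%:C * L2dot mu f g.
Proof.
move=> f2 g2; rewrite -L2dot_wavelet// /L2dot.
have fg1 := inL1_mul (inL2_wavelet f2) (inL2_conj (inL2_wavelet g2)).
have [mfg _] := fg1; rewrite /wavelet_density in fg1 *.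
rewrite (cintegral_density _ _ _ mfg) -(cfubini21 (inL1_density fg1)).
have invC (r : R) : (r%:C)^-1 = (r^-1)%:C by rewrite -fmorphV.
apply: eq_cintegral => b; rewrite /cintegral; congr (fine _ +i* fine _);
  rewrite integral_mkcond; apply: eq_integral => a _; rewrite patchE;
  (case: ifPn => [_|a0]; first by rewrite invC);
  (have -> : a = 0 by apply/eqP; apply: contraNT a0 => a0; rewrite inE);
  by rewrite (absK0 H) expr0n invr0 mulr0.
Qed.

End wavelet_isometry.

Theorem theorem4p1 (R : realType) (K : localFieldType)
    (mu : {measure set (borel K) -> \bar R})
    (absK : K -> R) (chi : K -> R[i])
    (mu_haar : is_haar mu)
    (absKP : is_absolute_value mu absK)
    (mu_normalized : mu (ringD absK) = 1%E)
    (chiP : is_basic_character absK chi)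
    (psi psihat : K -> R[i])
    (psiP : admissible_wavelet mu absK chi psi psihat)
    (f g : K -> R[i]) (fL2 : inL2 mu f) (gL2 : inL2 mu g) :
  let W h := wavelet_transform mu absK psi h in
  let W2 h := (fun p : borel K * borel K => W h p.1 p.2) in
  let nu := wavelet_measure mu absK in
  let c_psi := fine (admissibility_constant mu absK psihat) in
  [/\ inL2 nu (W2 f) /\ inL2 nu (W2 g),
      L2dot nu (W2 f) (W2 g) = c_psi%:C * L2dot mu f g
    & cintegral mu setT (fun b =>
        cintegral mu [set a | a != 0] (fun a =>
          W f a b * (W g a b)^* / (absK a ^+ 2)%:C)) =
      c_psi%:C * L2dot mu f g].
Proof.
have H : normalized_haar mu absK chi by split.
(* [mu] is replaced everywhere by an equal measure carrying the sigma-finite structure. *)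
have [mus musE] := sigma_finite_measure_of (haar_sigma_finite H).
move: H psiP fL2 gL2; rewrite -musE => H psiP fL2 gL2 W W2 nu c_psi.
rewrite /nu (wavelet_measureE H); split.
- by split; [exact: (inL2_wavelet H psiP fL2)|exact: (inL2_wavelet H psiP gL2)].
- exact: (L2dot_wavelet H psiP fL2 gL2).
- exact: (iterated_wavelet H psiP fL2 gL2).
Qed.
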